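(* For each $n\ge 1$ let $\lambda$ be a random partition of $n$ distributed according to the Gelfand measure $\mathbb{G}_n$, let $\lambda^{*}$ be its rescaled shape, and let $\Omega$ be the Logan-Shepp-Kerov-Vershik curve. For the topology of uniform convergence, the rescaled shapes $\lambda^{*}$ converge in probability towards $\Omega$: $$\forall \varepsilon>0,\qquad \mathbb{G}_{n}\big[\|\lambda^{*}-\Omega\|_{\infty}\geq \varepsilon\big]\;\longrightarrow\;0\quad\text{as } n\to\infty,$$ where $\|\cdot\|_\infty$ is the supremum norm on $\mathbb{R}$.
   Context: For a partition $\lambda$ of $n$, $\dim\lambda$ is the dimension of the irreducible complex representation of the symmetric group $\mathfrak{S}_n$ labelled by $\lambda$ (the number of standard Young tableaux of shape $\lambda$). The Gelfand measure $\mathbb{G}_n$ is the probability measure on the set of partitions of $n$ given by $\mathbb{G}_n[\lambda]=\dim\lambda\,/\sum_{|\mu|=n}\dim\mu$. The Young diagram of $\lambda$ is identified with a function $s\mapsto\lambda(s)$ on $\mathbb{R}$, the upper boundary of the diagram rotated by 45 degrees: the region $\{(s,t): |s|\le t\le \lambda(s)\}$ is the union, over the boxes $(i,j)$ with $1\le j\le\lambda_i$, of the images of the unit squares $[j-1,j]\times[i-1,i]$ under the map $(x,y)\mapsto(x-y,x+y)$; $\lambda(s)=|s|$ for $s\le-\ell(\lambda)$ and for $s\ge\lambda_1$. The rescaled shape of a partition $\lambda$ of $n$ is $\lambda^{*}(s)=\lambda(\sqrt n\,s)/\sqrt n$. The Logan-Shepp-Kerov-Vershik curve is $\Omega(s)=\frac{2}{\pi}\left(s\arcsin\frac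 s2+\sqrt{4-s^2}\right)$ if $|s|<2$, and $\Omega(s)=|s|$ if $|s|\ge 2$. *)

(* Defs.v *)
From HB Require Import structures.
From mathcomp Require Import all_boot all_order all_algebra.
From mathcomp Require Import all_classical all_reals all_analysis.

Set Implicit Arguments.
Unset Strict Implicit.
Unset Printing Implicit Defensive.

Import Order.TTheory GRing.Theory Num.Theory.
Import numFieldNormedType.Exports.

Local Open Scope classical_set_scope.
Local Open Scope ring_scope.

(* Rows, columns and parts are indexed from 0.  A partition of n has at most  *)
(* n parts, each at most n; it is padded with zeros to exactly n parts.       *)
Definition is_intpart (n : nat) (f : {ffun 'I_n -> 'I_n.+1}) : bool :=
  [forall i : 'I_n, forall j : 'I_n, (i <= j)%N ==> (f j <= f i)%N] &&
  (\sum_(i < n) f i == n)%N.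

Record intpart (n : nat) := IntPart {
  part :> {ffun 'I_n -> 'I_n.+1};
  _ : is_intpart part
}.

HB.instance Definition _ n := [isSub for @part n].
HB.instance Definition _ n := [Finite of intpart n by <:].

(* b = (i, j) is the box in row i and column j. *)
Definition in_diagram (n : nat) (la : intpart n) (b : 'I_n * 'I_n) : bool :=
  (b.2 < la b.1)%N.

Definition box (n : nat) (la : intpart n) : finType :=
  {b : 'I_n * 'I_n | in_diagram la b}.

Lemma card_box (n : nat) (la : intpart n) : #|{: box la}| = n.
Proof.
rewrite card_sig -sum1_card (eq_bigl (in_diagram la)) //.
rewrite -(pair_big_dep xpredT (fun i j : 'I_n => in_diagram la (i, j))
           (fun _ _ => 1%N)) /=.
case/andP: (valP la) => _ /eqP sla; rewrite -[RHS]sla.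
apply: eq_bigr => i _; rewrite sum1_card /in_diagram /=.
have le_n : (la i <= n)%N by rewrite -ltnS.
rewrite -sum1_card (eq_bigl (fun j : 'I_n => (j < la i)%N)) //.
by rewrite -(big_ord_widen _ (fun=> 1%N) le_n) sum1_card card_ord.
Qed.

(* The entries are 0, ..., n - 1 instead of 1, ..., n.  By card_box, an       *)
(* injective filling of the boxes by 'I_n uses each entry exactly once.       *)
Definition is_syt (n : nat) (la : intpart n) (T : {ffun box la -> 'I_n})
    : bool :=
  [&& injectiveb T,
      [forall b : box la, forall c : box la,
        ((val b).1 == (val c).1) && ((val b).2 < (val c).2)%N
          ==> (T b < T c)%N]
    & [forall b : box la, forall c : box la,
        ((val b).2 == (val c).2) && ((val b).1 < (val c).1)%N
          ==> (T b < T c)%N]].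

Definition dimp (n : nat) (la : intpart n) : nat :=
  #|[pred T : {ffun box la -> 'I_n} | is_syt T]|.

Definition gelfand_pmf (R : realType) (n : nat) (la : intpart n) : R :=
  (dimp la)%:R / (\sum_(mu : intpart n) dimp mu)%:R.

Definition gelfand (R : realType) (n : nat) (A : set (intpart n)) : R :=
  \sum_(la : intpart n | la \in A) gelfand_pmf R la.

Definition rotated_diagram (R : realType) (n : nat) (la : intpart n)
    : set (R * R) :=
  [set p | exists2 b : 'I_n * 'I_n, in_diagram la b &
     exists x y : R,
       [/\ b.2%:R <= x <= b.2%:R + 1,
           b.1%:R <= y <= b.1%:R + 1
         & p = (x - y, x + y)]].

(* Upper boundary of the rotated diagram, completed by the graph of |s|: the  *)
(* term `|s| is what remains when the vertical line at s misses the diagram.  *)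
Definition profile (R : realType) (n : nat) (la : intpart n) (s : R) : R :=
  sup (`|s| |` [set t : R | rotated_diagram la (s, t)]).

Definition rescaled_profile (R : realType) (n : nat) (la : intpart n) (s : R)
    : R :=
  profile la (Num.sqrt n%:R * s) / Num.sqrt n%:R.

Definition LSKV (R : realType) (s : R) : R :=
  if `|s| < 2 then 2 / pi * (s * asin (s / 2) + Num.sqrt (4 - s ^+ 2))
  else `|s|.

Definition sup_norm (R : realType) (f : R -> R) : \bar R :=
  ereal_sup [set `|f s|%:E | s in [set: R]].

(* Main.v *)
(* Let G and H be the Cauchy transforms of the transition measure (add a box  *)
(* to la) and of the cotransition measure of total mass n (remove one).       *)
(* Partial fractions give explicit weights for both and the relation          *)
(* 1 / G(z) = z - H(z).  Integrated against dim la, both transforms become    *)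
(* sums over pairs of partitions of n that differ by the move of one box, and *)
(* the pairs where the box really moves agree.  Hence, under the Gelfand      *)
(* measure, g(s) = sqrt n G(sqrt n s) and H(sqrt n s) / sqrt n are close in   *)
(* L^2, so that g (s - g) ~ 1: g(s) tends in probability to the transform of  *)
(* the semicircle law, for s large.  Since z G(z) is the product over the     *)
(* boxes of (1 - (z - c)^-2)^-1, c being the content, taking logarithms gives *)
(* the limit of the averages over boxes of (s - c / sqrt n)^-2, then, by      *)
(* difference quotients, of the exponent -3.  These are the values for the    *)
(* curve LSKV; extracting Taylor coefficients at s = oo, la* - LSKV becomes   *)
(* negligible against every polynomial.  As it is 2-Lipschitz and, with high  *)
(* probability, supported in a fixed segment, polynomials peaked at the       *)
(* points of a finite grid show that it is uniformly small.                   *)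

Require Import Defs.
From mathcomp Require Import all_boot all_order all_algebra.
From mathcomp Require Import all_classical all_reals all_analysis.
From mathcomp Require Import zify ring lra.
Set Implicit Arguments.
Unset Strict Implicit.
Unset Printing Implicit Defensive.
Import Order.TTheory GRing.Theory Num.Theory.
Import numFieldNormedType.Exports.
Local Open Scope classical_set_scope.
Local Open Scope ring_scope.

(** * Dimensions and the Young graph *)

Section Shapes.
Local Open Scope nat_scope.

(** Under a measure proportional to [dimp], adding a box to a random shape and removing one from it
    are nearly the same operation. By the branching rule, both integrals become sums of dimensions
    over pairs of shapes that differ by the move of one box ([dimp_up_off], [dimp_down_off]); the
    discrepancy comes from the corners, of which there are at most sqrt (2 n) ([ncor_sq],
    [kernel_bound]). Hence the two rescaled transforms [gtr] and [hco] agree in mean square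
    ([trgap_sq_le]). They are tied on each shape by gtr (s - hco) = 1, a consequence of the partial
    fractions [wt_frac] and [nu_frac], so in the limit g (s - g) = 1, and the root that remains is
    [gam] ([gtr_cvg]).

    The other probabilistic input is an exponential tail for the first row and the number of rows
    ([wsum_exp_le]). It is obtained by comparing exponential moments with the recursion [wtotSS] of
    the involution numbers, and confines the shapes to a fixed segment.

    To pass from transforms to shapes, z G(z) is written as a product over the boxes ([Gtr_boxes]);
    logarithm and differentiation in s give the limit of the averages of 2 (s - u)^-3 ([bavg3_cvg]).
    The same number is the integral of LSKV - |u| against (s - u)^-3, found with an explicit
    primitive ([riemann_hs]). So the difference of the curves is negligible against these kernels
    ([Dsum_inv3]), hence, letting s grow, against each monomial ([negligibleX]). Since both curves
    are 1-Lipschitz, a deviation at one point extends to an interval, and a peaked polynomial would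
    detect it ([bump_detects]). *)

Definition rowlen n (la : intpart n) (i : nat) : nat :=
  if insub i is Some j then la j : nat else 0.

Lemma rowlen_ord n (la : intpart n) (i : 'I_n) : rowlen la i = la i.
Proof. by rewrite /rowlen valK. Qed.

Lemma rowlen_ge n (la : intpart n) i : n <= i -> rowlen la i = 0.
Proof. by move=> le_ni; rewrite /rowlen insubF // ltnNge le_ni. Qed.

Lemma rowlen_inj n (la mu : intpart n) : rowlen la =1 rowlen mu -> la = mu.
Proof.
move=> eq_row; apply: val_inj; apply/ffunP => i; apply: val_inj.
by have := eq_row i; rewrite !rowlen_ord.
Qed.

Lemma rowlen_homo n (la : intpart n) i j : i <= j -> rowlen la j <= rowlen la i.
Proof.
move=> le_ij; case: (ltnP j n) => [lt_jn|/rowlen_ge->//].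
have lt_in := leq_ltn_trans le_ij lt_jn.
case/andP: (valP la) => /forallP/(_ (Ordinal lt_in))/forallP/(_ (Ordinal lt_jn)).
rewrite le_ij; have := rowlen_ord la (Ordinal lt_in); have := rowlen_ord la (Ordinal lt_jn).
by move=> /= -> ->.
Qed.

Lemma rowlen_sum n (la : intpart n) N : n <= N -> \sum_(i < N) rowlen la i = n.
Proof.
move=> le_nN; rewrite -(big_mkord xpredT (rowlen la)) (@big_cat_nat _ _ _ n) //=.
rewrite [X in _ + X]big_nat_cond [X in _ + X]big1 ?addn0; last first.
  by move=> i /andP[/andP[/rowlen_ge->]].
rewrite big_mkord; case/andP: (valP la) => _ /eqP sn.
rewrite -[RHS]sn; by apply: eq_bigr => i _; rewrite rowlen_ord.
Qed.

Lemma rowlen_le n (la : intpart n) i : rowlen la i <= n.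
Proof.
case: (ltnP i n) => [lt_in|/rowlen_ge->//].
by rewrite (rowlen_ord la (Ordinal lt_in)) -ltnS.
Qed.

(* The condition sums n + 1 rows: this forces rowlen n to be empty. *)
Lemma rowlen_surj n (r : nat -> nat) :
  (forall i, r i.+1 <= r i) -> \sum_(i < n.+1) r i = n ->
  exists la : intpart n, rowlen la =1 r.
Proof.
move=> r_dec sum_r.
have r_homo : forall i j, i <= j -> r j <= r i.
  move=> i j /subnK<-; elim: (j - i) => // k IH.
  exact: leq_trans (r_dec _) IH.
have rn0 : r n = 0.
  apply/eqP; rewrite -leqn0 leqNgt; apply/negP => rn_gt0.
  suff : n.+1 <= n by rewrite ltnn.
  rewrite -[X in _ <= X]sum_r -[X in X <= _]card_ord -sum1_card.
  apply: leq_sum => i _; apply: leq_trans rn_gt0 (r_homo _ _ _).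
  by rewrite -ltnS.
have r_le i : r i <= n.
  case: (ltnP i n.+1) => [lt_in|/ltnW/r_homo]; last by rewrite rn0 leqn0 => /eqP->.
  by rewrite -[X in _ <= X]sum_r (bigD1 (Ordinal lt_in)) //= leq_addr.
pose f := [ffun i : 'I_n => inord (r i) : 'I_n.+1].
have fE i : f i = r i :> nat by rewrite ffunE inordK // ltnS.
have f_part : is_intpart f.
  apply/andP; split.
    apply/forallP => i; apply/forallP => j; apply/implyP => le_ij.
    by rewrite !fE r_homo.
  move: sum_r; rewrite big_ord_recr /= rn0 addn0 => sn.
  apply/eqP; rewrite -[RHS]sn; by apply: eq_bigr => i _; rewrite fE.
exists (IntPart f_part) => i; case: (ltnP i n) => [lt_in|le_ni].
  by rewrite (rowlen_ord _ (Ordinal lt_in)) /= fE.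
by rewrite rowlen_ge //; apply/esym/eqP; rewrite -leqn0 -rn0 r_homo.
Qed.

Definition addable (r : nat -> nat) (i : nat) : bool :=
  (i == 0) || (r i < r i.-1).
Definition removable (r : nat -> nat) (i : nat) : bool := r i.+1 < r i.

(** The edges of the Young graph, labelled by the row of the new box. Only the rows up to [n] are
    compared, which keeps the relation boolean; [edgeP] removes the bounds. *)
Definition edge n (mu : intpart n) (la : intpart n.+1) (i : nat) : bool :=
  (i <= n) && [forall k : 'I_n.+1, rowlen la k == rowlen mu k + (k == i :> nat)].

Lemma edgeP n (mu : intpart n) (la : intpart n.+1) i :
  reflect (forall k, rowlen la k = rowlen mu k + (k == i)) (edge mu la i).
Proof.
apply: (iffP andP) => [[le_in /forallP h] k|h].
  case: (ltnP k n.+1) => [lt_kn|le_nk]; first exact/eqP/(h (Ordinal lt_kn)).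
  rewrite !rowlen_ge ?(ltnW le_nk) // gtn_eqF //; exact: leq_ltn_trans le_nk.
split; last by apply/forallP => k; apply/eqP.
rewrite leqNgt; apply/negP => lt_ni; move: (h i).
by rewrite eqxx !rowlen_ge // ltnW.
Qed.

Lemma edge_le n (mu : intpart n) la i : edge mu la i -> i <= n.
Proof. by case/andP. Qed.

Lemma edge_add n (mu : intpart n) la i : edge mu la i -> addable (rowlen mu) i.
Proof.
move=> /edgeP h; case: i h => // i h; rewrite /addable /=.
have := rowlen_homo la (leqnSn i).
by rewrite !h eqxx (ltn_eqF (ltnSn i)) addn0 addn1.
Qed.

Lemma edge_rem n (mu : intpart n) la i : edge mu la i -> removable (rowlen la) i.
Proof.
move=> /edgeP h; rewrite /removable !h eqxx (gtn_eqF (ltnSn i)) addn0 addn1 ltnS.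
exact: rowlen_homo.
Qed.

Lemma edge_up n (mu : intpart n) i :
  addable (rowlen mu) i -> exists la, edge mu la i.
Proof.
move=> add_i.
have le_in : i <= n.
  case: i add_i => //= i; rewrite /addable /= => h.
  rewrite ltnNge; apply/negP => /rowlen_ge h'; by rewrite h' in h.
have [||la laE] := @rowlen_surj n.+1 (fun k => rowlen mu k + (k == i)).
- move=> k; have := rowlen_homo mu (leqnSn k).
  case: (eqVneq k.+1 i) add_i => [<-|_ _]; rewrite /addable /=.
    by rewrite (ltn_eqF (ltnSn k)); lia.
  by lia.
- rewrite big_split /= rowlen_sum ?leqnSn // 1?ltnW //.
  have lt_i : i < n.+2 by rewrite ltnS leqW.
  rewrite (bigD1 (Ordinal lt_i)) //= eqxx big1 ?addn0 ?addn1 // => k.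
  by rewrite -val_eqE /= => /negbTE->.
- by exists la; apply/edgeP.
Qed.

Lemma edge_down n (la : intpart n.+1) i :
  removable (rowlen la) i -> exists mu, edge mu la i.
Proof.
move=> rem_i; have lai_gt0 : 0 < rowlen la i by exact: leq_trans rem_i.
have le_in : i <= n.
  by rewrite leqNgt; apply/negP => /rowlen_ge h; rewrite h in lai_gt0.
have [||mu muE] := @rowlen_surj n (fun k => rowlen la k - (k == i)).
- move=> k; have := rowlen_homo la (leqnSn k).
  case: (eqVneq k i) rem_i => [<-|_ _]; rewrite /removable /=.
    by rewrite (gtn_eqF (ltnSn k)); lia.
  by lia.
- have := rowlen_sum la (leqnn _).
  have lt_i : i < n.+1 by rewrite ltnS.
  rewrite (bigD1 (Ordinal lt_i)) //= => sla; rewrite (bigD1 (Ordinal lt_i)) //= eqxx.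
  rewrite (eq_bigr (fun k : 'I_n.+1 => rowlen la k)); last first.
    by move=> k; rewrite -val_eqE /= => /negbTE->; rewrite subn0.
  lia.
- exists mu; apply/edgeP => k; rewrite muE subnK //.
  by case: eqP => // ->.
Qed.

Lemma edge_injl n (mu mu' : intpart n) la i :
  edge mu la i -> edge mu' la i -> mu = mu'.
Proof.
move=> /edgeP h /edgeP h'; apply: rowlen_inj => k.
by apply: (@addIn (k == i)); rewrite -h -h'.
Qed.

Lemma edge_injr n (mu : intpart n) la la' i :
  edge mu la i -> edge mu la' i -> la = la'.
Proof. by move=> /edgeP h /edgeP h'; apply: rowlen_inj => k; rewrite h h'. Qed.

Lemma edge_inji n (mu : intpart n) la i j :
  edge mu la i -> edge mu la j -> i = j.
Proof.
move=> /edgeP h /edgeP /(_ i); rewrite h eqxx => /addnI.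
by case: (eqVneq i j).
Qed.

Lemma addableS r i : addable r i.+1 = removable r i. Proof. by []. Qed.

Lemma removable_lt n (la : intpart n) i : removable (rowlen la) i -> i < n.
Proof.
move=> rem_i; rewrite ltnNge; apply/negP => /rowlen_ge h.
by move: rem_i; rewrite /removable h.
Qed.

Lemma sum_edge_up (V : nmodType) n (mu : intpart n) i (x : V) :
  (\sum_(la : intpart n.+1 | edge mu la i) x =
   if addable (rowlen mu) i then x else 0)%R.
Proof.
case: ifP => [/edge_up[la e_la]|add_i].
  by rewrite (big_pred1 la) // => la'; apply/idP/eqP => [/edge_injr|->//]; exact.
by rewrite big1 // => la /edge_add; rewrite add_i.
Qed.

Lemma sum_edge_down (V : nmodType) n (la : intpart n.+1) i (x : V) :
  (\sum_(mu : intpart n | edge mu la i) x =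
   if removable (rowlen la) i then x else 0)%R.
Proof.
case: ifP => [/edge_down[mu e_mu]|rem_i].
  by rewrite (big_pred1 mu) // => mu'; apply/idP/eqP => [/edge_injl|->//]; exact.
by rewrite big1 // => mu /edge_rem; rewrite rem_i.
Qed.

Lemma is_sytP n (la : intpart n) (T : {ffun box la -> 'I_n}) :
  reflect [/\ injective T,
    forall b c : box la, (val b).1 = (val c).1 -> (val b).2 < (val c).2 -> T b < T c
  & forall b c : box la, (val b).2 = (val c).2 -> (val b).1 < (val c).1 -> T b < T c]
  (is_syt T).
Proof.
apply: (iffP and3P) => -[h1 h2 h3]; split.
- exact/injectiveP.
- move=> b c e l; move/forallP: h2 => /(_ b)/forallP/(_ c)/implyP; apply.
  by rewrite e eqxx.
- move=> b c e l; move/forallP: h3 => /(_ b)/forallP/(_ c)/implyP; apply.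
  by rewrite e eqxx.
- exact/injectiveP.
- by apply/forallP => b; apply/forallP => c; apply/implyP => /andP[/eqP]; apply: h2.
- by apply/forallP => b; apply/forallP => c; apply/implyP => /andP[/eqP]; apply: h3.
Qed.

Lemma in_diagramE n (la : intpart n) b : in_diagram la b = (b.2 < rowlen la b.1).
Proof. by rewrite /in_diagram rowlen_ord. Qed.

Lemma ord_pair_inj m n (b c : 'I_m * 'I_n) :
  b.1 = c.1 :> nat -> b.2 = c.2 :> nat -> b = c.
Proof. by case: b c => b1 b2 [c1 c2] /= /val_inj-> /val_inj->. Qed.

Section Corner.
Variables (n : nat) (mu : intpart n) (la : intpart n.+1) (i : nat).
Hypothesis e_i : edge mu la i.

Let rowE k : rowlen la k = rowlen mu k + (k == i).
Proof. exact/edgeP. Qed.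

Let corner_subproof : in_diagram la (inord i, inord (rowlen mu i)).
Proof.
have le_in := edge_le e_i.
by rewrite in_diagramE /= !inordK ?ltnS ?rowlen_le // rowE eqxx addn1.
Qed.

Definition corner : box la := Sub (inord i, inord (rowlen mu i)) corner_subproof.

Let emb_subproof (b : box mu) :
  in_diagram la (widen_ord (leqnSn n) (val b).1, widen_ord (leqnSn n) (val b).2).
Proof.
rewrite in_diagramE /= rowE; apply: leq_trans (leq_addr _ _).
by have := valP b; rewrite in_diagramE.
Qed.

Definition emb (b : box mu) : box la := Sub _ (emb_subproof b).

Lemma emb_inj : injective emb.
Proof.
move=> b c /(congr1 val)/= [e1 e2]; apply: val_inj.
exact: ord_pair_inj.
Qed.

Lemma emb_corner b : emb b != corner.
Proof.
apply/eqP => /(congr1 val) /=.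
move=> /eqP; rewrite xpair_eqE -!val_eqE /= !inordK ?ltnS ?rowlen_le ?(edge_le e_i) //.
case/andP=> /eqP e1 /eqP e2; have := valP b; rewrite in_diagramE /= e1 e2.
by rewrite ltnn.
Qed.

Lemma box_corner_emb (b : box la) : b = corner \/ exists b', b = emb b'.
Proof.
have := valP b; rewrite in_diagramE rowE.
case: (ltnP (val b).2 (rowlen mu (val b).1)) => [lt_b _|le_b lt_b].
  right.
  have lt1 : (val b).1 < n.
    by rewrite ltnNge; apply/negP => /rowlen_ge h; rewrite h in lt_b.
  have lt2 : (val b).2 < n := leq_trans lt_b (rowlen_le _ _).
  have h : in_diagram mu (Ordinal lt1, Ordinal lt2) by rewrite in_diagramE.
  exists (Sub _ h); apply: val_inj => /=.
  exact: ord_pair_inj.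
left; apply: val_inj => /=.
move: lt_b; case: eqP => e; last by rewrite addn0 ltnNge le_b.
rewrite addn1 ltnS => ge_b.
apply/eqP; rewrite [val b]surjective_pairing xpair_eqE -!val_eqE /=.
rewrite !inordK ?ltnS ?rowlen_le ?(edge_le e_i) // e eqxx /=.
by rewrite eqn_leq -e ge_b le_b.
Qed.

(** The inverse of deleting the largest entry: the corner receives [ord_max], and [lift ord_max]
    leaves the other values unchanged. *)
Definition syt_ext (S : {ffun box mu -> 'I_n}) : {ffun box la -> 'I_n.+1} :=
  [ffun b => if [pick b' | emb b' == b] is Some b' then lift ord_max (S b')
             else ord_max].

Lemma syt_ext_emb S b : syt_ext S (emb b) = lift ord_max (S b).
Proof.
rewrite ffunE; case: pickP => [b' /eqP/emb_inj->//|/(_ b)].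
by rewrite eqxx.
Qed.

Lemma syt_ext_corner S : syt_ext S corner = ord_max.
Proof.
by rewrite ffunE; case: pickP => // b /eqP e; have := emb_corner b; rewrite e eqxx.
Qed.

Lemma syt_extP S : is_syt S -> is_syt (syt_ext S).
Proof.
move=> /is_sytP[inj_S rowS colS].
have val_ext b : syt_ext S (emb b) = S b :> nat.
  by rewrite syt_ext_emb lift_max.
apply/is_sytP; split.
- move=> b c; case: (box_corner_emb b) => [->|[b' ->]];
    case: (box_corner_emb c) => [->//|[c' ->]]; rewrite ?syt_ext_corner ?syt_ext_emb.
  + by move=> /eqP; rewrite (negbTE (neq_lift _ _)).
  + by move=> /esym/eqP; rewrite (negbTE (neq_lift _ _)).
  + by move=> /lift_inj/inj_S->.
- move=> b c; case: (box_corner_emb b) => [->|[b' ->]] e l;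
    case: (box_corner_emb c) e l => [->|[c' ->]] e l.
  + by rewrite ltnn in l.
  + have := valP c'; rewrite in_diagramE.
    move: (congr1 val e) l => /=.
    rewrite !inordK ?ltnS ?rowlen_le ?(edge_le e_i) // => <- l.
    by rewrite ltnNge (ltnW l).
  + by rewrite syt_ext_corner syt_ext_emb lift_max.
  + by rewrite !val_ext; apply: rowS => //; apply: val_inj; move: (congr1 val e).
- move=> b c; case: (box_corner_emb b) => [->|[b' ->]] e l;
    case: (box_corner_emb c) e l => [->|[c' ->]] e l.
  + by rewrite ltnn in l.
  + have := valP c'; rewrite in_diagramE.
    move: (congr1 val e) l => /=.
    rewrite !inordK ?ltnS ?rowlen_le ?(edge_le e_i) // => <- l.
    by rewrite ltnNge rowlen_homo // ltnW.
  + by rewrite syt_ext_corner syt_ext_emb lift_max.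
  + by rewrite !val_ext; apply: colS => //; apply: val_inj; move: (congr1 val e).
Qed.

Lemma syt_ext_inj : injective syt_ext.
Proof.
move=> S S' e; apply/ffunP => b.
by have := congr1 (fun T : {ffun box la -> 'I_n.+1} => T (emb b)) e; rewrite !syt_ext_emb => /lift_inj.
Qed.

Lemma syt_ext_surj T : is_syt T -> T corner = ord_max ->
  exists2 S, is_syt S & syt_ext S = T.
Proof.
move=> /is_sytP[inj_T rowT colT] Tmax.
(* The default of [odflt] is only some element of 'I_n: [unlift] fails at [ord_max] alone, which [T]
   takes at the corner. *)
pose S := [ffun b : box mu => odflt (val b).1 (unlift ord_max (T (emb b)))].
have SE b : T (emb b) = lift ord_max (S b).
  rewrite ffunE; case: unliftP => //= e.
  by move: (emb_corner b); rewrite -Tmax in e; rewrite (inj_T _ _ e) eqxx.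
have val_S b : S b = T (emb b) :> nat by rewrite SE lift_max.
exists S.
  apply/is_sytP; split.
  - by move=> b c e; apply: emb_inj; apply: inj_T; rewrite !SE e.
  - move=> b c e l; rewrite !val_S; apply: rowT => //=.
    by rewrite e.
  - move=> b c e l; rewrite !val_S; apply: colT => //=.
    by rewrite e.
apply/ffunP => b; case: (box_corner_emb b) => [->|[b' ->]].
  by rewrite syt_ext_corner.
by rewrite syt_ext_emb SE.
Qed.

Lemma card_syt_corner :
  #|[pred T : {ffun box la -> 'I_n.+1} | is_syt T && (T corner == ord_max)]|
  = dimp mu.
Proof.
rewrite /dimp -(card_imset _ syt_ext_inj); apply: eq_card => T.
rewrite !inE; apply/andP/imsetP => [[sT /eqP mT]|[S]].
  by have [S sS <-] := syt_ext_surj sT mT; exists S; rewrite ?inE.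
by rewrite inE => sS ->; rewrite syt_extP // syt_ext_corner.
Qed.

End Corner.

(** The default [ord0] does not occur for a tableau: an injective filling of n + 1 boxes by n + 1
    entries attains the maximum ([syt_maxrow]). *)
Definition maxrow n (la : intpart n.+1) (T : {ffun box la -> 'I_n.+1}) : 'I_n.+1 :=
  if [pick b | T b == ord_max] is Some b then (val b).1 else ord0.

Lemma syt_maxrow n (la : intpart n.+1) (T : {ffun box la -> 'I_n.+1}) :
  is_syt T -> exists2 b, T b = ord_max & (val b).1 = maxrow T.
Proof.
move=> /is_sytP[inj_T _ _]; rewrite /maxrow; case: pickP => [b /eqP e|no_max].
  by exists b.
have le_card : #|'I_n.+1| <= #|{: box la}| by rewrite card_box card_ord.
by have /mapP[b _ e] := inj_card_onto inj_T le_card ord_max; move: (no_max b); rewrite -e eqxx.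
Qed.

(** Otherwise the box just below the largest entry would lie in the diagram and carry a larger
    one. *)
Lemma syt_max_removable n (la : intpart n.+1) (T : {ffun box la -> 'I_n.+1}) :
  is_syt T -> removable (rowlen la) (maxrow T).
Proof.
move=> sT; have [b e <-] := syt_maxrow sT; have /is_sytP[_ _ colT] := sT.
rewrite /removable ltnNge; apply/negP => le_row.
have := valP b; rewrite in_diagramE => lt_b.
have lt_b1 : (val b).1.+1 < n.+1.
  rewrite ltnNge; apply/negP => /rowlen_ge h.
  by move: (leq_trans lt_b le_row); rewrite h.
have h : in_diagram la (Ordinal lt_b1, (val b).2).
  by rewrite in_diagramE /= (leq_trans lt_b).
have /(_ (leqnn _)) := colT b (Sub _ h) erefl.
by rewrite e ltnNge -ltnS ltn_ord.
Qed.

Lemma syt_max_corner n (mu : intpart n) (la : intpart n.+1) i (e_i : edge mu la i)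
    (T : {ffun box la -> 'I_n.+1}) :
  is_syt T -> (maxrow T == i :> nat) = (T (corner e_i) == ord_max).
Proof.
move=> sT; have [b e ei] := syt_maxrow sT; have /is_sytP[inj_T rowT _] := sT.
have c1 : (val (corner e_i)).1 = i :> nat by rewrite /= inordK // ltnS (edge_le e_i).
have c2 : (val (corner e_i)).2 = rowlen mu i :> nat by rewrite /= inordK // ltnS rowlen_le.
apply/eqP/eqP => [ei'|]; last by rewrite -ei -e => /inj_T <-.
rewrite -e; congr (T _); apply/esym.
have [->//|[b' eb]] := box_corner_emb e_i b.
have lt_b : (val b).2 < (val (corner e_i)).2.
  rewrite c2 eb /=.
  have <- : (val b').1 = i :> nat by rewrite -ei' -ei eb.
  by have := valP b'; rewrite in_diagramE.
have := rowT b (corner e_i) _ lt_b; rewrite e => /(_ _)/wrap[].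
  by apply: ord_inj; rewrite ei ei' c1.
by rewrite ltnNge -ltnS ltn_ord.
Qed.

(** Tableaux are sorted by the row of their largest entry; deleting that entry leaves a tableau of
    the shape without this corner. *)
Lemma dimp_rec n (la : intpart n.+1) :
  dimp la = \sum_(i < n.+1) \sum_(mu : intpart n | edge mu la i) dimp mu.
Proof.
rewrite /dimp -sum1_card (partition_big (@maxrow n la) xpredT) //=.
apply: eq_bigr => i _.
have [rem_i|nrem_i] := boolP (removable (rowlen la) i); last first.
  rewrite !big1 //.
    by move=> mu /edge_rem; rewrite (negbTE nrem_i).
  by move=> T /andP[/syt_max_removable h /eqP e]; rewrite e (negbTE nrem_i) in h.
have [mu e_mu] := edge_down rem_i.
rewrite [RHS](big_pred1 mu); last first.
  by move=> mu'; apply/idP/eqP => [/edge_injl|->//]; exact.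
rewrite -[RHS](card_syt_corner e_mu) -[RHS]sum1_card; apply: eq_bigl => T.
by rewrite !inE; case: (boolP (is_syt T)) => //= sT; rewrite -val_eqE (syt_max_corner e_mu).
Qed.

Lemma dimp_gt0 n (la : intpart n) : 0 < dimp la.
Proof.
elim: n la => [|n IH] la.
  have box0 (b : box la) : False by case: (val b).1.
  apply/card_gt0P; exists [ffun b => (val b).1]; rewrite inE; apply/is_sytP.
  by split => b; case: (box0 b).
have [i rem_i] : exists i : 'I_n.+1, removable (rowlen la) i.
  apply/existsP; apply: contraT; rewrite negb_exists => /forallP h.
  have h0 i : rowlen la i = 0.
    have h' : forall k, rowlen la k <= rowlen la k.+1.
      move=> k; case: (ltnP k n.+1) => [lt_k|/rowlen_ge->//].
      by have := h (Ordinal lt_k); rewrite /removable /= -leqNgt.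
    have /(_ n.+1) : forall k, rowlen la i <= rowlen la (i + k).
      elim=> [|k IHk]; first by rewrite addn0.
      by rewrite addnS; apply: leq_trans IHk (h' _).
    by rewrite [X in _ <= X]rowlen_ge ?leq_addl // leqn0 => /eqP.
  by have := rowlen_sum la (leqnn _); rewrite big1.
have [mu e_mu] := edge_down rem_i.
rewrite dimp_rec (bigD1 i) //= (bigD1 mu) //=.
by apply: leq_trans (IH mu) _; rewrite -addnA leq_addr.
Qed.

End Shapes.

(** * Transition and cotransition measures *)

Section PartialFractions.
Variable F : fieldType.
Implicit Types (p : {poly F}) (N : nat).

Lemma horner_prod_XsubC (I : finType) (P : pred I) (b : I -> F) z :
  (\prod_(k | P k) ('X - (b k)%:P)).[z] = \prod_(k | P k) (z - b k).
Proof. by rewrite horner_prod; apply: eq_bigr => k _; rewrite hornerXsubC. Qed.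

Lemma size_prod_XsubC_neq N (b : 'I_N -> F) j :
  size (\prod_(k | k != j) ('X - (b k)%:P)) = N.
Proof.
rewrite (eq_bigl (mem (predC1 j))) // -big_enum /= size_prod_XsubC -cardE cardC1.
by rewrite card_ord prednK // (leq_ltn_trans _ (ltn_ord j)).
Qed.

Lemma coef_prod_XsubC_neq N (b : 'I_N -> F) j :
  (\prod_(k | k != j) ('X - (b k)%:P))`_N.-1 = 1.
Proof.
have h : \prod_(k | k != j) ('X - (b k)%:P) \is monic.
  by apply: monic_prod => k _; apply: monicXsubC.
by rewrite -[RHS](monicP h) lead_coefE size_prod_XsubC_neq.
Qed.

(** The difference of the two sides has degree less than N and vanishes at the N nodes. *)
Lemma lagrange_interp N (b : 'I_N -> F) p : injective b -> (size p <= N)%N ->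
  p = \sum_j (p.[b j] / \prod_(k | k != j) (b j - b k)) *:
             \prod_(k | k != j) ('X - (b k)%:P).
Proof.
move=> inj_b size_p; apply/eqP; rewrite -subr_eq0; apply/eqP.
apply: (@roots_geq_poly_eq0 _ _ (codom b)).
- apply/allP => _ /codomP[i ->]; rewrite /root hornerD hornerN horner_sum.
  rewrite (bigD1 i) //= [X in _ - (_ + X)]big1 => [|j ji]; last first.
    rewrite hornerZ horner_prod; apply/eqP; rewrite mulf_eq0; apply/orP; right.
    by rewrite (bigD1 i) 1?eq_sym //= hornerXsubC subrr mul0r.
  rewrite addr0 hornerZ horner_prod.
  under [X in _ * X]eq_bigr do rewrite hornerXsubC.
  rewrite divfK ?subrr //; apply/prodf_neq0 => k ki.
  by rewrite subr_eq0; apply: contra ki => /eqP/inj_b->.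
- by rewrite map_inj_uniq ?enum_uniq.
rewrite size_codom card_ord; apply: leq_trans (size_polyD _ _) _.
rewrite geq_max size_p size_polyN /=; apply: leq_trans (size_sum _ _ _) _.
apply/bigmax_leqP => j _; apply: leq_trans (size_scale_leq _ _) _.
by rewrite size_prod_XsubC_neq.
Qed.

(* The remainder of the division of (z+N) q(z-1) by q(z), where q has the     *)
(* root list s and N roots.                                                   *)
Let rem_shift (s : seq F) : {poly F} :=
  'X * \prod_(b <- s) ('X - b%:P) -
  ('X + (size s)%:R%:P) * \prod_(b <- s) ('X - (b + 1)%:P).

Let rem_shift_cons b s : rem_shift (b :: s) =
  ('X - b%:P) * rem_shift s +
  (b + (size s).+1%:R)%:P * \prod_(b <- s) ('X - (b + 1)%:P).
Proof.
rewrite /rem_shift !big_cons /= -[(size s).+1]addn1 natrD !polyCD.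
move: (\prod_(_ <- _) _) => q; move: (\prod_(_ <- _) _) => q1.
have -> : (1 : F)%:P = 1 by []. ring.
Qed.

(** The leading terms of the two products cancel, and the shift by [size s] makes the next ones
    cancel too. The coefficient found here is the total mass of [nu] in [nu_sum]. *)
Let rem_shift_coef s : (size (rem_shift s) <= size s)%N /\
  (rem_shift s)`_(size s).-1 =
  \sum_(b <- s) b + \sum_(i < size s) i.+1%:R.
Proof.
elim: s => [|b s [IHs IHc]].
  rewrite /rem_shift !big_nil !mulr1 addr0 subrr big_ord0 addr0.
  by rewrite size_poly0 coef0.
have monic_q1 : \prod_(b <- s) ('X - (b + 1)%:P) \is monic.
  by apply: monic_prod => i _; apply: monicXsubC.
have size_q1 : size (\prod_(b <- s) ('X - (b + 1)%:P)) = (size s).+1.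
  by rewrite size_prod_XsubC.
rewrite rem_shift_cons; split.
  apply: leq_trans (size_polyD _ _) _; rewrite geq_max; apply/andP; split.
    have [->|nz] := eqVneq (rem_shift s) 0; first by rewrite mulr0 size_poly0.
    by rewrite size_monicM ?monicXsubC // size_XsubC /= ltnS.
  by rewrite mul_polyC; apply: leq_trans (size_scale_leq _ _) _; rewrite size_q1.
have q1_lead : (\prod_(b <- s) ('X - (b + 1)%:P))`_(size s) = 1.
  by rewrite -[RHS](monicP monic_q1) lead_coefE size_q1.
rewrite coefD coefCM /= q1_lead mulr1 mulrBl coefB coefXM coefCM.
rewrite [(rem_shift s)`_(size s)]nth_default // mulr0 subr0.
rewrite big_cons big_ord_recr /=.
have -> : (if size s == 0%N then 0 else (rem_shift s)`_(size s).-1) =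
          \sum_(b <- s) b + \sum_(i < size s) i.+1%:R.
  rewrite -IHc; case: eqP => // e; by rewrite nth_default // (leq_trans IHs) ?e.
by ring.
Qed.

(* For a_i = la_i - i, wt and nu will be the probabilities that the box added *)
(* to (resp. removed from) la at random lies in row i, nu having mass |la|.   *)
Definition nu N (a : 'I_N -> F) (i : 'I_N) : F :=
  (a i + N%:R - 1) * \prod_(j | j != i) ((a i - a j - 1) / (a i - a j)).

Definition wt N (a : 'I_N -> F) (i : 'I_N) : F :=
  (a i + N%:R)^-1 * \prod_(j | j != i) ((a i - a j + 1) / (a i - a j)).

Section Nu.
Variables (N : nat) (a : 'I_N -> F).
Hypothesis inj_a : injective a.

Let b i := a i - 1.
Let s := [seq b i | i <- enum 'I_N].

Let size_s : size s = N. Proof. by rewrite size_map size_enum_ord. Qed.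

Let prod_s (f : F -> {poly F}) : \prod_(x <- s) f x = \prod_i f (b i).
Proof. by rewrite big_map big_enum. Qed.

Let inj_b : injective b.
Proof. by move=> i j /addIr/inj_a. Qed.

Let rem_shift_b i :
  (rem_shift s).[b i] / \prod_(k | k != i) (b i - b k) = nu a i.
Proof.
rewrite /rem_shift !prod_s size_s hornerD hornerN !hornerM hornerX hornerD.
rewrite hornerX hornerC !horner_prod.
rewrite (bigD1 i) //= hornerXsubC subrr mul0r mulr0 add0r /nu.
rewrite [X in - (_ * X) / _](bigD1 i) //= hornerXsubC.
rewrite prodf_div.
under eq_bigr => k ki do rewrite hornerXsubC.
have -> : \prod_(k | k != i) (b i - b k) = \prod_(k | k != i) (a i - a k).
  by apply: eq_bigr => k _; rewrite /b; ring.
have -> : \prod_(k | k != i) (b i - (b k + 1)) = \prod_(k | k != i) (a i - a k - 1).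
  by apply: eq_bigr => k _; rewrite /b; ring.
rewrite mulrA; congr (_ / _); rewrite /b; ring.
Qed.

Let rem_shiftE :
  rem_shift s = \sum_j nu a j *: \prod_(k | k != j) ('X - (b k)%:P).
Proof.
have [sz _] := rem_shift_coef s; rewrite size_s in sz.
rewrite [LHS](lagrange_interp inj_b sz).
by apply: eq_bigr => j _; rewrite rem_shift_b.
Qed.

Lemma nu_sum : \sum_i nu a i = \sum_i a i + \sum_(i < N) i%:R.
Proof.
have [_] := rem_shift_coef s; rewrite size_s rem_shiftE coef_sum.
have -> : \sum_(x <- s) x = \sum_i b i by rewrite big_map big_enum.
under eq_bigr => i _.
  rewrite coefZ.
  rewrite coef_prod_XsubC_neq mulr1; over.
move=> ->; rewrite /b sumrB.
under [\sum_(i < N) i.+1%:R]eq_bigr do rewrite -addn1 natrD.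
rewrite big_split /=; ring.
Qed.

(** The Lagrange expansion of [rem_shift s] at its nodes [b], divided by the product of the z - b
    i. *)
Lemma nu_frac z : (forall i, z != b i) ->
  \sum_i nu a i / (z - b i) =
  z - (z + N%:R) * \prod_i ((z - a i) / (z - b i)).
Proof.
move=> zb; have nz i : z - b i != 0 by rewrite subr_eq0.
have q_nz : \prod_i (z - b i) != 0 by apply/prodf_neq0.
have /(congr1 (fun p => p.[z])) := rem_shiftE.
rewrite /rem_shift !prod_s size_s horner_sum hornerD hornerN !hornerM hornerX hornerD.
rewrite hornerX hornerC !horner_prod_XsubC.
have -> : \prod_i (z - (b i + 1)) = \prod_i (z - a i).
  by apply: eq_bigr => i _; rewrite /b; ring.
move=> e; apply: (mulIf q_nz).
rewrite prodf_div mulrBl mulrA divfK // e mulr_suml.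
apply: eq_bigr => i _; rewrite hornerZ horner_prod_XsubC (bigD1 i) //=.
by field.
Qed.

End Nu.

Section Wt.
Variables (N : nat) (a : 'I_N.+1 -> F).
Hypothesis inj_a : injective a.
Hypothesis a_max : a ord_max = - N%:R.
Hypothesis a_N : forall i, a i + N.+1%:R != 0.

(** As the last row is empty, its factor z - a + 1 equals z + N + 1 and cancels the prefactor of
    [wt_frac]; [p] is the numerator that remains, monic of degree N. *)
Let p : {poly F} := \prod_(j | j != ord_max) ('X - (a j - 1)%:P).

Let p_a i : p.[a i] / \prod_(k | k != i) (a i - a k) = wt a i.
Proof.
rewrite /wt prodf_div mulrA; congr (_ / _).
apply: (mulfI (a_N i)); rewrite mulrA mulfV // mul1r horner_prod_XsubC.
have -> : a i + N.+1%:R = a i - (a ord_max - 1).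
  by rewrite a_max -addn1 natrD; ring.
transitivity (\prod_k (a i - (a k - 1))); first by rewrite [RHS](bigD1 ord_max).
rewrite (bigD1 i) //=.
have -> : a i - (a i - 1) = 1 by ring.
by rewrite mul1r; apply: eq_bigr => k _; ring.
Qed.

Let pE : p = \sum_j wt a j *: \prod_(k | k != j) ('X - (a k)%:P).
Proof.
rewrite [LHS](lagrange_interp inj_a); last first.
  by rewrite size_prod_XsubC_neq.
by apply: eq_bigr => j _; rewrite p_a.
Qed.

Lemma wt_sum : \sum_i wt a i = 1.
Proof.
have := congr1 (fun p : {poly F} => p`_N.+1.-1) pE; rewrite /p coef_prod_XsubC_neq coef_sum => ->.
by apply: eq_bigr => i _; rewrite coefZ coef_prod_XsubC_neq mulr1.
Qed.

Lemma wt_frac z : (forall i, z != a i) -> z + N.+1%:R != 0 ->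
  \sum_i wt a i / (z - a i) =
  (z + N.+1%:R)^-1 * \prod_i ((z - a i + 1) / (z - a i)).
Proof.
move=> za zN; have nz i : z - a i != 0 by rewrite subr_eq0.
have q_nz : \prod_i (z - a i) != 0 by apply/prodf_neq0.
have /(congr1 (fun p => p.[z])) := pE.
rewrite horner_sum horner_prod_XsubC.
move=> e; apply: (mulIf q_nz); rewrite prodf_div mulrA divfK //.
have -> : \prod_i (z - a i + 1) = (z + N.+1%:R) * \prod_(i | i != ord_max) (z - (a i - 1)).
  rewrite (bigD1 ord_max) //= a_max; congr (_ * _); first by rewrite [_%:R in RHS]mulrSr; ring.
  by apply: eq_bigr => i _; ring.
rewrite mulKf // e mulr_suml.
apply: eq_bigr => i _; rewrite hornerZ horner_prod_XsubC [\prod_i _](bigD1 i) //=.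
by field.
Qed.

End Wt.

End PartialFractions.

Section FieldIdentities.
Variable F : fieldType.

(** Lowering [a i] by one affects only the factor of index [i] in the product: with x = a j - a i it
    passes from (x - 1) / x to x / (x + 1). *)
Lemma nu_dec N (a a' : 'I_N -> F) i j : j != i ->
    (forall k, a k = a' k + (k == i)%:R) ->
    a j - a i != 0 -> a j - a i + 1 != 0 ->
  nu a' j * ((a j - a i) ^+ 2 - 1) = nu a j * (a j - a i) ^+ 2.
Proof.
move=> ji aE x0 x1; rewrite /nu [in LHS](bigD1 i) 1?eq_sym //=.
rewrite [in RHS](bigD1 i) 1?eq_sym //=.
have a'i : a' i = a i - 1 by rewrite aE eqxx addrK.
have a'k k : k != i -> a' k = a k by move=> /negbTE h; rewrite aE h addr0.
rewrite a'i (a'k j) //.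
rewrite (eq_bigr (fun k => (a j - a k - 1) / (a j - a k))); last first.
  by move=> k /andP[kj ki]; rewrite (a'k k).
have x1' : a j - (a i - 1) != 0 by rewrite opprB addrA addrAC.
by field; rewrite x0 x1'.
Qed.

(** As [a'] raises [a i] by one, the factors of the two products are inverse to each other one by
    one, and so are the prefactors. *)
Lemma wt_nu N (a a' : 'I_N -> F) i : injective a -> injective a' ->
    (forall k, a' k = a k + (k == i)%:R) -> a i + N%:R != 0 ->
  wt a i * nu a' i = 1.
Proof.
move=> inj_a inj_a' a'E aN; rewrite /wt /nu.
have a'i : a' i = a i + 1 by rewrite a'E eqxx.
have a'k k : k != i -> a' k = a k by move=> /negbTE h; rewrite a'E h addr0.
rewrite (eq_bigr (fun k => (a i - a k) / (a i - a k + 1))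
  (P := fun k => k != i) (F1 := fun k => (a' i - a' k - 1) / (a' i - a' k))); last first.
  move=> k ki; rewrite a'i a'k //; congr (_ / _); ring.
rewrite a'i mulrACA -big_split /= big1 ?mulr1; last first.
  move=> k ki.
  have x0 : a i - a k != 0.
    by rewrite subr_eq0; apply: contra ki => /eqP/inj_a->.
  have x1 : a i - a k + 1 != 0.
    rewrite -addrAC -a'i -(a'k k) // subr_eq0.
    by apply: contra ki => /eqP/inj_a'->.
  by rewrite mulf_div [X in X / _]mulrC divff // mulf_neq0.
by field.
Qed.

End FieldIdentities.

Section Dim.
Variable R : realType.
Implicit Type n : nat.

(* The content of the box that row i would receive.                           *)
Definition acont n (la : intpart n) (i : nat) : R := (rowlen la i)%:R - i%:R.

Lemma acont_lt n (la : intpart n) i j : (i < j)%N -> acont la j < acont la i.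
Proof.
move=> lt_ij; rewrite /acont ltrBlDr addrAC ltrBrDr -!natrD ltr_nat.
by rewrite -addnS leq_add // rowlen_homo // ltnW.
Qed.

Lemma acont_inj n (la : intpart n) i j : acont la i = acont la j -> i = j.
Proof.
move=> e; case: (ltngtP i j) => // /(acont_lt la); by rewrite e ltxx.
Qed.

Lemma acont_inj_ord n (la : intpart n) N : injective (fun i : 'I_N => acont la i).
Proof. by move=> i j /acont_inj/val_inj. Qed.

(** This keeps x, x + 1 and 1 - x away from zero when [nu_dec] is applied in [dim_nu]. *)
Lemma acont_sub_nat n (la : intpart n) i j : (i < j)%N -> removable (rowlen la) i ->
  2 <= acont la i - acont la j.
Proof.
move=> lt_ij; rewrite /removable => rem_i.
have := rowlen_homo la lt_ij => le_j; rewrite /acont.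
have : (rowlen la j + 1)%:R <= (rowlen la i)%:R :> R by rewrite ler_nat; lia.
have : (i + 1)%:R <= j%:R :> R by rewrite ler_nat; lia.
rewrite !natrD; lra.
Qed.

Lemma acontN n (la : intpart n) N i : (i < N)%N -> 0 < acont la i + N%:R.
Proof.
move=> lt_i; rewrite /acont addrAC -natrD subr_gt0 ltr_nat; lia.
Qed.

Lemma acont_edge n (mu : intpart n) la i k : edge mu la i ->
  acont la k = acont mu k + (k == i)%:R.
Proof. by move=> /edgeP h; rewrite /acont h natrD addrAC. Qed.

(** When rows i and i + 1 have equal length, the factor of index i + 1 vanishes; for i = N - 1 the
    row is empty and the prefactor vanishes. Thus sums over all rows are sums over corners;
    [wt_naddable] is the analogue with the factor of index i - 1. *)
Lemma nu_nremovable n (la : intpart n) N (i : 'I_N) : (n <= N)%N ->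
  ~~ removable (rowlen la) i -> nu (fun k : 'I_N => acont la k) i = 0.
Proof.
move=> le_nN; rewrite /removable -leqNgt => nrem.
have e : rowlen la i = rowlen la i.+1.
  by apply/eqP; rewrite eqn_leq nrem rowlen_homo.
rewrite /nu; case: (ltnP i.+1 N) => [lt_iN|ge_iN].
  rewrite (bigD1 (Ordinal lt_iN)) /=; last by rewrite -val_eqE /= gtn_eqF.
  have -> : acont la i - acont la i.+1 - 1 = 0.
    by rewrite /acont -e [i.+1%:R]mulrSr; ring.
  by rewrite !mul0r mulr0.
have -> : acont la i + N%:R - 1 = 0; last by rewrite mul0r.
have eN : N = i.+1 by apply/eqP; rewrite eqn_leq ge_iN ltn_ord.
rewrite /acont e rowlen_ge; last by rewrite (leq_trans le_nN).
have -> : N%:R = i%:R + 1 :> R by rewrite {1}eN mulrSr.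
ring.
Qed.

Lemma wt_naddable n (mu : intpart n) N (i : 'I_N) :
  ~~ addable (rowlen mu) i -> wt (fun k : 'I_N => acont mu k) i = 0.
Proof.
case: i => -[|i] lt_i //; rewrite addableS /removable -leqNgt /= => nrem.
have e : rowlen mu i = rowlen mu i.+1.
  by apply/eqP; rewrite eqn_leq nrem rowlen_homo.
rewrite /wt (bigD1 (Ordinal (ltnW lt_i))) /=; last first.
  by rewrite -val_eqE /= ltn_eqF.
have -> : acont mu i.+1 - acont mu i + 1 = 0.
  by rewrite /acont -e [i.+1%:R]mulrSr; ring.
by rewrite !mul0r mulr0.
Qed.

Lemma nu_sum_acont n (la : intpart n) N : (n <= N)%N ->
  \sum_(i < N) nu (fun k : 'I_N => acont la k) i = n%:R.
Proof.
move=> le_nN; rewrite nu_sum; last exact: acont_inj_ord.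
rewrite -big_split /= -[in RHS](rowlen_sum la le_nN) natr_sum.
by apply: eq_bigr => i _; rewrite /acont subrK.
Qed.

Lemma dimp_recR n (la : intpart n.+1) N : (n < N)%N ->
  (dimp la)%:R = \sum_(i < N) \sum_(mu : intpart n | edge mu la i) (dimp mu)%:R :> R.
Proof.
move=> lt_nN; rewrite dimp_rec natr_sum.
rewrite (eq_bigr (fun i : 'I_n.+1 => \sum_(mu | edge mu la i) (dimp mu)%:R)); last first.
  by move=> i _; rewrite natr_sum.
rewrite (big_ord_widen N (fun i => \sum_(mu | edge mu la i) (dimp mu)%:R)) // big_mkcond.
apply: eq_bigr => i _; case: ifP => // h; rewrite big1 // => mu /edge_le.
by rewrite -ltnS h.
Qed.

Lemma edge_cross n (mu mu' : intpart n.+1) la i j : i != j ->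
  edge mu la i -> edge mu' la j ->
  exists2 rho : intpart n, edge rho mu j & edge rho mu' i.
Proof.
move=> ij e_mu e_mu'.
have /edgeP h := e_mu; have /edgeP h' := e_mu'.
have rem_j : removable (rowlen mu) j.
  have := edge_rem e_mu'; rewrite /removable !h (negbTE (_ : j != i)) 1?eq_sym //.
  by rewrite addn0; apply: leq_ltn_trans; apply: leq_addr.
have [rho e_rho] := edge_down rem_j; exists rho => //.
have /edgeP h'' := e_rho; apply/edgeP => k.
by apply: (@addIn (k == j)); rewrite -h' h h'' addnAC.
Qed.

(* The nu sum to n + 1, so it suffices that dimp mu / nu does not depend on   *)
(* the removed corner.                                                        *)
Lemma dim_nu_of_ratio N n (mu : intpart n) la (i : 'I_N) : (n < N)%N ->
    (forall (j : 'I_N) (mu' : intpart n), edge mu' la j ->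
       (dimp mu')%:R * nu (fun k : 'I_N => acont la k) i =
       (dimp mu)%:R * nu (fun k : 'I_N => acont la k) j) ->
  n.+1%:R * (dimp mu)%:R = nu (fun k : 'I_N => acont la k) i * (dimp la)%:R :> R.
Proof.
move=> lt_nN H.
rewrite (dimp_recR la lt_nN) -[in LHS](nu_sum_acont la lt_nN) mulr_suml mulr_sumr.
apply: eq_bigr => j _; have [/edge_down[mu' e_mu']|nrem] := boolP (removable (rowlen la) j).
  rewrite (big_pred1 mu'); last by move=> ?; apply/idP/eqP => [/edge_injl|->//]; exact.
  by rewrite mulrC -(H _ _ e_mu') mulrC.
rewrite nu_nremovable // mul0r big_pred0 ?mulr0 // => mu'.
by apply/negP => /edge_rem; rewrite (negbTE nrem).
Qed.

(** For two corners of [la], let [rho] be [la] without both. The induction hypothesis for the edges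
    from [rho] compares dimp mu with dimp mu' through the values of [nu] at mu and mu'. Passing from
    these to [la] by [nu_dec] costs the same factor on both sides, because x enters it only through
    its square. *)
Lemma dim_nu N n (mu : intpart n) la (i : 'I_N) : (n < N)%N -> edge mu la i ->
  n.+1%:R * (dimp mu)%:R = nu (fun k : 'I_N => acont la k) i * (dimp la)%:R :> R.
Proof.
elim: n mu la i => [|n IH] mu la i lt_nN e_mu; apply: dim_nu_of_ratio => // j mu'.
  move=> e'; have emu : mu' = mu by apply: rowlen_inj => k; rewrite !rowlen_ge.
  by rewrite emu in e' *; rewrite (val_inj (edge_inji e' e_mu)).
move=> e_mu'; have [eij|ij] := eqVneq i j.
  by rewrite -eij in e_mu' *; rewrite (edge_injl e_mu e_mu').
have [rho e_rho e_rho'] := edge_cross ij e_mu e_mu'.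
have h := IH _ _ _ (ltnW lt_nN) e_rho; have h' := IH _ _ _ (ltnW lt_nN) e_rho'.
set x := acont la j - acont la i.
have [x0 x1 x1'] : [/\ x != 0, x + 1 != 0 & - x + 1 != 0].
  rewrite /x.
  case: (ltngtP i j) => [lt_ij|lt_ji|/val_inj e]; last by rewrite e eqxx in ij.
  - have := acont_sub_nat lt_ij (edge_rem e_mu) => hh; split; apply/eqP; lra.
  - have := acont_sub_nat lt_ji (edge_rem e_mu') => hh; split; apply/eqP; lra.
have k : nu (fun k : 'I_N => acont mu k) j * (x ^+ 2 - 1) =
         nu (fun k : 'I_N => acont la k) j * x ^+ 2.
  apply: (nu_dec (i := i)) => //; first by rewrite eq_sym.
  by move=> k; rewrite (acont_edge _ e_mu).
have k' : nu (fun k : 'I_N => acont mu' k) i * (x ^+ 2 - 1) =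
          nu (fun k : 'I_N => acont la k) i * x ^+ 2.
  have xN : acont la i - acont la j = - x by rewrite /x; ring.
  rewrite -[x ^+ 2]sqrrN -xN; apply: (nu_dec (i := j)) => //; rewrite ?xN ?oppr_eq0 //.
  by move=> k'; rewrite (acont_edge _ e_mu').
apply: (mulIf (expf_neq0 2 x0)).
rewrite -[LHS]mulrA -[RHS]mulrA -k -k' [LHS]mulrA [RHS]mulrA.
by rewrite [X in X * _]mulrC -h' h [X in X * _ = _]mulrC.
Qed.

Lemma dim_wt n (mu : intpart n) la (i : 'I_n.+1) : edge mu la i ->
  (dimp la)%:R = n.+1%:R * (dimp mu)%:R * wt (fun k : 'I_n.+1 => acont mu k) i :> R.
Proof.
move=> e_mu; rewrite (dim_nu (ltnSn n) e_mu) mulrAC -[LHS]mul1r; congr (_ * _).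
rewrite mulrC wt_nu //; try exact: acont_inj_ord.
- by move=> k; rewrite (acont_edge _ e_mu).
- by rewrite gt_eqF // acontN.
Qed.

Lemma wt_sum_acont n (mu : intpart n) :
  \sum_(i < n.+1) wt (fun k : 'I_n.+1 => acont mu k) i = 1.
Proof.
apply: wt_sum; first exact: acont_inj_ord.
- by rewrite /acont rowlen_ge ?sub0r.
- by move=> i; rewrite gt_eqF // acontN.
Qed.

Lemma sum_up n (mu : intpart n) (f : nat -> R) :
  \sum_(i < n.+1) \sum_(la | edge mu la i) (dimp la)%:R * f i =
  n.+1%:R * (dimp mu)%:R * \sum_(i < n.+1) wt (fun k : 'I_n.+1 => acont mu k) i * f i.
Proof.
rewrite mulr_sumr; apply: eq_bigr => i _.
have [/edge_up[la e_la]|nadd] := boolP (addable (rowlen mu) i).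
  rewrite (big_pred1 la); last by move=> ?; apply/idP/eqP => [/edge_injr|->//]; exact.
  by rewrite (dim_wt e_la) mulrA.
rewrite wt_naddable // mul0r mulr0 big_pred0 // => la.
by apply/negP => /edge_add; rewrite (negbTE nadd).
Qed.

Lemma sum_down n (la : intpart n.+1) N (f : nat -> R) : (n < N)%N ->
  \sum_(i < N) \sum_(mu | edge mu la i) n.+1%:R * (dimp mu)%:R * f i =
  (dimp la)%:R * \sum_(i < N) nu (fun k : 'I_N => acont la k) i * f i.
Proof.
move=> lt_nN; rewrite mulr_sumr; apply: eq_bigr => i _.
have [/edge_down[mu e_mu]|nrem] := boolP (removable (rowlen la) i).
  rewrite (big_pred1 mu); last by move=> ?; apply/idP/eqP => [/edge_injl|->//]; exact.
  by rewrite (dim_nu lt_nN e_mu) [X in X * _]mulrC -[LHS]mulrA.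
rewrite nu_nremovable // mul0r mulr0 big_pred0 // => mu.
by apply/negP => /edge_rem; rewrite (negbTE nrem).
Qed.

(** The weights [wt] sum to one. This rule turns (m + 1) dimp mu into a sum over shapes of size m +
    1 in [dimp_down_off]. *)
Lemma dimp_up n (mu : intpart n) :
  \sum_(i < n.+1) \sum_(la | edge mu la i) (dimp la)%:R =
  n.+1%:R * (dimp mu)%:R :> R.
Proof.
have := sum_up mu (fun=> 1); under [X in _ = _ * X -> _]eq_bigr do rewrite mulr1.
rewrite wt_sum_acont mulr1 => <-.
by apply: eq_bigr => i _; apply: eq_bigr => la _; rewrite mulr1.
Qed.

(** By [dim_wt], a nonzero weight is a quotient of dimensions. *)
Lemma wt_ge0 n (mu : intpart n) (i : 'I_n.+1) :
  0 <= wt (fun k : 'I_n.+1 => acont mu k) i.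
Proof.
have [/edge_up[la e_la]|nadd] := boolP (addable (rowlen mu) i); last by rewrite wt_naddable.
have := dim_wt e_la => h.
have p : 0 < n.+1%:R * (dimp mu)%:R :> R by rewrite mulr_gt0 ?ltr0n ?dimp_gt0.
by rewrite -(pmulr_rge0 _ p) -h.
Qed.

Lemma nu_ge0 n (la : intpart n) N (i : 'I_N) : (n <= N)%N ->
  0 <= nu (fun k : 'I_N => acont la k) i.
Proof.
case: n la => [|n] la le_nN.
  rewrite nu_nremovable // /removable !rowlen_ge //.
have [/edge_down[mu e_mu]|nrem] := boolP (removable (rowlen la) i); last by rewrite nu_nremovable.
have p : 0 < (dimp la)%:R :> R by rewrite ltr0n dimp_gt0.
by rewrite -(pmulr_lge0 _ p) -(dim_nu le_nN e_mu) mulr_ge0.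
Qed.

End Dim.

(** * Corners and moves of one box *)

Lemma edge_cross_up n (mu : intpart n) (la la' : intpart n.+1) i j : i != j ->
  edge mu la j -> edge mu la' i ->
  exists2 La : intpart n.+2, edge la La i & edge la' La j.
Proof.
move=> ij e_la e_la'; have /edgeP h := e_la; have /edgeP h' := e_la'.
have add_i : addable (rowlen la) i.
  have := edge_add e_la'; case: i ij e_la' h' => // i ij e_la' h'.
  rewrite !addableS /removable !h (negbTE ij) addn0 => /leq_trans; apply.
  exact: leq_addr.
have [La e_La] := edge_up add_i; exists La => //.
by have /edgeP h'' := e_La; apply/edgeP => k; rewrite h'' h h' addnAC.
Qed.

Definition ncor n (la : intpart n) : nat := (\sum_(i < n) removable (rowlen la) i)%N.

Lemma ncorE n (la : intpart n) N : (n <= N)%N ->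
  (\sum_(i < N) removable (rowlen la) i)%N = ncor la.
Proof.
move=> le_nN; rewrite /ncor.
rewrite (big_ord_widen N (fun i => nat_of_bool (removable (rowlen la) i)) le_nN).
rewrite [RHS]big_mkcond; apply: eq_bigr => i _; case: ltnP => // le_ni.
by case E : (removable _ _) => //; have := removable_lt E; rewrite ltnNge le_ni.
Qed.

(** A shape with k corners contains a staircase: row [i] is at least as long as the number of
    removable rows from [i] on. Summed over [i], this counts the pairs i <= j of removable rows, at
    least half of all k^2 pairs. *)
Lemma ncor_sq n (la : intpart n) : (ncor la ^ 2 <= n.*2)%N.
Proof.
pose r i := nat_of_bool (removable (rowlen la) i).
have row_ge (i k : nat) : (\sum_(i <= j < i + k) r j + rowlen la (i + k) <= rowlen la i)%N.
  elim: k => [|k IH]; first by rewrite addn0 big_geq.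
  rewrite addnS big_nat_recr ?leq_addr //=; apply: leq_trans IH.
  rewrite -addnA leq_add2l /r /removable; have := rowlen_homo la (leqnSn (i + k)).
  by case: ltnP; lia.
have le_n : (\sum_(i < n) \sum_(j < n | i <= j) r j <= n)%N.
  rewrite -[X in (_ <= X)%N](rowlen_sum la (leqnn n)); apply: leq_sum => i _.
  apply: leq_trans (row_ge i (n - i)%N); rewrite subnKC ?(ltnW (ltn_ord i)) //.
  apply: leq_trans (leq_addr _ _).
  rewrite [X in (_ <= X)%N](@big_nat_widenl _ _ _ i 0%N) //= big_mkord.
  exact: leqnn.
have sym : (\sum_(i < n) \sum_(j < n) r i * r j <=
    \sum_(i < n) \sum_(j < n | i <= j) r i * r j +
    \sum_(i < n) \sum_(j < n | i <= j) r i * r j)%N.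
  rewrite [X in (_ <= X + _)%N](exchange_big_dep xpredT) //= -big_split /=.
  apply: leq_sum => i _; rewrite [X in (_ <= X + _)%N]big_mkcond.
  rewrite [X in (_ <= _ + X)%N]big_mkcond -big_split /=; apply: leq_sum => j _.
  by case: (leqP i j) => h; [rewrite leq_addl|rewrite (ltnW h) mulnC leq_addr].
rewrite /ncor expnS expn1 big_distrlr /=; apply: leq_trans sym _.
rewrite addnn leq_double; apply: leq_trans le_n.
apply: leq_sum => i _; apply: leq_sum => j _.
by rewrite /r; case: removable; rewrite ?mul1n.
Qed.

Lemma naddE n (la : intpart n) N : (n <= N)%N ->
  (\sum_(i < N.+1) addable (rowlen la) i)%N = (ncor la).+1.
Proof.
move=> le_nN; rewrite big_ord_recl /= add1n; congr _.+1.
by rewrite -(ncorE la le_nN); apply: eq_bigr => i _; rewrite addableS.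
Qed.

Section Kernel.
Variable R : realType.
Variable m : nat.
Implicit Types la : intpart m.+1.

(* la' is la with one box moved from row j to row i.                          *)
Definition swp la la' i j : bool :=
  [exists mu : intpart m, edge mu la j && edge mu la' i].

Lemma swpP la la' i j :
  reflect (exists2 mu : intpart m, edge mu la j & edge mu la' i) (swp la la' i j).
Proof.
apply: (iffP existsP) => [[mu /andP[]]|[mu h h']]; exists mu => //.
exact/andP.
Qed.

Lemma swp_sym la la' i j : swp la la' i j = swp la' la j i.
Proof. by apply/swpP/swpP => -[mu h h']; exists mu. Qed.

Lemma swp_acont la la' i j : i != j -> swp la la' i j ->
  acont R la i = acont R la' i - 1.
Proof.
move=> ij /swpP[mu e e'].
by rewrite (acont_edge _ _ e) (acont_edge _ _ e') eqxx (negbTE ij) addr0 addrK.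
Qed.

(** Expand dimp La by removing a box from La: taking it from row [i] gives back [la], and taking it
    from another row [j] is a move from [j] to [i]. *)
Lemma dimp_up_off la (i : 'I_m.+2) :
  \sum_(La : intpart m.+2 | edge la La i) (dimp La)%:R =
  \sum_(j < m.+2 | j != i) \sum_(la' | swp la la' i j) (dimp la')%:R +
  (addable (rowlen la) i)%:R * (dimp la)%:R :> R.
Proof.
have [/edge_up[La e_La]|nadd] := boolP (addable (rowlen la) i); last first.
  rewrite mul0r addr0 !big1 //.
    move=> j ji; rewrite big_pred0 // => la'; apply/negbTE/swpP => -[mu e e'].
    have [|La e_La _] := edge_cross_up _ e e'; first by rewrite eq_sym.
    by rewrite (edge_add e_La) in nadd.
  by move=> La /edge_add; rewrite (negbTE nadd).
rewrite (big_pred1 La); last by move=> ?; apply/idP/eqP => [/edge_injr|->//]; exact.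
rewrite (dimp_recR R La (ltnSn _)) (bigD1 i) //= addrC mul1r; congr (_ + _).
  apply: eq_bigr => j ji; apply: eq_bigl => la'; apply/idP/swpP.
    by move=> e'; have [|mu] := edge_cross _ e_La e'; [rewrite eq_sym|exists mu].
  move=> [mu e e']; have [|La' e_La' e'_La'] := edge_cross_up _ e e'.
    by rewrite eq_sym.
  by rewrite (edge_injr e_La e_La').
by apply: big_pred1 => la'; apply/idP/eqP => [/edge_injl|->//]; exact.
Qed.

Lemma dimp_down_off la (j : 'I_m.+2) :
  \sum_(mu : intpart m | edge mu la j) m.+1%:R * (dimp mu)%:R =
  \sum_(i < m.+2 | i != j) \sum_(la' | swp la la' i j) (dimp la')%:R +
  (removable (rowlen la) j)%:R * (dimp la)%:R :> R.
Proof.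
have [/edge_down[mu e_mu]|nrem] := boolP (removable (rowlen la) j); last first.
  rewrite mul0r addr0 !big1 //.
    move=> i ij; rewrite big_pred0 // => la'; apply/negbTE/swpP => -[mu e e'].
    by rewrite (edge_rem e) in nrem.
  by move=> mu /edge_rem; rewrite (negbTE nrem).
rewrite (big_pred1 mu); last by move=> ?; apply/idP/eqP => [/edge_injl|->//]; exact.
rewrite -dimp_up.
rewrite (big_ord_widen m.+2 (fun i => \sum_(la' | edge mu la' i) (dimp la')%:R)) //.
rewrite big_mkcond (bigD1 j) //= addrC mul1r; congr (_ + _).
  apply: eq_bigr => i ij.
  rewrite (_ : (if _ then _ else _) = \sum_(la' | edge mu la' i) (dimp la')%:R).
    apply: eq_bigl => la'; apply/idP/swpP => [e'|[mu' e e']]; first by exists mu.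
    by rewrite (edge_injl e_mu e).
  case: ifP => // h; rewrite big1 // => la' /edge_le; by rewrite -ltnS h.
rewrite ifT; last by rewrite ltnS (edge_le e_mu).
by apply: big_pred1 => la'; apply/idP/eqP => [/edge_injr|->//]; exact.
Qed.

Let N := m.+2.

(** Given la', i and j, at most one [la] occurs, and [o] tells whether it does. Removing a box from
    row i leaves the addability of row j unchanged, except that it may block row i + 1. *)
Lemma card_swp la' (i j : 'I_N) : i != j ->
  exists2 o : bool, (forall V : nmodType, forall x : V,
      \sum_(la | swp la la' i j) x = if o then x else 0) &
    [/\ o -> removable (rowlen la') i, o -> addable (rowlen la') j &
       removable (rowlen la') i -> addable (rowlen la') j -> ~~ o -> j = i.+1 :> nat].
Proof.
move=> ij; have [/edge_down[mu e_mu]|nrem] := boolP (removable (rowlen la') i); last first.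
  exists false; last by split.
  move=> V x; rewrite big_pred0 // => la; apply/negbTE/swpP => -[mu e e'].
  by rewrite (edge_rem e') in nrem.
exists (addable (rowlen mu) j).
  move=> V x; rewrite -sum_edge_up; apply: eq_bigl => la; apply/swpP/idP.
    by move=> [mu' e]; move/(edge_injl e_mu) => ->.
  by exists mu.
have /edgeP h := e_mu; split=> // [|_].
  move: (nat_of_ord j) ij (val_eqE i j : (i == j :> nat) = (i == j)) => [//|k] ij eij.
  rewrite !addableS /removable !h [k.+1 == i]eq_sym eij (negbTE ij) addn0.
  by move=> /leq_trans; apply; apply: leq_addr.
move: (nat_of_ord j) ij (val_eqE i j : (i == j :> nat) = (i == j)) => [//|k] ij eij.
rewrite !addableS /removable !h [k.+1 == i]eq_sym eij (negbTE ij) addn0.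
by case: eqP => [->//|_]; rewrite addn0 => ->.
Qed.

Definition addsum (phi : R -> R) la := \sum_(i < N) (addable (rowlen la) i)%:R * phi (acont R la i).
Definition remsum (phi : R -> R) la := \sum_(i < N) (removable (rowlen la) i)%:R * phi (acont R la i - 1).

Section Bound.
Variables (phi : R -> R) (Phi : R).
Hypothesis phi_mono : {homo phi : x y / x <= y}.
Hypothesis phi_ge0 : forall x, 0 <= phi x.
Hypothesis phi_le : forall x, phi x <= Phi.

(** Apart from row 0, the addable rows are the successors of the removable ones, and the contents of
    the two kinds of corners interlace. For a monotone [phi] the differences then telescope. *)
Lemma addsum_remsum la : `|addsum phi la - remsum phi la| <= Phi.
Proof.
rewrite /addsum /remsum big_ord_recl [X in _ - X]big_ord_recr /=.
have -> : removable (rowlen la) m.+1 = false.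
  by apply/negbTE/negP => /removable_lt; rewrite ltnn.
rewrite mul0r addr0 mul1r -addrA -sumrB.
under eq_bigr => i _ do rewrite addableS -mulrBr.
have h : 0 <= \sum_(i < m.+1) (removable (rowlen la) i)%:R *
    (phi (acont R la i - 1) - phi (acont R la i.+1)) <= phi (acont R la 0) - phi (acont R la m.+1).
  have lt_a i : acont R la i.+1 <= acont R la i - 1.
    by rewrite /acont [i.+1%:R]mulrSr opprD addrA lerB // lerB // ler_nat rowlen_homo.
  apply/andP; split.
    by apply: sumr_ge0 => i _; rewrite mulr_ge0 // subr_ge0 phi_mono.
  apply: (@le_trans _ _ (\sum_(i < m.+1) (phi (acont R la i) - phi (acont R la i.+1)))).
    apply: ler_sum => i _; apply: (@le_trans _ _ (phi (acont R la i - 1) - phi (acont R la i.+1))).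
      by rewrite ler_piMl ?lern1 ?leq_b1 // subr_ge0 phi_mono.
    by rewrite lerB // phi_mono // gerBl.
  rewrite -(big_mkord xpredT (fun i => phi (acont R la i) - phi (acont R la i.+1))).
  by rewrite -[X in _ <= X]opprB -(telescope_sumr (fun i => phi (acont R la i))) // -sumrN le_eqVlt; apply/orP; left; apply/eqP; apply: eq_bigr => i _; rewrite opprB.
move: h; rewrite -[X in `|_ + X|]opprK -sumrN.
under [X in `|_ - X|]eq_bigr => i _ do rewrite -mulrN opprB.
move=> /andP[h0 h1]; have := phi_ge0 (acont R la 0); have := phi_le (acont R la 0).
have := phi_ge0 (acont R la m.+1).
by rewrite ler_norml; lra.
Qed.

Lemma sum_rem la : \sum_(i < N) (removable (rowlen la) i)%:R = (ncor la)%:R :> R.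
Proof. by rewrite -(@ncorE _ la N) ?natr_sum. Qed.

Lemma sum_add la : \sum_(i < N) (addable (rowlen la) i)%:R = (ncor la)%:R + 1 :> R.
Proof. by rewrite natr1 -(@naddE _ la m.+1) ?natr_sum. Qed.

Let psi la (i j : nat) := phi (acont R la i - 1) - phi (acont R la j).

Let psi_le la i j : `|psi la i j| <= Phi.
Proof.
have := phi_ge0 (acont R la i - 1); have := phi_le (acont R la i - 1).
have := phi_ge0 (acont R la j); have := phi_le (acont R la j).
rewrite /psi ler_norml; lra.
Qed.

Let Phi_ge0 : 0 <= Phi.
Proof. exact: le_trans (phi_ge0 0) (phi_le 0). Qed.

(** The bound is linear in [ncor], although there are about ncor^2 pairs: the double sum factors
    through [remsum] and [addsum], which almost cancel. *)
Lemma sum_all_psi la :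
  `|\sum_(i < N) \sum_(j < N)
      (removable (rowlen la) i)%:R * (addable (rowlen la) j)%:R * psi la i j|
  <= 2 * (ncor la)%:R * Phi.
Proof.
have -> : \sum_(i < N) \sum_(j < N)
      (removable (rowlen la) i)%:R * (addable (rowlen la) j)%:R * psi la i j =
    remsum phi la - (ncor la)%:R * (addsum phi la - remsum phi la).
  transitivity (remsum phi la * ((ncor la)%:R + 1) - (ncor la)%:R * addsum phi la).
    rewrite -sum_add -sum_rem !big_distrlr -sumrB; apply: eq_bigr => i _.
    by rewrite -sumrB; apply: eq_bigr => j _; rewrite /psi /=; ring.
  by ring.
apply: le_trans (ler_normB _ _) _.
have -> : 2 * (ncor la)%:R * Phi = (ncor la)%:R * Phi + (ncor la)%:R * Phi by ring.
apply: lerD.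
  rewrite ger0_norm; last by apply: sumr_ge0 => i _; rewrite mulr_ge0.
  by rewrite -sum_rem mulr_suml; apply: ler_sum => i _; rewrite ler_wpM2l.
by rewrite normrM normr_nat ler_wpM2l // addsum_remsum.
Qed.

Lemma swp_sum_le la' (delta : R) : 0 <= delta ->
  \sum_(i < N) \sum_(j < N | j != i) \sum_(la | swp la la' i j) delta <=
  (ncor la')%:R * ((ncor la')%:R + 1) * delta.
Proof.
move=> d0; rewrite -sum_add -sum_rem mulr_suml mulr_suml; apply: ler_sum => i _.
rewrite mulr_sumr mulr_suml big_mkcond; apply: ler_sum => j _.
case: ifP => [ji|_]; last by rewrite !mulr_ge0.
have [|q oE [h1 h2 _]] := @card_swp la' i j; [by rewrite eq_sym|rewrite oE {oE}].
case: q h1 h2 => [-> // -> // |_ _]; first by rewrite !mul1r.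
by rewrite !mulr_ge0.
Qed.

(** The pairs of corners counted by [sum_all_psi] but absent here have j = i or j = i + 1, hence at
    most two for each removable row. *)
Lemma swp_sum_psi la' :
  `|\sum_(i < N) \sum_(j < N | j != i) \sum_(la | swp la la' i j) psi la' i j|
  <= 4 * (ncor la')%:R * Phi.
Proof.
set r := fun i : 'I_N => (removable (rowlen la') i)%:R : R.
set a := fun i : 'I_N => (addable (rowlen la') i)%:R : R.
have h : `|\sum_(i < N) \sum_(j < N) r i * a j * psi la' i j -
    \sum_(i < N) \sum_(j < N | j != i) \sum_(la | swp la la' i j) psi la' i j| <=
    \sum_(i < N) r i * (Phi + Phi).
  rewrite -sumrB; apply: le_trans (ler_norm_sum _ _ _) _; apply: ler_sum => i _.
  rewrite (bigD1 i) //= -addrA -sumrB; apply: le_trans (ler_normD _ _) _.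
  rewrite [X in _ <= X]mulrDr; apply: lerD.
    rewrite !normrM !normr_nat -mulrA ler_wpM2l //.
    by apply: le_trans (psi_le la' i i); rewrite ler_piMl // lern1 leq_b1.
  apply: le_trans (ler_norm_sum _ _ _) _.
  have le_term (j : 'I_N) : j != i ->
      `|r i * a j * psi la' i j - \sum_(la | swp la la' i j) psi la' i j| <=
      if j == i.+1 :> nat then r i * Phi else 0.
    move=> ji; have [|q oE [h1 h2 h3]] := @card_swp la' i j; [by rewrite eq_sym|rewrite oE {oE}].
    rewrite /r /a; case: q h1 h2 h3 => [-> // -> // _|_ _].
      by rewrite !mul1r subrr normr0; case: ifP.
    case: (removable _ i); last by rewrite !mul0r subr0 normr0; case: ifP.
    case: (addable _ j); last by rewrite !(mul0r, mulr0) subr0 normr0; case: ifP; rewrite ?mul1r.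
    by move=> ->//; rewrite eqxx !mul1r subr0.
  apply: le_trans (ler_sum _ le_term) _.
  case: (ltnP i.+1 N) => [lt_i|ge_i]; last first.
    rewrite big1 ?mulr_ge0 // => j _; rewrite ltn_eqF //; exact: leq_trans (ltn_ord j) ge_i.
  rewrite (bigD1 (Ordinal lt_i)) /=; last by rewrite -val_eqE /= gtn_eqF.
  rewrite eqxx big1 ?addr0 // => j /andP[_ h]; case: eqP => // e.
  by move: h; rewrite -val_eqE /= e eqxx.
have h2 := sum_all_psi la'.
rewrite -[X in `|X|](subrK (\sum_(i < N) \sum_(j < N) r i * a j * psi la' i j)).
apply: le_trans (ler_normD _ _) _; rewrite distrC.
apply: le_trans (lerD h h2) _; rewrite -mulr_suml sum_rem.
by rewrite le_eqVlt; apply/orP; left; apply/eqP; ring.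
Qed.

(* Writing dimp La and (m + 1) dimp mu as sums of dimensions over partitions  *)
(* la' of m + 1, both double sums run over pairs (la, la') that differ by the *)
(* move of a box.  For i != j they contain the same pairs, with phi evaluated *)
(* at the same contents up to exchanging la and la', so only the diagonal and *)
(* the variation of f remain.                                                 *)
Lemma kernel_bound (f delta : intpart m.+1 -> R) :
    (forall la, `|f la| <= 1) -> (forall la, 0 <= delta la) ->
    (forall la la' i j, i != j -> swp la la' i j -> `|f la - f la'| <= delta la') ->
  `|\sum_la f la * \sum_(i < N) \sum_(La : intpart m.+2 | edge la La i)
        (dimp La)%:R * phi (acont R la i) -
    \sum_la f la * \sum_(j < N) \sum_(mu : intpart m | edge mu la j)
        m.+1%:R * (dimp mu)%:R * phi (acont R la j - 1)| <=
  \sum_(la : intpart m.+1) (dimp la)%:R *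
     ((5 * (ncor la)%:R + 1 + delta la * ((ncor la)%:R * ((ncor la)%:R + 1))) * Phi).
Proof.
move=> f1 d0 fd.
pose T la' := \sum_(i < N) \sum_(j < N | j != i) \sum_(la | swp la la' i j) f la * psi la' i j.
have -> : \sum_la f la * \sum_(i < N) \sum_(La : intpart m.+2 | edge la La i)
        (dimp La)%:R * phi (acont R la i) =
    \sum_(la' : intpart m.+1) \sum_(i < N) \sum_(j < N | j != i) \sum_(la | swp la la' i j)
       f la * (dimp la')%:R * phi (acont R la' i - 1) +
    \sum_la f la * (dimp la)%:R * addsum phi la.
  under eq_bigr => la _.
    under eq_bigr => i _ do rewrite -mulr_suml dimp_up_off mulrDl.
    rewrite big_split /= mulrDr; over.
  rewrite big_split /=; congr (_ + _).
    under eq_bigr => la _.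
      rewrite mulr_sumr; under eq_bigr => i _.
        rewrite mulr_suml mulr_sumr; under eq_bigr => j ji.
          rewrite mulr_suml mulr_sumr; under eq_bigr => la' sw.
            rewrite (swp_acont _ sw); last by rewrite eq_sym. rewrite mulrA; over.
          over.
        over.
      over.
    rewrite exchange_big [RHS]exchange_big; apply: eq_bigr => i _.
    rewrite exchange_big [RHS]exchange_big; apply: eq_bigr => j ji.
    by rewrite (exchange_big_dep xpredT).
  by apply: eq_bigr => la _; rewrite -[RHS]mulrA /addsum; congr (_ * _); rewrite mulr_sumr;
    apply: eq_bigr => i _; ring.
have -> : \sum_la f la * \sum_(j < N) \sum_(mu : intpart m | edge mu la j)
        m.+1%:R * (dimp mu)%:R * phi (acont R la j - 1) =
    \sum_(la' : intpart m.+1) \sum_(i < N) \sum_(j < N | j != i) \sum_(la | swp la la' i j)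
       f la * (dimp la')%:R * phi (acont R la' j) +
    \sum_la f la * (dimp la)%:R * remsum phi la.
  under eq_bigr => la _.
    under eq_bigr => j _ do rewrite -mulr_suml dimp_down_off mulrDl.
    rewrite big_split /= mulrDr; over.
  rewrite big_split /=; congr (_ + _).
    under eq_bigr => la _.
      rewrite mulr_sumr; under eq_bigr => j _.
        rewrite mulr_suml mulr_sumr; under eq_bigr => i ij.
          rewrite mulr_suml mulr_sumr; under eq_bigr => la' sw.
            have -> : acont R la j - 1 = acont R la' j.
              have sw' : swp la' la j i by rewrite swp_sym.
              by rewrite (swp_acont _ sw') // eq_sym.
            rewrite mulrA; over.
          over.
        over.
      over.
    rewrite exchange_big [RHS]exchange_big /=.
    under eq_bigr => j _ do rewrite exchange_big /=.
    under [RHS]eq_bigr => i _ do rewrite exchange_big /=.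
    rewrite [RHS](exchange_big_dep xpredT) //=; apply: eq_bigr => j _.
    apply: eq_big => [i|i ij]; first by rewrite eq_sym.
    by rewrite (exchange_big_dep xpredT).
  by apply: eq_bigr => la _; rewrite -[RHS]mulrA /remsum; congr (_ * _); rewrite mulr_sumr;
    apply: eq_bigr => i _; ring.
rewrite opprD addrACA -!sumrB -big_split /=.
apply: le_trans (ler_norm_sum _ _ _) _; apply: ler_sum => la _.
have -> : \sum_(i < N) \sum_(j < N | j != i) \sum_(la0 | swp la0 la i j)
       f la0 * (dimp la)%:R * phi (acont R la i - 1) -
    \sum_(i < N) \sum_(j < N | j != i) \sum_(la0 | swp la0 la i j)
       f la0 * (dimp la)%:R * phi (acont R la j) +
    (f la * (dimp la)%:R * addsum phi la - f la * (dimp la)%:R * remsum phi la) =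
    (dimp la)%:R * (T la + f la * (addsum phi la - remsum phi la)).
  rewrite mulrDr; congr (_ + _); last by ring.
  rewrite -sumrB mulr_sumr; apply: eq_bigr => i _.
  rewrite -sumrB mulr_sumr; apply: eq_bigr => j _.
  by rewrite -sumrB mulr_sumr; apply: eq_bigr => la' _; rewrite /psi; ring.
rewrite normrM normr_nat ler_wpM2l //.
(* [T la] involves the values of [f] at the shapes swapped with [la]; replacing them by [f la] costs
   [delta la] per pair. *)
have TE : T la = f la * \sum_(i < N) \sum_(j < N | j != i) \sum_(la' | swp la' la i j) psi la i j +
   \sum_(i < N) \sum_(j < N | j != i) \sum_(la' | swp la' la i j) (f la' - f la) * psi la i j.
  rewrite mulr_sumr -big_split; apply: eq_bigr => i _.
  rewrite mulr_sumr -big_split; apply: eq_bigr => j _.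
  rewrite mulr_sumr -big_split; apply: eq_bigr => la' _; rewrite /=; ring.
have h1 : `|f la * \sum_(i < N) \sum_(j < N | j != i) \sum_(la' | swp la' la i j) psi la i j|
    <= 4 * (ncor la)%:R * Phi.
  by rewrite normrM; apply: le_trans (swp_sum_psi la); rewrite ler_piMl.
have h2 : `|\sum_(i < N) \sum_(j < N | j != i) \sum_(la' | swp la' la i j) (f la' - f la) * psi la i j|
    <= (ncor la)%:R * ((ncor la)%:R + 1) * (delta la * Phi).
  apply: le_trans (swp_sum_le la (mulr_ge0 (d0 la) Phi_ge0)).
  apply: le_trans (ler_norm_sum _ _ _) _; apply: ler_sum => i _.
  apply: le_trans (ler_norm_sum _ _ _) _; apply: ler_sum => j ji.
  apply: le_trans (ler_norm_sum _ _ _) _; apply: ler_sum => la' sw.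
  by rewrite normrM ler_pM // (fd _ _ i j) // eq_sym.
have h3 : `|f la * (addsum phi la - remsum phi la)| <= Phi.
  by rewrite normrM; apply: le_trans (addsum_remsum la); rewrite ler_piMl.
rewrite TE; apply: le_trans (ler_normD _ _) _.
apply: le_trans (lerD (le_trans (ler_normD _ _) (lerD h1 h2)) h3) _.
have : 0 <= (ncor la)%:R * Phi by rewrite mulr_ge0.
by move: (ncor la)%:R => c; move: (delta la) => d; nra.
Qed.

End Bound.
End Kernel.

(** Row [n] is empty, so the search through rows 0, ..., n succeeds. *)
Definition nrows n (la : intpart n) : nat :=
  find (fun i => rowlen la i == 0%N) (iota 0 n.+1).

Lemma ltn_nrows n (la : intpart n) i : (i < nrows la)%N = (0 < rowlen la i)%N.
Proof.
have has0 : has (fun i => rowlen la i == 0%N) (iota 0 n.+1).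
  by apply/hasP; exists n; rewrite ?mem_iota ?ltnSn ?rowlen_ge.
have lt_find := has0; rewrite has_find size_iota in lt_find.
case: (ltnP i (nrows la)) => h.
  have := before_find 0%N h; rewrite nth_iota ?add0n; last exact: ltn_trans h lt_find.
  by rewrite lt0n => ->.
have := nth_find 0%N has0; rewrite nth_iota // add0n => /eqP e.
by have := rowlen_homo la h; rewrite e leqn0 => /eqP->.
Qed.

Lemma nrows_unique n (la : intpart n) k :
  (forall i, (0 < rowlen la i)%N = (i < k)%N) -> nrows la = k.
Proof.
move=> h; apply/eqP; rewrite eqn_leq; apply/andP; split; rewrite leqNgt.
  by rewrite ltn_nrows h ltnn.
by rewrite -h -ltn_nrows ltnn.
Qed.

Lemma nrows_edge n (mu : intpart n) la i : edge mu la i ->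
  nrows la = (nrows mu + (i == nrows mu))%N.
Proof.
move=> e; have /edgeP h := e; apply: nrows_unique => k; rewrite h.
have le_i : (i <= nrows mu)%N.
  have := edge_add e; case: i {e h} => // i; rewrite addableS /removable ltn_nrows.
  exact: leq_trans.
have hk := ltn_nrows mu k; have hi := ltn_nrows mu i.
case: (eqVneq i (nrows mu)) le_i hi hk => [<-|ni] le_i hi hk.
  by case: (eqVneq k i) hk => [->|nk] hk /=; lia.
by case: (eqVneq k i) hk => [->|nk] hk /=; lia.
Qed.

(** * Moments and tails of the Gelfand measure *)

Section Weights.
Variable R : realType.

Definition wsum n (f : intpart n -> R) : R := \sum_la (dimp la)%:R * f la.
Definition wtot n : R := \sum_(la : intpart n) (dimp la)%:R.

Lemma wsum1 n : wsum (fun _ : intpart n => 1) = wtot n.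
Proof. by apply: eq_bigr => la _; rewrite mulr1. Qed.

Lemma wtot_ge0 n : 0 <= wtot n.
Proof. exact: sumr_ge0. Qed.

Lemma wsum_le n (f g : intpart n -> R) : (forall la, f la <= g la) -> wsum f <= wsum g.
Proof. by move=> h; apply: ler_sum => la _; rewrite ler_wpM2l. Qed.

Lemma wsum_ge0 n (f : intpart n -> R) : (forall la, 0 <= f la) -> 0 <= wsum f.
Proof. by move=> h; apply: sumr_ge0 => la _; rewrite mulr_ge0. Qed.

Lemma wsumD n (f g : intpart n -> R) : wsum (fun la => f la + g la) = wsum f + wsum g.
Proof. by rewrite -big_split; apply: eq_bigr => la _; rewrite mulrDr. Qed.

Lemma wsumZ n (f : intpart n -> R) c : wsum (fun la => c * f la) = c * wsum f.
Proof. by rewrite mulr_sumr; apply: eq_bigr => la _; rewrite mulrCA. Qed.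

Lemma wsum_up n (f : intpart n.+1 -> R) :
  wsum f = \sum_(mu : intpart n) (dimp mu)%:R *
     \sum_(i < n.+1) \sum_(la | edge mu la i) f la.
Proof.
rewrite /wsum; under eq_bigr => la _.
  rewrite (dimp_recR R la (ltnSn n)) mulr_suml.
  under eq_bigr => i _ do rewrite mulr_suml.
  over.
rewrite exchange_big; under [RHS]eq_bigr => mu _ do rewrite mulr_sumr.
rewrite [RHS]exchange_big; apply: eq_bigr => i _ /=.
rewrite (exchange_big_dep xpredT) //=; apply: eq_bigr => mu _.
by rewrite mulr_sumr.
Qed.

(** Double counting of edges: [la] has one edge below it for each removable row. *)
Lemma wsum_ncor n (f : intpart n.+1 -> R) :
  wsum (fun la => (ncor la)%:R * f la) =
  \sum_(mu : intpart n) \sum_(i < n.+1) \sum_(la | edge mu la i) (dimp la)%:R * f la.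
Proof.
have cE (la : intpart n.+1) : (ncor la)%:R = \sum_(i < n.+1) (removable (rowlen la) i)%:R :> R.
  by rewrite /ncor natr_sum.
rewrite [RHS]exchange_big /wsum /=.
under eq_bigr => la _.
  rewrite cE mulr_suml mulr_sumr; over.
rewrite exchange_big; apply: eq_bigr => i _ /=.
rewrite [RHS](exchange_big_dep xpredT) //=; apply: eq_bigr => la _.
rewrite sum_edge_down; case: removable; rewrite ?mul1r //.
by rewrite mul0r mulr0.
Qed.

Lemma sum_addable n (mu : intpart n) (x : R) :
  \sum_(i < n.+1) \sum_(la | edge mu la i) x = ((ncor mu)%:R + 1) * x.
Proof.
rewrite natr1 -(@naddE _ mu n) // natr_sum mulr_suml; apply: eq_bigr => i _.
by rewrite sum_edge_up; case: addable; rewrite ?mul1r ?mul0r.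
Qed.

Lemma wtot_ncor n : wsum (fun la : intpart n.+1 => (ncor la)%:R) = n.+1%:R * wtot n.
Proof.
transitivity (wsum (fun la : intpart n.+1 => (ncor la)%:R * 1)).
  by apply: eq_bigr => la _; rewrite mulr1.
rewrite wsum_ncor mulr_sumr; apply: eq_bigr => mu _; rewrite -dimp_up.
by apply: eq_bigr => i _; apply: eq_bigr => la _; rewrite mulr1.
Qed.

Lemma wtotS n : wtot n.+1 = wtot n + wsum (fun la : intpart n => (ncor la)%:R).
Proof.
rewrite -wsum1 wsum_up -wsum1 -wsumD; apply: eq_bigr => mu _.
by rewrite sum_addable mulr1 addrC.
Qed.

(* wtot is the number of involutions of n points.                             *)
Lemma wtotSS n : wtot n.+2 = wtot n.+1 + n.+1%:R * wtot n.
Proof. by rewrite wtotS wtot_ncor. Qed.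

Lemma ncor_le n (la : intpart n) : (ncor la)%:R <= Num.sqrt (2 * n%:R) :> R.
Proof.
rewrite -[X in X <= _]ger0_norm // -sqrtr_sqr ler_wsqrtr //.
by rewrite -natrX -natrM ler_nat mul2n ncor_sq.
Qed.

(** By [wtot_ncor] the quotient (n + 1) wtot n / wtot (n + 1) is the mean number of corners, which
    [ncor_le] bounds. *)
Lemma wtot_ratio n : Num.sqrt n.+1%:R * wtot n <= Num.sqrt 2 * wtot n.+1.
Proof.
have h : n.+1%:R * wtot n <= Num.sqrt 2 * Num.sqrt n.+1%:R * wtot n.+1.
  rewrite -wtot_ncor -sqrtrM // -wsum1 -wsumZ; apply: wsum_le => la.
  by rewrite mulr1 ncor_le.
have p : 0 < Num.sqrt n.+1%:R :> R by rewrite sqrtr_gt0 ltr0n.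
rewrite -(ler_pM2l p) mulrA -expr2 sqr_sqrtr //.
by apply: le_trans h _; rewrite mulrCA mulrA.
Qed.

Lemma expR1_le3 : expR 1 <= 3 :> R.
Proof.
(* This is exp (-1/8) >= 7/8, and (8/7)^8 < 3. *)
have h : expR (8^-1) <= 8 / 7 :> R.
  rewrite -[8^-1]opprK expRN -[8 / 7]invrK lef_pV2 ?posrE ?expR_gt0 ?invr_gt0 //.
  have := expR_ge1Dx (- 8^-1 : R); lra.
have -> : expR 1 = expR (8^-1) ^+ 8 :> R by rewrite -expRM_natl; congr expR; field.
apply: (@le_trans _ _ ((8 / 7) ^+ 8)); first by rewrite lerXn2r ?nnegrE ?expR_ge0.
lra.
Qed.

Section ExpMoment.
(* t counts boxes of a given kind: it grows when a box is put in row rho mu,  *)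
(* and then that box is the one in row rho' la.                               *)
Variable t : forall n, intpart n -> nat.
Variable rho : forall n, intpart n -> nat.
Variable rho' : forall n, intpart n -> nat.
Arguments t {n}. Arguments rho {n}. Arguments rho' {n}.
Hypothesis t0 : forall la : intpart 0, t la = 0%N.
Hypothesis t_edge : forall n (mu : intpart n) la i, edge mu la i ->
  t la = (t mu + (i == rho mu))%N.
Hypothesis rho_edge : forall n (mu : intpart n) la i, edge mu la i ->
  i = rho mu -> i = rho' la.

Let f n (la : intpart n) : R := expR (t la)%:R.
Arguments f {n}.
Let e : R := expR 1.

Let f_edge n (mu : intpart n) la i : edge mu la i ->
  f la = f mu * (if i == rho mu then e else 1).
Proof.
move=> /t_edge h; rewrite /f h natrD expRD; case: eqP => // _.
by rewrite expR0.
Qed.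

Let e_ge1 : 1 <= e.
Proof. by rewrite /e -expR0 ler_expR. Qed.

Let e_le3 : e <= 3.
Proof. exact: expR1_le3. Qed.

Let f_ge0 n (la : intpart n) : 0 <= f la.
Proof. exact: expR_ge0. Qed.

(** Only the row [rho mu] multiplies the exponential by e; in every other addable row it keeps its
    value. *)
Lemma wsum_exp_up n : wsum (@f n.+1) <= e * wsum (@f n) +
   wsum (fun la : intpart n => (ncor la)%:R * f la).
Proof.
rewrite wsum_up -wsumZ -wsumD; apply: ler_sum => mu _; rewrite ler_wpM2l //.
apply: (@le_trans _ _ (\sum_(i < n.+1)
   ((addable (rowlen mu) i)%:R * f mu + (i == rho mu :> nat)%:R * (f mu * (e - 1))))).
  apply: ler_sum => i _; under eq_bigr => la e_la do rewrite (f_edge e_la).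
  rewrite sum_edge_up; case: addable.
    by case: eqP => _; rewrite mul1r ?mul1r ?mul0r; lra.
  by rewrite mul0r add0r mulr_ge0 // mulr_ge0 // subr_ge0.
rewrite big_split /= -!mulr_suml -natr_sum naddE // -natr1.
suff h : \sum_(i < n.+1) (i == rho mu :> nat)%:R <= 1 :> R.
  have := ler_wpM2r (mulr_ge0 (f_ge0 mu) _ : 0 <= f mu * (e - 1)) h.
  by rewrite subr_ge0 => /(_ e_ge1); lra.
case: (ltnP (rho mu) n.+1) => [lt_rho|ge_rho].
  rewrite (bigD1 (Ordinal lt_rho)) //= eqxx big1 ?addr0 // => i.
  by rewrite -val_eqE /= => /negbTE->.
rewrite big1 // => i _; rewrite ltn_eqF //; exact: leq_trans (ltn_ord i) ge_rho.
Qed.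

(** Count edges as in [wsum_ncor]. Those on which [t] does not grow give the first term; the others
    are at most one for each [la], because [rho'] recovers their row. *)
Lemma wsum_exp_ncor n : wsum (fun la : intpart n.+1 => (ncor la)%:R * f la) <=
  n.+1%:R * wsum (@f n) + wsum (@f n.+1).
Proof.
rewrite wsum_ncor.
have -> : n.+1%:R * wsum (@f n) = \sum_(mu : intpart n) \sum_(i < n.+1)
    \sum_(la | edge mu la i) (dimp la)%:R * f mu.
  rewrite /wsum mulr_sumr; apply: eq_bigr => mu _; rewrite mulrA -dimp_up mulr_suml.
  by apply: eq_bigr => i _; rewrite mulr_suml.
apply: (@le_trans _ _ (\sum_(mu : intpart n) \sum_(i < n.+1)
    \sum_(la | edge mu la i) ((dimp la)%:R * f mu + (i == rho mu :> nat)%:R * ((dimp la)%:R * f la)))).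
  apply: ler_sum => mu _; apply: ler_sum => i _; apply: ler_sum => la e_la.
  rewrite (f_edge e_la); case: eqP => _; last by rewrite mul0r addr0 mulr1.
  by rewrite mul1r lerDr mulr_ge0.
under eq_bigr => mu _.
  under eq_bigr => i _ do rewrite big_split /=.
  rewrite big_split /=; over.
rewrite big_split /= lerD2l exchange_big /=.
under eq_bigr => i _ do rewrite (exchange_big_dep xpredT) //=.
rewrite exchange_big /wsum /=; apply: ler_sum => la _.
under eq_bigr => i _ do rewrite -mulr_suml.
rewrite -mulr_suml ler_piMl ?mulr_ge0 //.
apply: (@le_trans _ _ (\sum_(i < n.+1) (i == rho' la :> nat)%:R)).
  apply: ler_sum => i _; case: (eqVneq (i : nat) (rho' la)) => [_|ni].
    apply: (@le_trans _ _ (\sum_(mu : intpart n | edge mu la i) 1)).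
      by apply: ler_sum => mu _; rewrite lern1 leq_b1.
    by rewrite sum_edge_down; case: removable.
  rewrite big1 // => mu e_mu; case: eqP => // /(rho_edge e_mu) h.
  by rewrite h eqxx in ni.
case: (ltnP (rho' la) n.+1) => [lt_rho|ge_rho].
  rewrite (bigD1 (Ordinal lt_rho)) //= eqxx big1 ?addr0 // => i.
  by rewrite -val_eqE /= => /negbTE->.
rewrite big1 // => i _; rewrite ltn_eqF //; exact: leq_trans (ltn_ord i) ge_rho.
Qed.

(** By the two previous lemmas and e + 1 <= 4, [wsum] satisfies the recursion [wtotSS] up to an
    excess 3 wtot (n + 1). By [wtot_ratio] and sqrt 2 <= 3/2, the excess is at most 9 / (2 sqrt (n +
    2)) times wtot (n + 2), and the growth of exp (9 sqrt n) absorbs it. *)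
Lemma wsum_exp_le n : wsum (@f n) <= expR (9 * Num.sqrt n%:R) * wtot n.
Proof.
suff : wsum (@f n) <= expR (9 * Num.sqrt n%:R) * wtot n /\
       wsum (@f n.+1) <= expR (9 * Num.sqrt n.+1%:R) * wtot n.+1 by case.
elim: n => [|n [IH0 IH1]].
  have Z0 : wsum (@f 0) = wtot 0.
    by apply: eq_bigr => la _; rewrite /f t0 expR0 mulr1.
  have c0 g : wsum (fun la : intpart 0 => (ncor la)%:R * g la) = 0.
    by rewrite /wsum big1 // => la _; rewrite /ncor big_ord0 mul0r mulr0.
  have w1 : wtot 1 = wtot 0.
    rewrite wtotS; rewrite -[RHS]addr0; congr (_ + _).
    by rewrite -[RHS](c0 (fun=> 1)); apply: eq_bigr => la _; rewrite mulr1.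
  rewrite Z0 sqrtr0 mulr0 expR0 mul1r; split=> //.
  apply: le_trans (wsum_exp_up 0) _; rewrite c0 addr0 Z0 w1 ler_wpM2r ?wtot_ge0 //.
  by rewrite sqrtr1 mulr1 /e ler_expR; lra.
split=> //.
set s := Num.sqrt n.+2%:R; set s1 := Num.sqrt n.+1%:R in IH1 *.
have s_gt0 : 0 < s by rewrite sqrtr_gt0 ltr0n.
have s1_ge0 : 0 <= s1 by exact: sqrtr_ge0.
have ss : s ^+ 2 = n.+1%:R + 1 by rewrite sqr_sqrtr // natr1.
have ss1 : s1 ^+ 2 = n.+1%:R by rewrite sqr_sqrtr.
have E0 : wsum (@f n) <= expR (9 * s1) * wtot n.
  apply: le_trans IH0 _; rewrite ler_wpM2r ?wtot_ge0 // ler_expR ler_wpM2l // ler_wsqrtr //.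
  by rewrite ler_nat.
apply: (@le_trans _ _ (expR (9 * s1) * (wtot n.+2 + 3 * wtot n.+1))).
  apply: le_trans (wsum_exp_up _) _; apply: le_trans (lerD (lexx _) (wsum_exp_ncor _)) _.
  rewrite wtotSS; have := ler_wpM2l (ler0n R n.+1) E0.
  have : 0 <= wsum (@f n.+1) by apply: wsum_ge0.
  move: e_le3 IH1; move: (n.+1%:R : R) (wsum _) (wsum _) (wtot _) (wtot _) (expR _) => k a b c d x.
  by nra.
have r := wtot_ratio n.+1; rewrite -/s in r.
have sq2 : Num.sqrt 2 <= 3 / 2 :> R.
  rewrite -[X in _ <= X]ger0_norm; last lra.
  rewrite -sqrtr_sqr ler_wsqrtr //; lra.
have -> : expR (9 * s) = expR (9 * s1) * expR (9 * (s - s1)).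
  by rewrite -expRD; congr expR; ring.
rewrite -mulrA ler_wpM2l ?expR_ge0 //.
have d_ge : 1 <= 2 * s * (s - s1).
  have : s1 <= s by rewrite ler_wsqrtr // ler_nat.
  nra.
have := expR_ge1Dx (9 * (s - s1)).
have w2 := wtot_ge0 n.+2; have w1 := wtot_ge0 n.+1.
move=> h; apply: (@le_trans _ _ ((1 + 9 * (s - s1)) * wtot n.+2)); last by rewrite ler_wpM2r.
rewrite [X in _ <= X]mulrDl mul1r lerD2l -(ler_pM2l s_gt0).
apply: (@le_trans _ _ (3 * (3 / 2 * wtot n.+2))).
  rewrite mulrCA ler_wpM2l //; apply: le_trans r _; by rewrite ler_wpM2r.
by nra.
Qed.

Lemma exp_tail n (x : R) :
  wsum (fun la : intpart n => (x <= (t la)%:R)%R%:R) <=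
  expR (9 * Num.sqrt n%:R - x) * wtot n.
Proof.
rewrite expRD expRN mulrAC; apply: (@le_trans _ _ (wsum (@f n) / expR x)); last first.
  by rewrite ler_wpM2r ?invr_ge0 ?expR_ge0 ?wsum_exp_le.
rewrite mulrC -wsumZ; apply: wsum_le => la; rewrite mulrC.
case: (boolP (x <= (t la)%:R)) => [h|_]; last by rewrite divr_ge0 ?expR_ge0.
by rewrite ler_pdivlMr ?expR_gt0 // mul1r ler_expR.
Qed.

End ExpMoment.

Lemma first_row_tail n (x : R) :
  wsum (fun la : intpart n => (x <= (rowlen la 0)%:R)%R%:R) <=
  expR (9 * Num.sqrt n%:R - x) * wtot n.
Proof.
apply: (exp_tail (t := fun n (la : intpart n) => rowlen la 0)
  (rho := fun n la => 0%N) (rho' := fun n la => 0%N)) => //.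
- by move=> la; rewrite rowlen_ge.
- by move=> k mu la i /edgeP ->; rewrite eq_sym.
Qed.

(** The count grows when the box opens the row of index nrows mu, which is afterwards the last row
    of [la]. *)
Lemma nrows_tail n (x : R) :
  wsum (fun la : intpart n => (x <= (nrows la)%:R)%R%:R) <=
  expR (9 * Num.sqrt n%:R - x) * wtot n.
Proof.
apply: (exp_tail (t := nrows) (rho := nrows) (rho' := fun n la => (nrows la).-1)).
- by move=> la; apply: nrows_unique => i; rewrite rowlen_ge.
- by move=> k mu la i /nrows_edge.
- by move=> k mu la i /nrows_edge -> ->; rewrite eqxx addn1.
Qed.

End Weights.

(** * Cauchy transforms *)

Section Cauchy.
Variable R : realType.
Implicit Types (n : nat) (z : R).

(* Cauchy transforms of the transition and cotransition measures; gtr and hco *)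
(* below are their rescalings by sqrt n, and 1 / gtr = s - hco.               *)
Definition Gtr n (la : intpart n) z : R :=
  \sum_(i < n.+1) wt (fun k : 'I_n.+1 => acont R la k) i / (z - acont R la i).

Definition Hco n (la : intpart n) z : R :=
  \sum_(i < n.+1) nu (fun k : 'I_n.+1 => acont R la k) i / (z - (acont R la i - 1)).

Definition Pco n (la : intpart n) N z : R :=
  \prod_(i < N) ((z - acont R la i + 1) / (z - acont R la i)).

Lemma acont_le0 n (la : intpart n) i : acont R la i <= (rowlen la 0)%:R.
Proof.
apply: (@le_trans _ _ (rowlen la i)%:R); first by rewrite /acont gerBl.
by rewrite ler_nat rowlen_homo.
Qed.

Lemma Gtr_prod n (la : intpart n) z : (rowlen la 0)%:R < z ->
  Gtr la z = (z + n.+1%:R)^-1 * Pco la n.+1 z.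
Proof.
move=> lt_z; have z_gt0 : 0 < z by apply: le_lt_trans lt_z.
rewrite /Gtr wt_frac //.
- exact: acont_inj_ord.
- by rewrite /acont rowlen_ge ?sub0r.
- by move=> i; rewrite gt_eqF // acontN.
- by move=> i; rewrite gt_eqF // (le_lt_trans (acont_le0 la i)).
- by rewrite gt_eqF // addr_gt0.
Qed.

Lemma Pco_gt0 n (la : intpart n) N z : (rowlen la 0)%:R < z -> 0 < Pco la N z.
Proof.
move=> lt_z; apply: prodr_gt0 => i _.
have : 0 < z - acont R la i by rewrite subr_gt0 (le_lt_trans (acont_le0 la i)).
by move=> h; rewrite divr_gt0 // addr_gt0.
Qed.

Lemma Gtr_gt0 n (la : intpart n) z : (rowlen la 0)%:R < z -> 0 < Gtr la z.
Proof.
move=> lt_z; have z_gt0 : 0 < z by apply: le_lt_trans lt_z.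
by rewrite Gtr_prod // mulr_gt0 ?Pco_gt0 // invr_gt0 addr_gt0.
Qed.

(** Both transforms are expressed by the same product over the rows, which occurs inverted in
    [nu_frac]. *)
Lemma Gtr_Hco n (la : intpart n) z : (rowlen la 0)%:R < z ->
  Gtr la z * (z - Hco la z) = 1.
Proof.
move=> lt_z; have z_gt0 : 0 < z by apply: le_lt_trans lt_z.
have z_a i : 0 < z - acont R la i by rewrite subr_gt0 (le_lt_trans (acont_le0 la i)).
rewrite Gtr_prod // /Hco nu_frac; first last.
- move=> i; rewrite gt_eqF // -subr_gt0.
  by have -> : z - (acont R la i - 1) = z - acont R la i + 1; [ring|rewrite addr_gt0].
- exact: acont_inj_ord.
rewrite subKr mulrACA mulVf ?mul1r; last by rewrite gt_eqF // addr_gt0.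
rewrite /Pco -big_split big1 //= => i _.
have h := z_a i; have -> : z - (acont R la i - 1) = z - acont R la i + 1 by ring.
by rewrite mulf_div [X in X / _]mulrC divff // mulf_neq0 // gt_eqF // addr_gt0.
Qed.

Lemma Gtr_le n (la : intpart n) z : (rowlen la 0)%:R < z ->
  Gtr la z <= (z - (rowlen la 0)%:R)^-1.
Proof.
move=> lt_z; have -> : (z - (rowlen la 0)%:R)^-1 =
    (\sum_(i < n.+1) wt (fun k : 'I_n.+1 => acont R la k) i) / (z - (rowlen la 0)%:R).
  by rewrite wt_sum_acont mul1r.
rewrite mulr_suml.
apply: ler_sum => i _; rewrite ler_wpM2l ?wt_ge0 // lef_pV2 ?posrE ?subr_gt0 //.
  by rewrite lerB // acont_le0.
by rewrite (le_lt_trans (acont_le0 la i)).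
Qed.

Lemma Hco_ge0 n (la : intpart n) z : (rowlen la 0)%:R < z -> 0 <= Hco la z.
Proof.
move=> lt_z; apply: sumr_ge0 => i _; rewrite divr_ge0 ?nu_ge0 // ltW //.
by rewrite subr_gt0 ltrBlDr ltr_wpDr // (le_lt_trans (acont_le0 la i)).
Qed.

Lemma Hco_le n (la : intpart n) z : (rowlen la 0)%:R < z ->
  Hco la z <= n%:R / (z - (rowlen la 0)%:R).
Proof.
move=> lt_z; rewrite -(nu_sum_acont R la (leqnSn n)) mulr_suml.
apply: ler_sum => i _; rewrite ler_wpM2l ?nu_ge0 // lef_pV2 ?posrE ?subr_gt0 //.
  by rewrite lerB // (le_trans _ (acont_le0 la i)) // gerBl.
by rewrite ltrBlDr ltr_wpDr // (le_lt_trans (acont_le0 la i)).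
Qed.

(** With x = z - acont mu i, the new box changes the factor of its row from (x + 1) / x to x / (x -
    1), and no other factor. *)
Lemma Pco_edge n (mu : intpart n) la i N z : (i < N)%N -> edge mu la i ->
    (rowlen la 0)%:R < z ->
  Pco mu N z = Pco la N z * (1 - (z - acont R mu i) ^- 2).
Proof.
move=> lt_iN e lt_z.
have la_a k : 0 < z - acont R la k by rewrite subr_gt0 (le_lt_trans (acont_le0 la k)).
rewrite /Pco (bigD1 (Ordinal lt_iN)) //= [in RHS](bigD1 (Ordinal lt_iN)) //=.
rewrite (eq_bigr (fun k : 'I_N => (z - acont R la k + 1) / (z - acont R la k))); last first.
  by move=> k; rewrite -val_eqE /= => /negbTE h; rewrite (acont_edge R k e) h addr0.
have h := la_a i; rewrite (acont_edge R i e) eqxx mulr1n in h *.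
rewrite [RHS]mulrAC; congr (_ * _).
have h0 : z - acont R mu i != 0 by rewrite gt_eqF //; lra.
have h1 : z - (acont R mu i + 1) != 0 by rewrite gt_eqF.
by field; rewrite h1 h0.
Qed.

(** The constant 10 exceeds the rate 9 of [first_row_tail], so bad shapes are rare; it is below 14,
    so for s >= 14 the transforms are evaluated away from the contents. *)
Definition good n (la : intpart n) : bool := (rowlen la 0)%:R <= 10 * Num.sqrt n%:R :> R.

Definition gtr s n (la : intpart n) : R := Num.sqrt n%:R * Gtr la (Num.sqrt n%:R * s).

Definition hco s n (la : intpart n) : R := Hco la (Num.sqrt n%:R * s) / Num.sqrt n%:R.

(** Set to 0 on bad shapes, where the transforms are not controlled, so that it is bounded by 1 as
    [kernel_bound] demands. *)
Definition trgap s n (la : intpart n) : R := if good la then gtr s la - hco s la else 0.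

End Cauchy.

(** * Mean square distance of the two transforms *)

Section L2.
Variable R : realType.
Variable m : nat.
Variable s : R.
Hypothesis s_ge : 14 <= s.
Let n := m.+1.
Let rn : R := Num.sqrt n%:R.
Let z : R := rn * s.
Implicit Type la : intpart n.

Let rn_ge1 : 1 <= rn.
Proof. by rewrite -[X in X <= _]sqrtr1 ler_wsqrtr // ler1n. Qed.

Let rn_ge0 : 0 <= rn.
Proof. exact: sqrtr_ge0. Qed.

Let s14 : 0 <= s - 14.
Proof. by rewrite subr_ge0. Qed.

Let rn_gt0 : 0 < rn.
Proof. exact: lt_le_trans rn_ge1. Qed.

Let rn_sq : rn ^+ 2 = n%:R.
Proof. by rewrite sqr_sqrtr. Qed.

Lemma good_lt la : good R la -> (rowlen la 0)%:R < z.
Proof.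
rewrite /good -/rn /z => h; apply: le_lt_trans h _.
have : 0 <= rn * (s - 14) by exact: mulr_ge0.
by move: rn_ge1; lra.
Qed.

Lemma good_gap la : good R la -> 4 * rn <= z - (rowlen la 0)%:R.
Proof.
rewrite /good -/rn /z => h; have : 0 <= rn * (s - 14) by exact: mulr_ge0.
nra.
Qed.

Lemma gtr_hco la : good R la -> gtr s la * (s - hco s la) = 1.
Proof.
move=> /good_lt lt_z; rewrite -(Gtr_Hco lt_z) /gtr /hco -/rn -/z.
have e : z = rn * s by []. rewrite [in X in _ = _ * (X - _)]e. field. by rewrite gt_eqF.
Qed.

Lemma gtr_gt0 la : good R la -> 0 < gtr s la.
Proof. by move=> /good_lt/Gtr_gt0 h; rewrite mulr_gt0. Qed.

Lemma gtr_le la : good R la -> gtr s la <= 4^-1.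
Proof.
move=> g; have := Gtr_le (good_lt g); rewrite /gtr -/rn -/z => h.
apply: (@le_trans _ _ (rn * (z - (rowlen la 0)%:R)^-1)); first by rewrite ler_pM2l.
have := good_gap g => h'; have p : 0 < z - (rowlen la 0)%:R by apply: lt_le_trans h'; rewrite mulr_gt0.
by rewrite ler_pdivrMr //; lra.
Qed.

Lemma hco_ge0 la : good R la -> 0 <= hco s la.
Proof. by move=> /good_lt/Hco_ge0 h; rewrite divr_ge0 // sqrtr_ge0. Qed.

Lemma hco_le la : good R la -> hco s la <= 4^-1.
Proof.
move=> g; have := Hco_le (good_lt g); rewrite /hco -/rn -/z => h.
rewrite ler_pdivrMr; last exact: rn_gt0.
apply: le_trans h _; have := good_gap g => h'; have p : 0 < z - (rowlen la 0)%:R by apply: lt_le_trans h'; rewrite mulr_gt0.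
have h2 : 0 <= rn * (z - (rowlen la 0)%:R - 4 * rn) by rewrite mulr_ge0 ?subr_ge0.
rewrite ler_pdivrMr // -rn_sq expr2; lra.
Qed.

(** Both shapes arise from [mu] by one box, so by [Pco_edge] the two values of [gtr] differ by a
    factor 1 + O(1 / n); [gtr_hco] transfers this to [hco]. *)
Lemma gtr_hco_swp la la' i j : i != j -> swp la la' i j -> good R la -> good R la' ->
  `|(gtr s la - hco s la) - (gtr s la' - hco s la')| <= s / n%:R.
Proof.
move=> ij /swpP[mu e e'] g g'.
have lt_jN := edge_le e; have lt_iN := edge_le e'.
have P := Pco_edge (N := n.+1) (leqW lt_jN : (j < n.+1)%N) e (good_lt g).
have P' := Pco_edge (N := n.+1) (leqW lt_iN : (i < n.+1)%N) e' (good_lt g').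
have rn0 := rn_gt0.
have x_bound k (nu : intpart n) : good R nu -> edge mu nu k ->
    0 <= (z - acont R mu k) ^- 2 <= (16 * n%:R)^-1.
  move=> gnu enu; have h := good_gap gnu.
  have h' : acont R mu k <= (rowlen nu 0)%:R.
    by apply: le_trans (acont_le0 R nu k); rewrite (acont_edge R k enu) lerDl.
  have h2 : 4 * rn <= z - acont R mu k by lra.
  have h3 : 16 * n%:R <= (z - acont R mu k) ^+ 2 by rewrite -rn_sq; nra.
  rewrite invr_ge0 sqr_ge0 /= lef_pV2 ?posrE //; last by rewrite mulr_gt0 ?ltr0n.
  by apply: lt_le_trans h3; rewrite mulr_gt0 ?ltr0n.
have hx := x_bound _ _ g e; have hy := x_bound _ _ g' e'.
move: P P' hx hy; set x := _ ^- 2; set y := _ ^- 2 => P P' hx hy.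
have GE : Gtr la z * (1 - x) = Gtr la' z * (1 - y).
  by rewrite !Gtr_prod ?good_lt // -!mulrA -P -P'.
have n1 : 1 <= n%:R :> R by rewrite ler1n.
have k16 : (16 * n%:R)^-1 <= 16^-1 :> R by rewrite lef_pV2 ?posrE; lra.
have gE : gtr s la * (1 - x) = gtr s la' * (1 - y).
  by rewrite /gtr -!mulrA GE.
have := gtr_gt0 g; have := gtr_gt0 g'; have := gtr_le g; have := gtr_le g'.
have := gtr_hco g; have := gtr_hco g'; have := hco_ge0 g; have := hco_ge0 g'.
move: gE k16 hx hy; have -> : (16 * n%:R)^-1 = 16^-1 * n%:R^-1 :> R by rewrite invfM.
set v := n%:R^-1.
have v0 : 0 < v by rewrite invr_gt0; lra.
move: (gtr s la) (gtr s la') (hco s la) (hco s la') => a b c d E k16 hx hy d0 c0 E2 E1 b4 a4 b0 a0.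
have sc : s - c <= s by lra. have sd : s - d <= s by lra.
have ab : `|a - b| <= v / 32.
  have -> : a - b = a * (x - y) / (1 - y).
    have q : 1 - y != 0 by rewrite gt_eqF //; lra.
    apply: (mulIf q); rewrite divfK //; rewrite mulrBl -E; ring.
  rewrite normrM normrM normfV (gtr0_norm a0) (gtr0_norm (_ : 0 < 1 - y)); last lra.
  rewrite ler_pdivrMr; last lra.
  have : `|x - y| <= 16^-1 * v by rewrite ler_norml; lra.
  have := normr_ge0 (x - y); nra.
have cd : `|c - d| <= s * v / 8.
  have -> : c - d = (s - c) * ((x - y) / (1 - x)).
    have q : 1 - x != 0 by rewrite gt_eqF //; lra.
    have -> : (x - y) / (1 - x) = (1 - y) / (1 - x) - 1 by field.
    have -> : (1 - y) / (1 - x) = a * (s - d).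
      apply: (mulIf q); rewrite divfK //.
      by rewrite mulrAC E mulrAC E2 mul1r.
    have -> : (s - c) * (a * (s - d) - 1) = a * (s - c) * (s - d) - (s - c) by ring.
    by rewrite E1; ring.
  have sc0 : 0 < s - c by rewrite -(pmulr_rgt0 _ a0) E1.
  rewrite normrM (gtr0_norm sc0) normrM normfV (gtr0_norm (_ : 0 < 1 - x)); last lra.
  have h1 : `|x - y| <= 16^-1 * v by rewrite ler_norml; lra.
  have h2 : `|x - y| / (1 - x) <= v / 8.
    rewrite ler_pdivrMr; last lra. nra.
  have h3 : 0 <= `|x - y| / (1 - x) by rewrite divr_ge0 //; lra.
  nra.
have -> : a - c - (b - d) = (a - b) - (c - d) by ring.
apply: le_trans (ler_normB _ _) _.
have : 0 <= v * (s - 14) by rewrite mulr_ge0 // ltW.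
lra.
Qed.

End L2.

Section L2Bound.
Variable R : realType.
Variable m : nat.
Variable s : R.
Hypothesis s_ge : 14 <= s.
Let n := m.+1.
Let rn : R := Num.sqrt n%:R.
Let z : R := rn * s.
Implicit Type la : intpart m.+1.

Let rn_ge1 : 1 <= rn.
Proof. by rewrite -[X in X <= _]sqrtr1 ler_wsqrtr // ler1n. Qed.

Let rn_gt0 : 0 < rn.
Proof. exact: lt_le_trans rn_ge1. Qed.

Let rn_sq : n%:R = rn * rn.
Proof. by rewrite -expr2 sqr_sqrtr. Qed.

(** The truncation makes the kernel 1 / (z - x) monotone and bounded on the whole line, as
    [kernel_bound] requires; on good shapes it changes nothing ([phiE]). *)
Let phi (x : R) := (z - Num.min x (10 * rn))^-1.

Let z_gap x : rn <= z - Num.min x (10 * rn).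
Proof.
have h : Num.min x (10 * rn) <= 10 * rn by rewrite ge_min lexx orbT.
have : 0 <= rn * (s - 14) by rewrite mulr_ge0 ?subr_ge0 // ltW.
by move: rn_gt0; rewrite /z; lra.
Qed.

Let phi_ge0 x : 0 <= phi x.
Proof. by rewrite invr_ge0 ltW // (lt_le_trans rn_gt0 (z_gap x)). Qed.

Let phi_le x : phi x <= rn^-1.
Proof. by rewrite lef_pV2 ?posrE // (lt_le_trans rn_gt0 (z_gap x)). Qed.

Let phi_mono : {homo phi : x y / x <= y}.
Proof.
move=> x y le_xy; rewrite lef_pV2 ?posrE ?(lt_le_trans rn_gt0) // lerB //.
by rewrite le_min !ge_min le_xy lexx orbT.
Qed.

Let trgap_le la : `|trgap s la| <= 1.
Proof.
rewrite /trgap; case: ifP => [g|_]; last by rewrite normr0.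
have := gtr_le s_ge g; have := gtr_gt0 s_ge g; have := hco_ge0 s_ge g; have := hco_le s_ge g.
by rewrite ler_norml; lra.
Qed.

(** The margin 1 accounts for the move of a box, which changes the first row by at most one: if la'
    is not bad, both shapes are good. *)
Let bad la : bool := 10 * rn - 1 <= (rowlen la 0)%:R.

Let delta la : R := s / n%:R + (bad la)%:R.

Let s0 : 0 <= s / n%:R.
Proof. by rewrite divr_ge0 // (le_trans _ s_ge). Qed.

Let trgap_delta la la' i j : i != j -> swp la la' i j -> `|trgap s la - trgap s la'| <= delta la'.
Proof.
move=> ij sw; rewrite /delta.
have h0 : bad la' -> `|trgap s la - trgap s la'| <= 1.
  move=> _; rewrite /trgap; case: ifP => [g|_]; case: ifP => [g'|_].
  - have := gtr_le s_ge g; have := gtr_gt0 s_ge g; have := hco_ge0 s_ge g; have := hco_le s_ge g.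
    have := gtr_le s_ge g'; have := gtr_gt0 s_ge g'; have := hco_ge0 s_ge g'; have := hco_le s_ge g'.
    by rewrite ler_norml; lra.
  - have := gtr_le s_ge g; have := gtr_gt0 s_ge g; have := hco_ge0 s_ge g; have := hco_le s_ge g.
    by rewrite ler_norml; lra.
  - have := gtr_le s_ge g'; have := gtr_gt0 s_ge g'; have := hco_ge0 s_ge g'; have := hco_le s_ge g'.
    by rewrite ler_norml; lra.
  - by rewrite subrr normr0.
have [b|nb] := boolP (bad la').
  by apply: le_trans (h0 b) _; rewrite lerDr.
rewrite addr0.
have g' : good R la'.
  by move: nb; rewrite /bad /good -ltNge -/rn; lra.
have g : good R la.
  have /swpP[mu /edgeP e /edgeP e'] := sw.
  have : (rowlen la 0)%:R <= (rowlen la' 0)%:R + 1 :> R.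
    by rewrite natr1 ler_nat e e'; move: (rowlen mu 0) => ?; case: eqP; case: eqP; clear; lia.
  by move: nb; rewrite /bad /good -ltNge -/rn; lra.
by rewrite /trgap g g'; apply: (gtr_hco_swp s_ge ij sw g g').
Qed.

Let S1 := \sum_la trgap s la * \sum_(i < m.+2) \sum_(La : intpart m.+2 | edge la La i)
        (dimp La)%:R * phi (acont R la i).
Let S2 := \sum_la trgap s la * \sum_(j < m.+2) \sum_(mu : intpart m | edge mu la j)
        m.+1%:R * (dimp mu)%:R * phi (acont R la j - 1).

Let phiE la x : good R la -> x <= (rowlen la 0)%:R -> phi x = (z - x)^-1.
Proof.
move=> g le_x; rewrite /phi; have -> // : Num.min x (10 * rn) = x.
by apply/min_idPl; apply: le_trans le_x g.
Qed.

Let S1E : wsum (fun la : intpart n => trgap s la * gtr s la) = rn / (n%:R + 1) * S1.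
Proof.
rewrite /S1 mulr_sumr; apply: eq_bigr => la _.
rewrite (sum_up la (fun i => phi (acont R la i))) /trgap; case: ifP => [g|_]; last first.
  by rewrite !mul0r !mulr0.
have -> : \sum_(i < n.+1) wt (fun k : 'I_n.+1 => acont R la k) i * phi (acont R la i) = Gtr la z.
  by apply: eq_bigr => i _; rewrite (phiE g) // acont_le0.
have -> : n.+1%:R = n%:R + 1 :> R by rewrite natr1.
rewrite /gtr -/n -/rn -/z.
have h : n%:R + 1 != 0 :> R by rewrite natr1 pnatr_eq0.
move: (Gtr la z) (hco s la) (dimp la)%:R => G H d; field.
exact: h.
Qed.

Let S2E : wsum (fun la : intpart n => trgap s la * hco s la) = S2 / rn.
Proof.
rewrite /S2 mulr_suml; apply: eq_bigr => la _.
rewrite (sum_down la (fun i => phi (acont R la i - 1)) (ltnW (ltnSn m.+1))) /trgap.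
case: ifP => [g|_]; last by rewrite !mul0r !mulr0.
have -> : \sum_(i < n.+1) nu (fun k : 'I_n.+1 => acont R la k) i * phi (acont R la i - 1) = Hco la z.
  apply: eq_bigr => i _; rewrite (phiE g) //.
  by apply: le_trans (acont_le0 R la i); rewrite gerBl.
by rewrite /hco -/n -/rn -/z; move: (Hco la z) (gtr s la) (dimp la)%:R => H G d; ring.
Qed.

Let ncor_le2 la : (ncor la)%:R <= 2 * rn.
Proof.
apply: le_trans (ncor_le R la) _; rewrite sqrtrM // ler_wpM2r ?sqrtr_ge0 //.
rewrite -[X in _ <= X]ger0_norm // -sqrtr_sqr ler_wsqrtr //; lra.
Qed.

Let ncor_sq_le la : (ncor la)%:R * ((ncor la)%:R + 1) <= 4 * n%:R :> R.
Proof.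
rewrite natr1 -natrM -natrM ler_nat; have := ncor_sq la; rewrite -/n -mul2n.
case: (ncor la) => // c; nia.
Qed.

(** Write the square as trgap gtr - trgap hco. By [S1E] and [S2E] its integral is (rn (S1 - S2) - S2
    / rn) / (n + 1), where [kernel_bound] controls S1 - S2, and S2 / rn is bounded as the integral
    of trgap hco. The exponential term comes from the bad shapes in [delta]. *)
Lemma trgap_sq_le : wsum (fun la : intpart n => trgap s la ^+ 2) <=
  ((10 * rn + 2 + 4 * s) / n%:R + 4 * expR (1 - rn)) * wtot R n.
Proof.
have n0 : 0 < n%:R :> R by rewrite ltr0n.
have n1 : 0 < n%:R + 1 :> R by rewrite addr_gt0.
have W := kernel_bound phi_mono phi_ge0 phi_le trgap_le
  (fun la => addr_ge0 s0 (ler0n R (bad la))) trgap_delta.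
rewrite -/S1 -/S2 in W.
have Wle : \sum_la (dimp la)%:R *
   ((5 * (ncor la)%:R + 1 + delta la * ((ncor la)%:R * ((ncor la)%:R + 1))) / rn) <=
   rn^-1 * ((10 * rn + 1 + 4 * s) * wtot R n + 4 * n%:R * (expR (1 - rn) * wtot R n)).
  apply: (@le_trans _ _ (rn^-1 * ((10 * rn + 1 + 4 * s) * wtot R n + 4 * n%:R * wsum (fun la => (bad la)%:R)))).
    rewrite -wsumZ -[wtot R n]wsum1 -wsumZ -wsumD -wsumZ; apply: ler_sum => la _.
    rewrite ler_wpM2l // [X in X <= _]mulrC ler_wpM2l ?invr_ge0 ?(ltW rn_gt0) // mulr1.
    have h1 := ncor_le2 la; have h2 := ncor_sq_le la.
    have h3 : delta la * ((ncor la)%:R * ((ncor la)%:R + 1)) <= 4 * s + 4 * n%:R * (bad la)%:R.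
      apply: (@le_trans _ _ (delta la * (4 * n%:R))).
        by rewrite ler_wpM2l // addr_ge0.
      rewrite /delta mulrDl; apply: lerD; last by rewrite mulrC.
      by rewrite le_eqVlt; apply/orP; left; apply/eqP; field; rewrite gt_eqF.
    by lra.
  rewrite ler_wpM2l ?invr_ge0 ?(ltW rn_gt0) // lerD2l ler_wpM2l ?mulr_ge0 //.
  have := first_row_tail n (10 * rn - 1).
  by have -> : 9 * Num.sqrt n%:R - (10 * rn - 1) = 1 - rn by rewrite /rn; ring.
have hZ : wsum (fun la : intpart n => trgap s la ^+ 2) = rn / (n%:R + 1) * S1 - S2 / rn.
  rewrite -S1E -S2E -[X in _ - X]mul1r -mulNr -wsumZ -wsumD; apply: eq_bigr => la _.
  rewrite /trgap; case: ifP => _; congr (_ * _); first by ring.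
  by ring.
have hS2 : - wtot R n <= S2 / rn.
  rewrite -S2E -[wtot R n]wsum1 -mulN1r -wsumZ; apply: wsum_le => la; rewrite mulr1.
  rewrite /trgap; case: ifP => [g|_]; last by rewrite mul0r; lra.
  have := gtr_le s_ge g; have := gtr_gt0 s_ge g; have := hco_ge0 s_ge g; have := hco_le s_ge g.
  by nra.
have wt0 := wtot_ge0 R n.
have e : wsum (fun la : intpart n => trgap s la ^+ 2) = (rn * (S1 - S2) - S2 / rn) / (n%:R + 1).
  rewrite hZ rn_sq; have h : rn * rn + 1 != 0 by rewrite -rn_sq gt_eqF.
  by field; rewrite h gt_eqF.
rewrite e ler_pdivrMr //.
have hS : rn * (S1 - S2) <= (10 * rn + 1 + 4 * s) * wtot R n + 4 * n%:R * (expR (1 - rn) * wtot R n).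
  have : S1 - S2 <= rn^-1 * ((10 * rn + 1 + 4 * s) * wtot R n + 4 * n%:R * (expR (1 - rn) * wtot R n)).
    by apply: le_trans (ler_norm _) _; apply: le_trans W Wle.
  by rewrite ler_pdivlMl.
have A0 : 0 <= (10 * rn + 2 + 4 * s) / n%:R * wtot R n.
  by rewrite mulr_ge0 // divr_ge0 //; move: rn_gt0 s_ge; lra.
have B0 : 0 <= 4 * expR (1 - rn) * wtot R n by rewrite !mulr_ge0 ?expR_ge0.
have -> : ((10 * rn + 2 + 4 * s) / n%:R + 4 * expR (1 - rn)) * wtot R n * (n%:R + 1) =
   (10 * rn + 2 + 4 * s) * wtot R n + 4 * n%:R * (expR (1 - rn) * wtot R n) +
   ((10 * rn + 2 + 4 * s) / n%:R * wtot R n + 4 * expR (1 - rn) * wtot R n).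
  by field; rewrite gt_eqF.
by lra.
Qed.

End L2Bound.

(** * Convergence in probability as convergence along a filter *)

Section Whp.
Variable R : realType.

Lemma wtot_gt0 n : 0 < wtot R n.
Proof.
elim: n => [|n IH]; last first.
  by rewrite wtotS ltr_wpDr // wsum_ge0.
have [|la _] := @rowlen_surj 0 (fun=> 0%N) (fun=> leqnn _); first by rewrite big_ord1.
by rewrite /wtot (bigD1 la) //= ltr_pwDl ?sumr_ge0 // ltr0n dimp_gt0.
Qed.

Lemma gelfandE n (A : set (intpart n)) :
  gelfand R A = wsum (fun la => `[< A la >]%:R) / wtot R n.
Proof.
rewrite /gelfand /wsum mulr_suml big_mkcond; apply: eq_bigr => la _.
rewrite /gelfand_pmf natr_sum -/(wtot R n).
rewrite (_ : (la \in A) = `[< A la >]); last by apply/idP/idP => [/set_mem/asboolP|/asboolP/mem_set].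
by case: asbool; rewrite ?mulr1 // mulr0 mul0r.
Qed.

Lemma gelfand_ge0 n (A : set (intpart n)) : 0 <= gelfand R A.
Proof. by rewrite gelfandE divr_ge0 ?wtot_ge0 ?wsum_ge0. Qed.

Lemma gelfand_le n (A B : set (intpart n)) : A `<=` B -> gelfand R A <= gelfand R B.
Proof.
move=> AB; rewrite !gelfandE ler_wpM2r ?invr_ge0 ?wtot_ge0 // wsum_le // => la.
rewrite ler_nat; case: (asboolP (A la)) => // /AB h.
by rewrite (asboolT h).
Qed.

Lemma gelfandU n (A B : set (intpart n)) :
  gelfand R (A `|` B) <= gelfand R A + gelfand R B.
Proof.
rewrite !gelfandE -mulrDl ler_wpM2r ?invr_ge0 ?wtot_ge0 // -wsumD wsum_le // => la.
rewrite -natrD ler_nat; case: (asboolP ((A `|` B) la)) => // -[] h; rewrite (asboolT h) //.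
by rewrite leq_addl.
Qed.

(* The filter of the sets of partitions whose Gelfand probability tends to 1; *)
(* convergence along it is convergence in probability.                        *)
Definition whp : set_system {n & intpart n} := fun A =>
  (fun n => gelfand R [set la | ~ A (existT _ n la)]) @ \oo --> (0 : R).

Global Instance whp_filter : Filter whp.
Proof.
split.
- rewrite /whp (_ : (fun n => _) = fun=> 0); first exact: cvg_cst.
  apply/funext => n; rewrite gelfandE /wsum big1 ?mul0r // => la _.
  by rewrite asboolF ?mulr0 // => h; apply: h.
- move=> A B hA hB; rewrite /whp.
  have hAB : (fun n => gelfand R [set la | ~ A (existT _ n la)] +
                       gelfand R [set la | ~ B (existT _ n la)]) @ \oo --> (0 : R).
    by rewrite -[X in _ --> X]addr0; apply: cvgD.
  apply: (squeeze_cvgr _ (cvg_cst 0) hAB); apply: nearW => n.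
  rewrite gelfand_ge0 /=; apply: le_trans (gelfandU _ _); apply: gelfand_le => la /=.
  by move=> /not_andP[h|h]; [left|right].
- move=> A B AB hA; apply: (squeeze_cvgr _ (cvg_cst 0) hA); apply: nearW => n.
  by rewrite gelfand_ge0 /=; apply: gelfand_le => la /=; apply: contra_not => /AB.
Qed.

Lemma near_sqrt_gt (r : R) : \forall n \near \oo, r < Num.sqrt n%:R.
Proof.
have [r0|r0] := leP 0 r; last first.
  by apply: nearW => n; apply: lt_le_trans r0 _; apply: sqrtr_ge0.
near=> n; rewrite -[X in X < _]ger0_norm // -sqrtr_sqr ltr_sqrt //.
  by near: n; exact: nbhs_infty_gtr.
rewrite ltr0n; near: n; exact: nbhs_infty_gt.
Unshelve. all: by end_near. Qed.

Lemma cvg_inv_sqrt (C : R) : (fun n : nat => C / Num.sqrt n%:R) @ \oo --> (0 : R).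
Proof.
apply/cvgrPdist_lt => e e0; near=> n; rewrite sub0r normrN.
have h : `|C| / e < Num.sqrt n%:R by near: n; exact: near_sqrt_gt.
have p : 0 < Num.sqrt n%:R :> R by apply: le_lt_trans h; rewrite divr_ge0 // ltW.
rewrite normrM normfV (gtr0_norm p) ltr_pdivrMr //.
by move: h; rewrite ltr_pdivrMr // mulrC.
Unshelve. all: by end_near. Qed.

Lemma whp_eventually (P : nat -> Prop) : (\forall n \near \oo, P n) ->
  \forall x \near whp, P (projT1 x).
Proof.
move=> hP; rewrite /prop_near1 /nbhs /= /whp.
apply/cvgrPdist_lt => e e0; near=> n; rewrite sub0r normrN gelfandE /wsum big1 ?mul0r ?normr0 // => la _.
rewrite asboolF ?mulr0 // /=; apply; near: n; exact: hP.
Unshelve. all: by end_near. Qed.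

Lemma whp_sqrt (P : {n & intpart n} -> Prop) (C : R) :
  (forall m, wsum (fun la : intpart m.+1 => (`[< ~ P (existT _ m.+1 la) >])%:R) <=
     C / Num.sqrt m.+1%:R * wtot R m.+1) ->
  \forall x \near whp, P x.
Proof.
move=> h; rewrite /prop_near1 /nbhs /= /whp.
have bound n : (0 < n)%N ->
    gelfand R [set la : intpart n | ~ P (existT _ n la)] <= C / Num.sqrt n%:R.
  by case: n => // m _; rewrite gelfandE ler_pdivrMr ?wtot_gt0.
apply: (squeeze_cvgr _ (cvg_cst 0) (cvg_inv_sqrt C)).
near=> n; rewrite gelfand_ge0 /= bound //.
by near: n; exact: nbhs_infty_gt.
Unshelve. all: by end_near. Qed.

End Whp.

Section Gcvg.
Variable R : realType.

Lemma expRN_le_inv (x : R) : 0 < x -> expR (- x) <= x^-1.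
Proof.
move=> x0; rewrite expRN lef_pV2 ?posrE ?expR_gt0 //.
by apply: le_trans (expR_ge1Dx x); rewrite lerDr.
Qed.

Let rn_ge1 m : 1 <= Num.sqrt m.+1%:R :> R.
Proof. by rewrite -[X in X <= _]sqrtr1 ler_wsqrtr // ler1n. Qed.

Lemma whp_first_row (K : R) : 9 < K ->
  \forall x \near whp R, (rowlen (projT2 x) 0)%:R <= K * Num.sqrt (projT1 x)%:R.
Proof.
move=> K9; apply: (whp_sqrt (C := (K - 9)^-1)) => m /=; set rn := Num.sqrt _.
have p : 0 < (K - 9) * rn by rewrite mulr_gt0 ?subr_gt0 // (lt_le_trans _ (rn_ge1 m)).
apply: (@le_trans _ _ (wsum (fun la : intpart m.+1 => (K * rn <= (rowlen la 0)%:R)%R%:R))).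
  apply: wsum_le => la; rewrite ler_nat; case: asboolP => //=.
  by move=> /negP; rewrite -ltNge => /ltW ->.
apply: le_trans (first_row_tail _ _) _; rewrite ler_wpM2r ?wtot_ge0 //.
have -> : 9 * Num.sqrt m.+1%:R - K * rn = - ((K - 9) * rn) by rewrite /rn; ring.
by rewrite -invfM expRN_le_inv.
Qed.

Lemma whp_nrows (K : R) : 9 < K ->
  \forall x \near whp R, (nrows (projT2 x))%:R <= K * Num.sqrt (projT1 x)%:R.
Proof.
move=> K9; apply: (whp_sqrt (C := (K - 9)^-1)) => m /=; set rn := Num.sqrt _.
have p : 0 < (K - 9) * rn by rewrite mulr_gt0 ?subr_gt0 // (lt_le_trans _ (rn_ge1 m)).
apply: (@le_trans _ _ (wsum (fun la : intpart m.+1 => (K * rn <= (nrows la)%:R)%R%:R))).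
  apply: wsum_le => la; rewrite ler_nat; case: asboolP => //=.
  by move=> /negP; rewrite -ltNge => /ltW ->.
apply: le_trans (nrows_tail _ _) _; rewrite ler_wpM2r ?wtot_ge0 //.
have -> : 9 * Num.sqrt m.+1%:R - K * rn = - ((K - 9) * rn) by rewrite /rn; ring.
by rewrite -invfM expRN_le_inv.
Qed.

Lemma whp_good : \forall x \near whp R, good R (projT2 x).
Proof. by apply: whp_first_row; lra. Qed.

(** Chebyshev's inequality for [trgap_sq_le], all terms being bounded by multiples of 1 / rn. *)
Lemma whp_trgap (s : R) (d : R) : 14 <= s -> 0 < d ->
  \forall x \near whp R, `|trgap s (projT2 x)| < d.
Proof.
move=> s14 d0; apply: (whp_sqrt (C := (24 + 4 * s) / d ^+ 2)) => m /=; set rn := Num.sqrt _.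
have rn1 : 1 <= rn by exact: rn_ge1.
have rn0 : 0 < rn by exact: lt_le_trans rn1.
have d2 : 0 < d ^+ 2 by rewrite exprn_gt0.
apply: (@le_trans _ _ (wsum (fun la : intpart m.+1 => (d ^+ 2)^-1 * trgap s la ^+ 2))).
  apply: wsum_le => la; case: asboolP => [/negP|_] /=; last first.
    by rewrite mulr_ge0 ?sqr_ge0 // invr_ge0 ltW.
  rewrite -leNgt => h; rewrite mulrC ler_pdivlMr // mul1r -[X in _ <= X]real_normK ?num_real //.
  by rewrite ler_sqr ?nnegrE // ltW.
rewrite wsumZ; apply: (@le_trans _ _ ((d ^+ 2)^-1 * ((24 + 4 * s) / rn * wtot R m.+1))); last first.
  by rewrite le_eqVlt; apply/orP; left; apply/eqP; ring.
rewrite ler_wpM2l ?invr_ge0 ?(ltW d2) //; apply: le_trans (trgap_sq_le m s14) _.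
rewrite ler_wpM2r ?wtot_ge0 // -/rn.
have -> : m.+1%:R = rn * rn by rewrite -expr2 sqr_sqrtr.
have h1 : (10 * rn + 2 + 4 * s) / (rn * rn) <= (12 + 4 * s) / rn.
  rewrite invfM mulrA ler_wpM2r ?invr_ge0 ?(ltW rn0) // ler_pdivrMr //.
  have : 0 <= (2 + 4 * s) * (rn - 1) by rewrite mulr_ge0 //; lra.
  lra.
have h2 : expR (1 - rn) <= 3 / rn.
  by rewrite expRD ler_pM ?expR_ge0 ?expR1_le3 ?expRN_le_inv.
have -> : (24 + 4 * s) / rn = (12 + 4 * s) / rn + 4 * (3 / rn) by ring.
lra.
Qed.

(* The Cauchy transform of the semicircle law on [-2, 2].                     *)
Definition gam (s : R) : R := (s - Num.sqrt (s ^+ 2 - 4)) / 2.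

Lemma gam_root s : 2 <= s -> gam s ^+ 2 - s * gam s = -1.
Proof.
move=> s2; rewrite /gam; have h : 0 <= s ^+ 2 - 4 by nra.
have := sqr_sqrtr h; set r := Num.sqrt _ => hr.
have -> : ((s - r) / 2) ^+ 2 - s * ((s - r) / 2) = (r ^+ 2 - s ^+ 2) / 4 by field.
by rewrite hr; field.
Qed.

Lemma gam_gt0 s : 2 <= s -> 0 < gam s.
Proof.
move=> s2; rewrite divr_gt0 // subr_gt0 -[X in _ < X]ger0_norm; last lra.
rewrite -sqrtr_sqr ltr_sqrt; nra.
Qed.

Lemma gam_le1 s : 2 <= s -> gam s <= 1.
Proof.
move=> s2; rewrite /gam; have h : 0 <= s ^+ 2 - 4 by nra.
have := sqr_sqrtr h; have := sqrtr_ge0 (s ^+ 2 - 4); set r := Num.sqrt _ => r0 hr.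
have : s - 2 <= r by nra.
lra.
Qed.

(** With a = gtr, b = hco and c = gam, the two quadratic relations give (c - a) (s - a - c) = a (a -
    b). As a and c are at most 1, the second factor is bounded below, which excludes the other
    root. *)
Lemma gtr_cvg s : 14 <= s -> gtr s (projT2 x) @[x --> whp R] --> gam s.
Proof.
move=> s14; apply/cvgrPdist_lt => e e0.
have H1 := whp_trgap s14 e0; have H2 := whp_good.
have H3 := whp_eventually (R := R) (nbhs_infty_gt 0).
refine (filterS3 _ _ H3 H2 H1) => -[n la] /= n0 g; rewrite /trgap g => hd.
case: n la n0 g hd => // m la _ g hd.
have E := gtr_hco s14 g; have gg := gtr_le s14 g; have gg0 := gtr_gt0 s14 g.
have s2 : 2 <= s by lra.
have r := gam_root s2; have r0 := gam_gt0 s2; have r1 := gam_le1 s2.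
move: E gg gg0 hd; move: (gtr s la) (hco s la) (gam s) r r0 r1 => a b c r r0 r1 E a4 a0.
set dl := a - b => hd.
have e1 : (c - a) * (s - a - c) = a * dl.
  have : a * s - a * b = 1 by rewrite -mulrBr.
  move: r; rewrite /dl !expr2 => r h; nra.
have h1 : `|c - a| * (s - a - c) <= `|dl|.
  rewrite -(gtr0_norm (_ : 0 < s - a - c)); last lra.
  rewrite -normrM e1 normrM gtr0_norm //.
  by rewrite ler_piMl //; lra.
have h2 := normr_ge0 (c - a); nra.
Qed.

End Gcvg.

(** * Averages over the boxes *)

Section Averages.
Variable R : realType.

Definition bsum n (la : intpart n) (F : R -> R) : R :=
  \sum_(i < n) \sum_(j < rowlen la i) F (j%:R - i%:R).

Definition bavg n (la : intpart n) (F : R -> R) : R :=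
  bsum la (fun c => F (c / Num.sqrt n%:R)) / n%:R.

Lemma bsum1 n (la : intpart n) x : bsum la (fun=> x) = n%:R * x.
Proof.
rewrite -[in RHS](rowlen_sum la (leqnn n)) natr_sum mulr_suml; apply: eq_bigr => i _.
by rewrite sumr_const card_ord mulr_natl.
Qed.

Lemma bsum_diff n (la : intpart n) (F G : R -> R) e :
    (forall c, c <= (rowlen la 0)%:R -> `|F c - G c| <= e) ->
  `|bsum la F - bsum la G| <= n%:R * e.
Proof.
move=> h; rewrite -(bsum1 la) -sumrB; apply: le_trans (ler_norm_sum _ _ _) _.
apply: ler_sum => i _; rewrite -sumrB; apply: le_trans (ler_norm_sum _ _ _) _.
apply: ler_sum => j _; apply: h.
apply: (@le_trans _ _ j%:R); first by rewrite gerBl.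
by rewrite ler_nat (leq_trans (ltnW (ltn_ord j))) // rowlen_homo.
Qed.

Lemma good_le n (la : intpart n) (c : R) : (0 < n)%N -> good R la ->
  c <= (rowlen la 0)%:R -> c / Num.sqrt n%:R <= 10.
Proof.
move=> n0 g h; rewrite ler_pdivrMr ?sqrtr_gt0 ?ltr0n //.
exact: le_trans h g.
Qed.

Lemma bavg_diff n (la : intpart n) (F G : R -> R) e : (0 < n)%N -> good R la ->
    (forall u, u <= 10 -> `|F u - G u| <= e) ->
  `|bavg la F - bavg la G| <= e.
Proof.
move=> n0 g h; rewrite /bavg -mulrBl normrM normfV normr_nat.
rewrite ler_pdivrMr ?ltr0n // mulrC; apply: bsum_diff => c hc.
by apply: h; apply: good_le hc.
Qed.

Lemma bavgZ n (la : intpart n) (F : R -> R) a :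
  bavg la (fun u => a * F u) = a * bavg la F.
Proof.
rewrite /bavg mulrA; congr (_ / _); rewrite mulr_sumr; apply: eq_bigr => i _.
by rewrite mulr_sumr.
Qed.

Lemma bavgB n (la : intpart n) (F G : R -> R) :
  bavg la (fun u => F u - G u) = bavg la F - bavg la G.
Proof.
rewrite /bavg -mulrBl; congr (_ / _); rewrite -sumrB; apply: eq_bigr => i _.
by rewrite -sumrB.
Qed.

Lemma ln_prod (I : Type) (r : seq I) (P : pred I) (F : I -> R) :
  (forall i, P i -> 0 < F i) ->
  0 < \prod_(i <- r | P i) F i /\ ln (\prod_(i <- r | P i) F i) = \sum_(i <- r | P i) ln (F i).
Proof.
move=> h; elim/big_rec2: _ => [|i x y Pi [y0 e]]; first by rewrite ltr01 ln1.
by rewrite mulr_gt0 ?h // lnM ?posrE ?h // e.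
Qed.

(** Within row k the factors telescope to the factor of [Pco] times (z + k) / (z + k + 1), and over
    the rows these quotients telescope against the prefactor of [Gtr_prod]. *)
Lemma Gtr_boxes n (la : intpart n) (z : R) : (rowlen la 0)%:R < z ->
  z * Gtr la z = \prod_(i < n) \prod_(j < rowlen la i) (1 - (z - (j%:R - i%:R)) ^- 2)^-1.
Proof.
move=> lt_z; have z_gt0 : 0 < z by apply: le_lt_trans lt_z.
have zN k : 0 < z + k%:R by rewrite ltr_pwDl.
rewrite Gtr_prod //.
have rowP k r : (r <= rowlen la 0)%N ->
    \prod_(j < r) (1 - (z - (j%:R - k%:R)) ^- 2)^-1 =
    (z + k%:R) / (z + k.+1%:R) * ((z - (r%:R - k%:R) + 1) / (z - (r%:R - k%:R))) :> R.
  elim: r => [|r IH] le_r.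
    rewrite big_ord0 sub0r opprK -[k.+1]addn1 natrD addrA mulrC mulf_div.
    rewrite [X in _ / X]mulrC divff // mulf_neq0 // gt_eqF //.
    by rewrite -addrA natr1.
  rewrite big_ord_recr /= IH ?(ltnW le_r) //.
  have h0 : 0 < z - (r.+1%:R - k%:R).
    rewrite subr_gt0; apply: le_lt_trans lt_z; apply: (@le_trans _ _ r.+1%:R).
      by rewrite gerBl.
    by rewrite ler_nat.
  rewrite -[r.+1]addn1 natrD in h0 *.
  set x := z - (r%:R - k%:R); have hx : z - (r%:R + 1%:R - k%:R) = x - 1 by rewrite /x; ring.
  rewrite hx in h0 *; move: (zN k.+1); move: (z + k.+1%:R) (z + k%:R) => a b a0.
  rewrite -!mulrA; congr (_ * (_ * _)); rewrite subrK mulrA.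
  have x1 : x - 1 != 0 by rewrite gt_eqF.
  have x0 : x != 0 by rewrite gt_eqF //; lra.
  have x2 : x + 1 != 0 by rewrite gt_eqF //; lra.
  have -> : 1 - x ^- 2 = (x - 1) * (x + 1) / x ^+ 2 by field.
  by field; rewrite x0 x1 x2.
have -> : z * ((z + n.+1%:R)^-1 * Pco la n.+1 z) =
    \prod_(i < n.+1) \prod_(j < rowlen la i) (1 - (z - (j%:R - i%:R)) ^- 2)^-1.
  under [RHS]eq_bigr => i _ do rewrite rowP ?rowlen_homo //.
  rewrite big_split /= mulrA; congr (_ * _).
  elim: n.+1 => [|k IH]; first by rewrite big_ord0 addr0 divff // gt_eqF.
  rewrite big_ord_recr /= -IH; have h1 := zN k; have h2 := zN k.+1.
  by rewrite -!mulrA mulKf // gt_eqF.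
by rewrite big_ord_recr /= rowlen_ge // big_ord0 mulr1.
Qed.

Lemma ln_bounds (x : R) : 0 <= x <= 2^-1 -> x <= - ln (1 - x) <= x + 2 * x ^+ 2.
Proof.
move=> /andP[x0 x1]; apply/andP; split.
  by rewrite lerNr; apply: le_ln1Dx; lra.
have p : 0 < 1 - x by lra.
have -> : - ln (1 - x) = ln (1 + x / (1 - x)).
  rewrite -lnV ?posrE //; congr ln; field; by rewrite gt_eqF.
apply: le_trans (le_ln1Dx _) _.
  by apply: (@lt_le_trans _ _ 0); [lra|rewrite divr_ge0 // ltW].
rewrite ler_pdivrMr // expr2; nra.
Qed.

(** In the logarithm of [Gtr_boxes], replacing - ln (1 - x) by x costs at most 2 x^2 per box, with x
    <= 1 / (16 n), and there are n boxes. *)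
Lemma ln_gtr_bavg s m (la : intpart m.+1) : 14 <= s -> good R la ->
  `|ln (s * gtr s la) - bavg la (fun u => (s - u) ^- 2)| <= m.+1%:R^-1.
Proof.
move=> s14 g; have lt_z := good_lt s14 g; have gap := good_gap s14 g.
set rn := Num.sqrt m.+1%:R in lt_z gap *; set z := rn * s in lt_z gap.
have rn2 : m.+1%:R = rn ^+ 2 by rewrite sqr_sqrtr.
have rn0 : 0 < rn by rewrite sqrtr_gt0 ltr0n.
have n1 : 1 <= m.+1%:R :> R by rewrite ler1n.
have -> : s * gtr s la = z * Gtr la z by rewrite /gtr -/rn /z; ring.
have xle c : c <= (rowlen la 0)%:R -> 0 <= (z - c) ^- 2 <= (16 * m.+1%:R)^-1.
  move=> hc; rewrite invr_ge0 sqr_ge0 /= lef_pV2 ?posrE.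
  - have : 4 * rn <= z - c by lra.
    rewrite rn2; nra.
  - have : 4 * rn <= z - c by lra.
    nra.
  - by rewrite mulr_gt0 ?ltr0n.
have jle (i : 'I_m.+1) (j : 'I_(rowlen la i)) : j%:R - i%:R <= (rowlen la 0)%:R :> R.
  apply: (@le_trans _ _ j%:R); first by rewrite gerBl.
  by rewrite ler_nat (leq_trans (ltnW (ltn_ord j))) // rowlen_homo.
have k16 : (16 * m.+1%:R)^-1 <= 16^-1 :> R by rewrite lef_pV2 ?posrE; lra.
have pos c : c <= (rowlen la 0)%:R -> 0 < (1 - (z - c) ^- 2)^-1.
  move=> /xle/andP[_ h]; rewrite invr_gt0 subr_gt0.
  by apply: le_lt_trans (le_trans h k16) _; lra.
have -> : ln (z * Gtr la z) = bsum la (fun c => - ln (1 - (z - c) ^- 2)).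
  rewrite Gtr_boxes // (proj2 (ln_prod _ _)).
    apply: eq_bigr => i _; rewrite (proj2 (ln_prod _ _)).
      apply: eq_bigr => j _; rewrite lnV // posrE -invr_gt0; exact/pos/jle.
    by move=> j _; apply/pos/jle.
  move=> i _; apply: prodr_gt0 => j _; exact/pos/jle.
have -> : bavg la (fun u => (s - u) ^- 2) = bsum la (fun c => (z - c) ^- 2).
  rewrite /bavg -/rn /bsum mulr_suml; apply: eq_bigr => i _.
  rewrite mulr_suml; apply: eq_bigr => j _.
  rewrite rn2 -invfM -exprMn; congr (_ ^- 2); rewrite /z mulrBl divfK ?gt_eqF //.
  by rewrite [s * _]mulrC.
apply: (@le_trans _ _ (m.+1%:R * (2 * (16 * m.+1%:R)^-1 ^+ 2))).
  apply: bsum_diff => c /xle /andP[x0 x1].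
  have /ln_bounds/andP[b1 b2] : 0 <= (z - c) ^- 2 <= 2^-1 by rewrite x0 (le_trans (le_trans x1 k16)) //; lra.
  rewrite ger0_norm ?subr_ge0 // lerBlDl; apply: le_trans b2 _.
  rewrite lerD2l ler_wpM2l // ler_sqr ?nnegrE //; exact: le_trans x1.
have n0 : m.+1%:R != 0 :> R by rewrite pnatr_eq0.
have -> : m.+1%:R * (2 * (16 * m.+1%:R)^-1 ^+ 2) = 128^-1 * m.+1%:R^-1 :> R by field.
by rewrite ler_piMl ?invr_ge0 //; lra.
Qed.

End Averages.

Section Averages2.
Variable R : realType.

Definition Lam (s : R) : R := ln (s * gam s).

Lemma is_derive_Lam (s : R) : 2 < s ->
  is_derive s 1 Lam (s^-1 - (Num.sqrt (s ^+ 2 - 4))^-1).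
Proof.
move=> s2.
have q0 : 0 < s ^+ 2 - 4 by nra.
have g0 : 0 < s * gam s by rewrite mulr_gt0 ?gam_gt0 //; lra.
have d1 : is_derive s 1 (fun s : R => s ^+ 2 - 4) (2 * s).
  by apply: is_derive_eq; rewrite subr0 /GRing.scale /=; ring.
have d2 : is_derive s 1 (fun s : R => Num.sqrt (s ^+ 2 - 4)) ((2 * Num.sqrt (s ^+ 2 - 4))^-1 * (2 * s)).
  exact: (is_derive1_comp (f := Num.sqrt) (g := fun s : R => s ^+ 2 - 4) (is_derive1_sqrt q0) d1).
have d3 : is_derive s 1 (fun s : R => s * gam s)
    (gam s + s * ((1 - (2 * Num.sqrt (s ^+ 2 - 4))^-1 * (2 * s)) / 2)).
  have -> : (fun s : R => s * gam s) = (fun s => s * ((s - Num.sqrt (s ^+ 2 - 4)) * 2^-1)) by [].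
  apply: is_derive_eq; rewrite /GRing.scale /= /gam; ring.
have d4 := is_derive1_comp (f := @ln R) (g := fun s : R => s * gam s) (is_derive1_ln g0) d3.
apply: (is_derive_eq d4).
have := sqr_sqrtr (ltW q0); set r := Num.sqrt _ => r2.
have r0 : 0 < r by rewrite sqrtr_gt0.
have s0 : s != 0 by rewrite gt_eqF //; lra.
move: g0; rewrite /gam -/r => g0.
have h : s - r != 0 by apply/eqP => e; move: g0; rewrite e mul0r mulr0 ltxx.
by field; rewrite s0 h gt_eqF.
Qed.

(** Mean value theorem; for s >= 14 the derivative of [Lam] varies by O(h) on [s, s + h]. *)
Lemma Lam_quotient (s h : R) : 14 <= s -> 0 < h ->
  `|(Lam s - Lam (s + h)) / h - ((Num.sqrt (s ^+ 2 - 4))^-1 - s^-1)| <= 2 * h.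
Proof.
move=> s14 h0.
have d x : x \in `]s, s + h[%R -> is_derive x 1 Lam (x^-1 - (Num.sqrt (x ^+ 2 - 4))^-1).
  by rewrite in_itv /= => /andP[sx _]; apply: is_derive_Lam; lra.
have [||c] := MVT _ d; first by rewrite ltrDl.
  apply: derivable_within_continuous => x; rewrite in_itv /= => /andP[sx _].
  by apply: ex_derive; apply: is_derive_Lam; lra.
rewrite in_itv /= => /andP[sc ch] e.
have -> : (Lam s - Lam (s + h)) / h = (Num.sqrt (c ^+ 2 - 4))^-1 - c^-1.
  by rewrite -opprB e addrAC subrr add0r -mulNr mulfK ?gt_eqF // opprB.
have X2 : 0 <= s ^+ 2 - 4 by nra. have Y2 : 0 <= c ^+ 2 - 4 by nra.
have := sqr_sqrtr X2; have := sqr_sqrtr Y2.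
have := sqrtr_ge0 (s ^+ 2 - 4); have := sqrtr_ge0 (c ^+ 2 - 4).
move: (Num.sqrt (s ^+ 2 - 4)) (Num.sqrt (c ^+ 2 - 4)) => X Y Y0 X0 YY XX.
have X13 : 13 <= X by nra.
have XY : X <= Y by nra.
have sX : s <= 2 * X by nra.
have cY : c <= 2 * Y by nra.
have YX : Y - X <= 2 * h.
  rewrite -(@ler_pM2r _ (X + Y)); last by lra.
  have -> : (Y - X) * (X + Y) = (c - s) * (c + s) by move: XX YY; rewrite !expr2; lra.
  apply: (@le_trans _ _ (h * (2 * (X + Y)))); last by lra.
  by apply: ler_pM; lra.
have e1 : X^-1 - Y^-1 = (Y - X) / (X * Y) by field; apply/andP; split; rewrite gt_eqF //; lra.
have e2 : s^-1 - c^-1 = (c - s) / (s * c) by field; apply/andP; split; rewrite gt_eqF //; lra.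
have b1 : 0 <= X^-1 - Y^-1 <= h.
  have p : 0 < X * Y by nra.
  rewrite e1 divr_ge0 ?subr_ge0 ?(ltW p) //= ler_pdivrMr //.
  by apply: le_trans YX _; rewrite mulrC ler_pM2l //; nra.
have b2 : 0 <= s^-1 - c^-1 <= h.
  have p : 0 < s * c by nra.
  rewrite e2 divr_ge0 ?subr_ge0 ?(ltW p) ?(ltW sc) //= ler_pdivrMr //.
  have sc1 : 1 <= s * c by nra.
  by apply: (@le_trans _ _ (h * 1)); [lra|rewrite ler_pM2l].
move: b1 b2; move: X^-1 Y^-1 s^-1 c^-1 => x y a b b1 b2.
by rewrite ler_norml; lra.
Qed.

Lemma near_good_pos : \forall x \near whp R, (0 < projT1 x)%N /\ good R (projT2 x).
Proof.
have H1 := @whp_good R; have H2 := whp_eventually (R := R) (nbhs_infty_gt 0).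
exact: (filterS2 _ _ H2 H1).
Qed.

Lemma bavg2_cvg (s : R) : 14 <= s ->
  bavg (projT2 x) (fun u => (s - u) ^- 2) @[x --> whp R] --> Lam s.
Proof.
move=> s14; have s2 : 2 <= s by lra.
have g0 : 0 < s * gam s by rewrite mulr_gt0 ?gam_gt0 //; lra.
have H : ln (s * gtr s (projT2 x)) @[x --> whp R] --> Lam s.
  apply: (@cvg_comp _ _ _ (fun x => s * gtr s (projT2 x)) (@ln R) _ (nbhs (s * gam s))).
    exact: cvgMr (gtr_cvg s14).
  exact: continuous_ln.
apply/cvgrPdist_lt => e e0.
move/cvgrPdist_lt : H => /(_ (e / 2)); rewrite divr_gt0 // => /(_ isT) H1.
have H2 := near_good_pos.
have H3 : \forall x \near whp R, (projT1 x)%:R^-1 < e / 2.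
  apply: (whp_eventually (P := fun n => n%:R^-1 < e / 2)).
  near=> n; have n0 : (2 / e) < n%:R by near: n; exact: nbhs_infty_gtr.
  have e2 : 0 < 2 / e by rewrite divr_gt0.
  rewrite -[e / 2]invf_div ltf_pV2 ?posrE //; exact: lt_trans e2 n0.
refine (filterS3 _ _ H1 H2 H3) => -[n la] /= h1 [n0 g] h3.
case: n la n0 g h1 h3 => // m la _ g h1 h3.
have h2 := ln_gtr_bavg s14 g.
rewrite -(subrK (ln (s * gtr s la)) (Lam s)) -addrA.
apply: le_lt_trans (ler_normD _ _) _; rewrite [e]splitr.
by apply: ltrD h1 _; apply: le_lt_trans h2 h3.
Unshelve. all: by end_near. Qed.

(* Difference quotients in s of bavg2_cvg.                                    *)
Lemma bavg3_cvg (s : R) : 14 <= s ->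
  bavg (projT2 x) (fun u => 2 * (s - u) ^- 3) @[x --> whp R] -->
    (Num.sqrt (s ^+ 2 - 4))^-1 - s^-1.
Proof.
move=> s14; apply/cvgrPdist_lt => e e0; set l := _ - s^-1.
(* The errors are e / 2 = 4 h from the limit of the quotient, h from the integrand and 2 h from
   [Lam_quotient]. *)
pose h := e / 8; have h0 : 0 < h by rewrite divr_gt0.
have sh14 : 14 <= s + h by lra.
have H : bavg (projT2 x) (fun u => h^-1 * ((s - u) ^- 2 - (s + h - u) ^- 2)) @[x --> whp R] -->
    (Lam s - Lam (s + h)) / h.
  have -> : (fun x : {n & intpart n} =>
        bavg (projT2 x) (fun u => h^-1 * ((s - u) ^- 2 - (s + h - u) ^- 2))) =
      (fun x => h^-1 * (bavg (projT2 x) (fun u => (s - u) ^- 2) -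
                        bavg (projT2 x) (fun u => (s + h - u) ^- 2))).
    by apply/funext => x; rewrite bavgZ bavgB.
  rewrite mulrC.
  by apply: cvgMr; apply: cvgB; apply: bavg2_cvg.
move/cvgrPdist_lt : H => /(_ (e / 2)); rewrite divr_gt0 // => /(_ isT) H1.
have H2 := near_good_pos; have q := Lam_quotient s14 h0.
refine (filterS2 _ _ H1 H2) => -[n la] /= h1 [n0 g].
have h2 : `|bavg la (fun u => h^-1 * ((s - u) ^- 2 - (s + h - u) ^- 2)) -
           bavg la (fun u => 2 * (s - u) ^- 3)| <= h.
  apply: bavg_diff => // u u10; set r := s - u.
  have -> : s + h - u = r + h by rewrite /r; ring.
  have r4 : 4 <= r by rewrite /r; lra.
  have p : 0 < r ^+ 3 * (r + h) ^+ 2 by rewrite mulr_gt0 // exprn_gt0 //; lra.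
  have -> : h^-1 * (r ^- 2 - (r + h) ^- 2) - 2 * r ^- 3 =
            - ((3 * r * h + 2 * h ^+ 2) / (r ^+ 3 * (r + h) ^+ 2)).
    by field; rewrite !gt_eqF //; lra.
  rewrite normrN ger0_norm; last by rewrite divr_ge0 ?(ltW p) //; nra.
  rewrite ler_pdivrMr //.
  have a1 : 1 <= r ^+ 3 by rewrite exprn_ege1 //; lra.
  apply: (@le_trans _ _ (h * (1 * (r + h) ^+ 2))).
    have -> : 3 * r * h + 2 * h ^+ 2 = h * (3 * r + 2 * h) by ring.
    rewrite ler_pM2l // mul1r expr2.
    have : 0 <= (r - 4) * (r - 4) + r * h by rewrite addr_ge0 ?mulr_ge0 //; lra.
    have : 0 <= (r - 4) * h by rewrite mulr_ge0 //; lra.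
    have : 0 <= h * h by rewrite mulr_ge0 //; lra.
    lra.
  by rewrite ler_pM2l // ler_wpM2r // sqr_ge0.
move: h1 h2 q; rewrite -/l; move: (bavg _ _) (bavg _ _) (_ / h) => x y z.
have eh : e = 8 * h by rewrite /h; field.
rewrite eh !ltr_norml !ler_norml; lra.
Qed.

End Averages2.

(** * Profiles *)

Section Profile.
Variable R : realType.

Lemma rotated_diagramP n (la : intpart n) (s t : R) :
  rotated_diagram la (s, t) <->
  exists i j : nat, (j < rowlen la i)%N /\ exists x y : R,
    [/\ j%:R <= x <= j%:R + 1, i%:R <= y <= i%:R + 1, s = x - y & t = x + y].
Proof.
split.
- move=> [b db [x [y [hx hy [-> ->]]]]]; exists b.1, b.2; split.
    by rewrite -in_diagramE.
  by exists x, y.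
- move=> [i [j [dij [x [y [hx hy -> ->]]]]]].
  have lt_i : (i < n)%N.
    by rewrite ltnNge; apply/negP => /rowlen_ge h; rewrite h in dij.
  have lt_j : (j < n)%N := leq_trans dij (rowlen_le _ _).
  exists (Ordinal lt_i, Ordinal lt_j); first by rewrite in_diagramE.
  by exists x, y.
Qed.

Let prof_set n (la : intpart n) (s : R) := `|s| |` [set t : R | rotated_diagram la (s, t)].

Lemma profile_has_sup n (la : intpart n) (s : R) : has_sup (prof_set la s).
Proof.
split; first by exists `|s|; left.
exists (`|s| + (n%:R + n%:R)) => t [->|]; first by rewrite lerDl addr_ge0.
move=> /rotated_diagramP[i [j [dij [x [y [hx hy _ ->]]]]]].
have hj : j%:R + 1 <= n%:R :> R by rewrite natr1 ler_nat (leq_trans dij (rowlen_le _ _)).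
have hi : i%:R + 1 <= n%:R :> R.
  rewrite natr1 ler_nat ltnNge; apply/negP => /rowlen_ge h; by rewrite h in dij.
by have := normr_ge0 s; lra.
Qed.

Lemma profile_ge_norm n (la : intpart n) (s : R) : `|s| <= profile la s.
Proof. by apply: (ub_le_sup (proj2 (profile_has_sup la s))); left. Qed.

Lemma profile_ge_rot n (la : intpart n) (s t : R) :
  rotated_diagram la (s, t) -> t <= profile la s.
Proof. by move=> h; apply: (ub_le_sup (proj2 (profile_has_sup la s))); right. Qed.

Lemma profile_le n (la : intpart n) (s B : R) : `|s| <= B ->
  (forall t, rotated_diagram la (s, t) -> t <= B) -> profile la s <= B.
Proof.
move=> h1 h2; apply: sup_le_ub; first by exists `|s|; left.
by move=> t [->//|]; apply: h2.
Qed.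

Lemma floor_interval (i : nat) (y : R) : 0 <= y <= i%:R + 1 ->
  exists2 k : nat, (k <= i)%N & k%:R <= y <= k%:R + 1.
Proof.
elim: i => [|i IH] /andP[y0 yi]; first by exists 0%N => //; rewrite y0 yi.
have [le_y|lt_y] := leP y (i%:R + 1).
  by have [|k ki hk] := IH; [rewrite y0|exists k => //; apply: leqW].
by exists i.+1 => //; rewrite yi andbT -natr1 ltW.
Qed.

(** A point (x, y) of the diagram over s is brought over s' by lowering y or x by |s - s'|. It stays
    in the diagram unless it leaves the quadrant, and in that case the graph of |s'| is high
    enough. *)
Lemma profile_lip_le n (la : intpart n) (s s' : R) :
  profile la s <= profile la s' + `|s - s'|.
Proof.
have h0 := profile_ge_norm la s'.
apply: profile_le.
  by have := ler_normD s' (s - s'); rewrite addrC subrK; lra.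
move=> t /rotated_diagramP[i [j [dij [x [y [hx hy es et]]]]]].
have j0 : 0 <= j%:R :> R by []. have i0 : 0 <= i%:R :> R by [].
have ns' : s' <= `|s'| /\ - s' <= `|s'| by split; [exact: ler_norm|rewrite -normrN ler_norm].
have [le_s|lt_s] := leP s s'.
  rewrite ler0_norm ?subr_le0 //.
  have [y'0|y'0] := leP 0 (y - (s' - s)); last by lra.
  have [|k ki hk] := @floor_interval i (y - (s' - s)); first by lra.
  suff : t - (s' - s) <= profile la s' by lra.
  apply: profile_ge_rot; apply/rotated_diagramP; exists k, j; split.
    by rewrite (leq_trans dij) // rowlen_homo.
  by exists x, (y - (s' - s)); split=> //; lra.
rewrite gtr0_norm ?subr_gt0 //.
have [x'0|x'0] := leP 0 (x - (s - s')); last by lra.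
have [|k kj hk] := @floor_interval j (x - (s - s')); first by lra.
suff : t - (s - s') <= profile la s' by lra.
apply: profile_ge_rot; apply/rotated_diagramP; exists i, k; split.
  exact: leq_ltn_trans kj dij.
by exists (x - (s - s')), y; split=> //; lra.
Qed.

Lemma profile_lip n (la : intpart n) (s s' : R) :
  `|profile la s - profile la s'| <= `|s - s'|.
Proof.
have := profile_lip_le la s s'; have := profile_lip_le la s' s.
rewrite distrC ler_norml; lra.
Qed.

Lemma profile_out n (la : intpart n) (s K : R) :
  (rowlen la 0)%:R <= K -> (nrows la)%:R <= K -> K <= `|s| -> profile la s = `|s|.
Proof.
move=> hr hn hs; apply/eqP; rewrite eq_le profile_ge_norm andbT.
apply: profile_le => // t /rotated_diagramP[i [j [dij [x [y [hx hy es et]]]]]].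
have hj : j%:R + 1 <= (rowlen la 0)%:R :> R.
  by rewrite natr1 ler_nat (leq_trans dij) // rowlen_homo.
have hi : i%:R + 1 <= (nrows la)%:R :> R.
  by rewrite natr1 ler_nat ltn_nrows (leq_ltn_trans _ dij).
have j0 : 0 <= j%:R :> R by []. have i0 : 0 <= i%:R :> R by [].
by move: hs; case: (ger0P s) => _ hs; lra.
Qed.

(* With p = 0 or q = 0, the number of boxes of content p - q.                 *)
Definition diag n (la : intpart n) (p q : nat) : nat :=
  (\sum_(k < n) (k + p < rowlen la (k + q)))%N.

Lemma count_initial (D : nat -> bool) n k : (forall i, D i.+1 -> D i) -> ~~ D n ->
  (k < \sum_(i < n) D i)%N = D k.
Proof.
move=> dec Dn.
have homo i j : (i <= j)%N -> D j -> D i.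
  by move=> /subnK <-; elim: (j - i)%N => // l IH /dec.
elim: n Dn k => [|n IH] Dn k.
  rewrite big_ord0 ltn0; apply/esym/negbTE; apply: contra Dn; exact: homo.
rewrite big_ord_recr /=; have [Dn'|nDn'] := boolP (D n); last by rewrite addn0 IH.
have -> : (\sum_(i < n) D i = n)%N.
  rewrite -[RHS]card_ord -sum1_card; apply: eq_bigr => i _.
  by rewrite (homo i n) // ltnW.
rewrite addn1 ltnS; case: (leqP k n) => [/homo/(_ Dn')->//|lt_nk].
by apply/esym/negbTE; apply: contra Dn; apply: homo.
Qed.

Lemma ltn_diag n (la : intpart n) p q k :
  (k < diag la p q)%N = (k + p < rowlen la (k + q))%N.
Proof.
apply: (count_initial (D := fun k => (k + p < rowlen la (k + q))%N)).
  move=> i; rewrite !addSn => h; apply: ltnW; apply: leq_trans h _.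
  exact: rowlen_homo.
by rewrite rowlen_ge // leq_addr.
Qed.

(** Over an integer abscissa, the boxes of that content are stacked on the graph of |s|, each of
    height 2. *)
Lemma profile_diag n (la : intpart n) p q : (p == 0%N) || (q == 0%N) ->
  profile la (p%:R - q%:R : R) = p%:R + q%:R + 2 * (diag la p q)%:R.
Proof.
move=> pq; set d := diag la p q.
have nE : `|p%:R - q%:R : R| = p%:R + q%:R.
  case/orP: pq => /eqP->; last by rewrite subr0 addr0 normr_nat.
  by rewrite sub0r normrN normr_nat add0r.
apply/eqP; rewrite eq_le; apply/andP; split.
  apply: profile_le; first by rewrite nE lerDl mulr_ge0.
  move=> t /rotated_diagramP[i [j [dij [x [y [hx hy es et]]]]]].
  rewrite leNgt; apply/negP => lt_t.
  have hy' : (d + q)%:R < (i.+1)%:R :> R by rewrite natrD -[i.+1]addn1 natrD; lra.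
  have hx' : (d + p)%:R < (j.+1)%:R :> R by rewrite natrD -[j.+1]addn1 natrD; lra.
  rewrite !ltr_nat !ltnS in hx' hy'.
  have : (d < d)%N by rewrite ltn_diag (leq_ltn_trans hx') // (leq_trans dij) // rowlen_homo.
  by rewrite ltnn.
case E : d => [|d']; first by rewrite mulr0 addr0 -nE profile_ge_norm.
apply: profile_ge_rot; apply/rotated_diagramP.
exists (d' + q)%N, (d' + p)%N; split; first by rewrite -ltn_diag -/d E.
exists ((d' + p)%:R + 1), ((d' + q)%:R + 1); rewrite !natrD -[d'.+1]addn1 natrD.
split; lra.
Qed.

(** The boxes are regrouped by content k - M; of the truncated differences k - M and M - k at least
    one is 0, as [profile_diag] needs. *)
Lemma bsum_diag n (la : intpart n) M (F : R -> R) :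
  (rowlen la 0 <= M)%N -> (nrows la <= M)%N ->
  bsum la F = \sum_(k < M + M) (diag la (k - M) (M - k))%:R * F (k%:R - M%:R).
Proof.
move=> hr hn.
have -> : bsum la F = \sum_(i < n) \sum_(j < rowlen la i) \sum_(k < M + M)
    if (k + i == j + M)%N then F (k%:R - M%:R) else 0.
  apply: eq_bigr => i _; apply: eq_bigr => j _.
  have lt_i : (i < M)%N by apply: leq_trans hn; rewrite ltn_nrows (leq_ltn_trans _ (ltn_ord j)).
  have lt_j : (j < M)%N by apply: leq_trans hr; apply: leq_trans (ltn_ord j) _; apply: rowlen_homo.
  have lt_k : (j + M - i < M + M)%N by lia.
  rewrite -big_mkcond (big_pred1 (Ordinal lt_k)) /=; last first.
    by move=> k; rewrite /= -val_eqE /=; lia.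
  by rewrite natrB ?natrD; [congr F; ring|lia].
under eq_bigr => i _ do rewrite exchange_big /=.
rewrite exchange_big /=; apply: eq_bigr => k _.
have -> : (diag la (k - M) (M - k))%:R * F (k%:R - M%:R) =
    \sum_(i < n) \sum_(j < n) if (j < rowlen la i)%N && (k + i == j + M)%N
      then F (k%:R - M%:R) else 0.
  rewrite /diag natr_sum mulr_suml; case: (leqP M k) => [le_k|lt_k].
    have -> : (M - k)%N = 0%N by apply/eqP.
    apply: eq_bigr => i _; rewrite addn0.
    case: (boolP (i + (k - M) < rowlen la i)%N) => h; last first.
      rewrite mul0r big1 // => j _; case: ifP => // /andP[h1 /eqP h2].
      by case/negP: h; have -> : (i + (k - M) = j)%N by lia.
    have lt_j : (i + (k - M) < n)%N := leq_trans h (rowlen_le _ _).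
    rewrite mul1r -big_mkcond (big_pred1 (Ordinal lt_j)) // => j.
    rewrite /= -val_eqE /=; apply/andP/eqP => [[_ /eqP]|->]; first lia.
    by split; [rewrite h|apply/eqP; lia].
  have -> : (k - M)%N = 0%N by apply/eqP; apply: ltnW.
  rewrite exchange_big /=; apply: eq_bigr => j _; rewrite addn0.
  case: (boolP (j < rowlen la (j + (M - k)))%N) => h; last first.
    rewrite mul0r big1 // => i _; case: ifP => // /andP[h1 /eqP h2].
    by case/negP: h; have -> : (j + (M - k) = i)%N by lia.
  have lt_i : (j + (M - k) < n)%N.
    by rewrite ltnNge; apply/negP => /rowlen_ge e; rewrite e in h.
  rewrite mul1r -big_mkcond (big_pred1 (Ordinal lt_i)) // => i.
  rewrite /= -val_eqE /=; apply/andP/eqP => [[_ /eqP]|->]; first lia.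
  by split; [rewrite h|apply/eqP; lia].
apply: eq_bigr => i _.
rewrite (big_ord_widen n (fun j => if (k + i == j + M)%N then F (k%:R - M%:R) else 0)) ?rowlen_le //.
by rewrite big_mkcond; apply: eq_bigr => j _; case: ltnP.
Qed.

End Profile.

(** * Primitives of the limit curve *)

Section OmegaCont.
Variable R : realType.

Lemma segment_continuous_comp (A B : set R) (f g : R -> R) :
  (forall x, A x -> B (f x)) -> {within A, continuous f} -> {within B, continuous g} ->
  {within A, continuous (g \o f)}.
Proof.
move=> AB /subspace_continuousP cf /subspace_continuousP cg.
apply/subspace_continuousP => x Ax P Pgx.
have := cg _ (AB _ Ax) _ Pgx; rewrite /= !nbhs_simpl /within /= => H.
have := cf _ Ax _ H; rewrite /= !nbhs_simpl /within /=.
apply: filterS => z /= h Az; exact: h (AB _ Az).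
Qed.

Lemma asin1 : asin (1 : R) = pi / 2.
Proof.
have := @sinK R (pi / 2); rewrite sin_pihalf; apply.
by rewrite in_itv /= lexx andbT; have := pi_ge0 R; lra.
Qed.

Lemma asinN1 : asin (-1 : R) = - (pi / 2).
Proof.
have := @sinK R (- (pi / 2)); rewrite sinN sin_pihalf; apply.
by rewrite in_itv /= lexx /=; have := pi_ge0 R; lra.
Qed.

Lemma asin_continuous : {within `[-1, 1], continuous (@asin R)}.
Proof.
have := @segment_can_le_continuous R (- (pi / 2)) (pi / 2) sin asin.
rewrite sinN sin_pihalf; apply.
- by have := pi_ge0 R; lra.
- exact/continuous_subspaceT/continuous_sin.
- exact: sinK.
Qed.

Lemma two_pi_half : 2 / pi * (pi / 2) = 1 :> R.
Proof. by rewrite mulf_div [X in X / _]mulrC divff // mulf_neq0 // gt_eqF // pi_gt0. Qed.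

Definition Omt (u : R) : R := 2 / pi * (u * asin (u / 2) + Num.sqrt (4 - u ^+ 2)).
Definition dOm (u : R) : R := 2 / pi * asin (u / 2).

Lemma half_itv (u : R) : -2 <= u <= 2 -> -1 <= u / 2 <= 1.
Proof. lra. Qed.

Lemma dOm_continuous : {within `[-2, 2], continuous dOm}.
Proof.
have h : {within `[-2, 2], continuous (fun u : R => asin (u / 2))}.
  apply: (@segment_continuous_comp _ `[-1, 1] (fun u => u / 2)).
  - by move=> x /=; rewrite !in_itv /= => /half_itv.
  - apply: continuous_subspaceT => x; apply: cvgMl; exact: cvg_id.
  - exact: asin_continuous.
by move=> x; apply: cvgMr; apply: h.
Qed.

Lemma Omt_continuous : {within `[-2, 2], continuous Omt}.
Proof.
have -> : Omt = fun u => u * dOm u + 2 / pi * Num.sqrt (4 - u ^+ 2).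
  by apply/funext => u; rewrite /Omt /dOm; ring.
move=> x; apply: cvgD.
  apply: cvgM; last exact: dOm_continuous.
  by apply: continuous_subspaceT => y; exact: cvg_id.
apply: cvgMr; apply: continuous_subspaceT => {}x.
apply: (@continuous_comp _ _ _ (fun u : R => 4 - u ^+ 2) (@Num.sqrt R)).
  apply: cvgB; [exact: cvg_cst|exact: exprn_continuous].
exact: sqrt_continuous.
Qed.

Lemma is_derive_dOm (u : R) : -2 < u < 2 ->
  is_derive u 1 dOm (2 / (pi * Num.sqrt (4 - u ^+ 2))).
Proof.
move=> hu; have hu2 : -1 < u / 2 < 1 by lra.
have d1 : is_derive u 1 (fun u : R => u / 2) (2^-1).
  by apply: is_derive_eq; rewrite /GRing.scale /=; ring.
have d2 := is_derive1_comp (f := @asin R) (g := fun u : R => u / 2) (is_derive1_asin hu2) d1.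
have d3 : is_derive u 1 dOm (2 / pi * ((Num.sqrt (1 - (u / 2) ^+ 2))^-1 * 2^-1)).
  by apply: is_derive_eq.
apply: (is_derive_eq d3).
have q : 0 < 4 - u ^+ 2 by nra.
have -> : 1 - (u / 2) ^+ 2 = (4 - u ^+ 2) / 4 by field.
rewrite sqrtrM ?(ltW q) // sqrtrV //.
have -> : Num.sqrt 4 = 2 :> R.
  by have -> : 4 = 2 ^+ 2 :> R; [ring|rewrite sqrtr_sqr ger0_norm].
have := pi_gt0 R; have : 0 < Num.sqrt (4 - u ^+ 2) by rewrite sqrtr_gt0.
move: (@pi R) (Num.sqrt _) => p r r0 p0.
by field; rewrite !gt_eqF.
Qed.

(** The derivative of the square root cancels that of the arcsine. *)
Lemma is_derive_Omt (u : R) : -2 < u < 2 -> is_derive u 1 Omt (dOm u).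
Proof.
move=> hu; have q : 0 < 4 - u ^+ 2 by nra.
have -> : Omt = fun u => u * dOm u + 2 / pi * Num.sqrt (4 - u ^+ 2).
  by apply/funext => v; rewrite /Omt /dOm; ring.
have d0 := is_derive_dOm hu.
have d1 : is_derive u 1 (fun u : R => 4 - u ^+ 2) (- (2 * u)).
  by apply: is_derive_eq; rewrite /GRing.scale /=; ring.
have d2 := is_derive1_comp (f := Num.sqrt) (g := fun u : R => 4 - u ^+ 2) (is_derive1_sqrt q) d1.
have d3 : is_derive u 1 (fun u => u * dOm u + 2 / pi * Num.sqrt (4 - u ^+ 2))
   (u * (2 / (pi * Num.sqrt (4 - u ^+ 2))) + dOm u + 2 / pi * ((2 * Num.sqrt (4 - u ^+ 2))^-1 * - (2 * u))).
  by apply: is_derive_eq; rewrite /GRing.scale /= mulr1 ; ring.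
apply: (is_derive_eq d3).
have := pi_gt0 R; have : 0 < Num.sqrt (4 - u ^+ 2) by rewrite sqrtr_gt0.
move: (@pi R) (Num.sqrt _) => p r r0 p0.
by field; rewrite !gt_eqF.
Qed.

Lemma dOm_bound (u : R) : -2 <= u <= 2 -> -1 <= dOm u <= 1.
Proof.
move=> /half_itv hu; have a := asin_geNpi2 hu; have b := asin_lepi2 hu.
have p0 := pi_gt0 R; rewrite /dOm.
have k : 0 < 2 / pi :> R by rewrite divr_gt0.
have e := two_pi_half.
apply/andP; split; last by rewrite -[X in _ <= X]e ler_pM2l.
by rewrite -[X in - X <= _]e -mulrN ler_pM2l.
Qed.

Lemma dOm_2 : dOm 2 = 1.
Proof. by rewrite /dOm divff // asin1 two_pi_half. Qed.

Lemma dOm_N2 : dOm (-2) = -1.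
Proof. by rewrite /dOm mulNr divff // asinN1 mulrN two_pi_half. Qed.

Lemma OmtE (u : R) : Omt u = u * dOm u + 2 / pi * Num.sqrt (4 - u ^+ 2).
Proof. by rewrite /Omt /dOm mulrDr mulrCA. Qed.

Lemma Omt_2 : Omt 2 = 2.
Proof.
rewrite OmtE dOm_2; have -> : 4 - 2 ^+ 2 = 0 :> R by ring.
by rewrite sqrtr0 mulr0 addr0 mulr1.
Qed.

Lemma Omt_N2 : Omt (-2) = 2.
Proof.
rewrite OmtE dOm_N2; have -> : 4 - (-2) ^+ 2 = 0 :> R by ring.
by rewrite sqrtr0 mulr0 addr0 mulrN1 opprK.
Qed.

Lemma LSKV_in (u : R) : -2 <= u <= 2 -> LSKV u = Omt u.
Proof.
move=> hu; rewrite /LSKV; case: ifP => // /negbT; rewrite -leNgt => h.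
have [->|->] : u = 2 \/ u = -2.
  by case: (ger0P u) h => _ h; [left|right]; lra.
  by rewrite Omt_2 normr_nat.
by rewrite Omt_N2 normrN normr_nat.
Qed.

Lemma LSKV_out (u : R) : 2 <= `|u| -> LSKV u = `|u|.
Proof. by move=> h; rewrite /LSKV ltNge h. Qed.

Lemma lipschitz_glue (f : R -> R) (p L : R) : 0 <= L ->
  (forall x y, x <= y -> y <= p -> `|f y - f x| <= L * (y - x)) ->
  (forall x y, p <= x -> x <= y -> `|f y - f x| <= L * (y - x)) ->
  forall x y, x <= y -> `|f y - f x| <= L * (y - x).
Proof.
move=> L0 h1 h2 x y xy.
have [yp|py] := leP y p; first exact: h1.
have [px|xp] := leP p x; first exact: h2.
have e1 := h1 x p (ltW xp) (lexx p); have e2 := h2 p y (lexx p) (ltW py).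
have -> : f y - f x = (f y - f p) + (f p - f x) by ring.
apply: le_trans (ler_normD _ _) _; lra.
Qed.

Lemma Omt_lip (x y : R) : -2 <= x -> x <= y -> y <= 2 -> `|Omt y - Omt x| <= 1 * (y - x).
Proof.
move=> hx xy hy.
have [||c] := @MVT_segment R Omt dOm x y xy.
- by move=> c; rewrite in_itv /= => /andP[h1 h2]; apply: is_derive_Omt; lra.
- apply: continuous_subspaceW Omt_continuous => z /=; rewrite !in_itv /=; lra.
rewrite in_itv /= => hc ->; rewrite normrM [X in _ * X]ger0_norm ?subr_ge0 //.
rewrite ler_wpM2r ?subr_ge0 // ler_norml; apply: dOm_bound; lra.
Qed.

Lemma LSKV_lip_le (x y : R) : x <= y -> `|LSKV y - LSKV x| <= 1 * (y - x).
Proof.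
have norm_lip (u v : R) : u <= v -> `| `|v| - `|u| | <= 1 * (v - u).
  by move=> uv; rewrite mul1r -[v - u]ger0_norm ?subr_ge0 //; exact: ler_dist_dist.
apply: (@lipschitz_glue _ (-2)) => //; last first.
  move=> {x y} x y hx xy; move: (x) (y) xy hx; clear x y.
  move=> x y xy hx.
  have [yp|py] := leP y 2; first by rewrite !LSKV_in ?Omt_lip //; lra.
  have [px|xp] := leP 2 x.
    by rewrite !LSKV_out ?norm_lip //; apply: le_trans (ler_norm _); lra.
  have e1 : `|LSKV 2 - LSKV x| <= 1 * (2 - x) by rewrite !LSKV_in ?Omt_lip //; lra.
  have e2 : `|LSKV y - LSKV 2| <= 1 * (y - 2).
    by rewrite !LSKV_out ?norm_lip //; [lra|rewrite normr_nat|apply: le_trans (ler_norm _); lra].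
  have -> : LSKV y - LSKV x = (LSKV y - LSKV 2) + (LSKV 2 - LSKV x) by ring.
  by apply: le_trans (ler_normD _ _) _; lra.
move=> u v uv hv; rewrite !LSKV_out ?norm_lip //; rewrite -normrN; apply: le_trans (ler_norm _); lra.
Qed.

Lemma LSKV_lip (x y : R) : `|LSKV y - LSKV x| <= `|y - x|.
Proof.
have [h|h] := leP x y.
  by rewrite [X in _ <= X]ger0_norm ?subr_ge0 // -[X in _ <= X]mul1r LSKV_lip_le.
rewrite distrC [X in _ <= X]distrC [X in _ <= X]gtr0_norm ?subr_gt0 //.
by rewrite -[X in _ <= X]mul1r LSKV_lip_le // ltW.
Qed.

End OmegaCont.

(** * Riemann sums of Lipschitz functions *)

Section Riemann.
Variable R : realType.
Implicit Types (h P : R -> R) (a b L : R).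

Definition lip_on h a b L := forall x y, a <= x -> x <= y -> y <= b -> `|h y - h x| <= L * (y - x).

(* All that a left Riemann sum needs of a primitive P of h; unlike            *)
(* differentiability, it passes to functions glued at a point.                *)
Definition prim_on P h a b L := forall x y, a <= x -> x <= y -> y <= b ->
  `|P y - P x - (y - x) * h x| <= L * (y - x) ^+ 2.

Lemma prim_MVT P h a b L : 0 <= L -> lip_on h a b L ->
  (forall x, a < x < b -> is_derive x 1 P (h x)) ->
  {within `[a, b], continuous P} -> prim_on P h a b L.
Proof.
move=> L0 lh dP cP x y ax xy yb.
have [||c] := @MVT_segment R P h x y xy.
- by move=> c; rewrite in_itv /= => /andP[h1 h2]; apply: dP; rewrite (le_lt_trans ax) ?(lt_le_trans h2).
- apply: continuous_subspaceW cP => z /=; rewrite !in_itv /= => /andP[h1 h2].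
  by rewrite (le_trans ax) ?(le_trans h2).
rewrite in_itv /= => /andP[xc cy] ->.
have -> : h c * (y - x) - (y - x) * h x = (h c - h x) * (y - x) by ring.
rewrite normrM [X in _ * X]ger0_norm ?subr_ge0 // expr2 mulrA ler_wpM2r ?subr_ge0 //.
apply: le_trans (lh x c ax xc (le_trans cy yb)) _.
by rewrite ler_wpM2l // lerB.
Qed.

Lemma prim_cst (c : R) h a b L : 0 <= L -> (forall x, a <= x <= b -> h x = 0) ->
  prim_on (fun=> c) h a b L.
Proof.
move=> L0 h0 x y ax xy yb; rewrite h0 ?ax ?(le_trans xy) //.
by rewrite subrr mulr0 subr0 normr0 mulr_ge0 // sqr_ge0.
Qed.

Definition piecewise2 (p : R) P Q (u : R) := if u <= p then P u else Q u.

(** Across [p] the extra error (y - p) (h p - h x) is at most L (y - p) (p - x), half of the cross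
    term of L (y - x)^2. *)
Lemma prim_glue p P Q h a b L : a <= p -> p <= b -> 0 <= L -> lip_on h a b L ->
  P p = Q p -> prim_on P h a p L -> prim_on Q h p b L -> prim_on (piecewise2 p P Q) h a b L.
Proof.
move=> ap pb L0 lh e hP hQ x y ax xy yb; rewrite /piecewise2.
have [yp|py] := leP y p; first by rewrite (le_trans xy yp); apply: hP.
have [xp|px] := leP x p; last by apply: hQ => //; exact: ltW.
have e1 := hP x p ax xp (lexx p); have e2 := hQ p y (lexx p) (ltW py) yb.
have e3 := lh x p ax xp pb.
have -> : Q y - P x - (y - x) * h x =
  (Q y - Q p - (y - p) * h p) + ((P p - P x - (p - x) * h x) + (y - p) * (h p - h x)).
  by rewrite e; ring.
apply: le_trans (ler_normD _ _) _; apply: le_trans (lerD e2 (ler_normD _ _)) _.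
have e4 : `|(y - p) * (h p - h x)| <= L * ((y - p) * (p - x)).
  by rewrite normrM gtr0_norm ?subr_gt0 // mulrCA ler_wpM2l // subr_ge0 ltW.
apply: le_trans (lerD (lexx _) (lerD e1 e4)) _.
have p1 : 0 <= y - p by rewrite subr_ge0 ltW.
have p2 : 0 <= p - x by rewrite subr_ge0.
have -> : y - x = (y - p) + (p - x) by ring.
move: (y - p) (p - x) p1 p2 => A B A0 B0.
have : 0 <= L * (A * B) by rewrite !mulr_ge0.
by rewrite !expr2; lra.
Qed.

Lemma riemann_sum P h a b L (M : nat) (d : R) : 0 <= d -> prim_on P h a b L ->
  a <= - (M%:R * d) -> M%:R * d <= b ->
  `|d * \sum_(k < M + M) h ((k%:R - M%:R) * d) - (P (M%:R * d) - P (- (M%:R * d)))|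
   <= (M + M)%:R * (L * d ^+ 2).
Proof.
move=> d0 prim ha hb.
have e : P (M%:R * d) - P (- (M%:R * d)) =
    \sum_(0 <= k < M + M) (P ((k.+1%:R - M%:R) * d) - P ((k%:R - M%:R) * d)).
  rewrite (telescope_sumr (fun k => P ((k%:R - M%:R) * d))) //.
  by rewrite natrD addrK sub0r mulNr.
rewrite e big_mkord mulr_sumr -sumrB; apply: le_trans (ler_norm_sum _ _ _) _.
have -> : (M + M)%:R * (L * d ^+ 2) = \sum_(k < M + M) L * d ^+ 2.
  by rewrite sumr_const card_ord mulr_natl.
apply: ler_sum => k _; rewrite distrC.
have kM : k.+1%:R <= M%:R + M%:R :> R by rewrite -natrD ler_nat.
have k0 : 0 <= k%:R :> R by [].
have kS : k.+1%:R = k%:R + 1 :> R by rewrite natr1.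
have := prim ((k%:R - M%:R) * d) ((k.+1%:R - M%:R) * d).
have -> : (k.+1%:R - M%:R) * d - (k%:R - M%:R) * d = d by rewrite kS; ring.
apply.
- by apply: le_trans ha _; rewrite -mulNr ler_wpM2r // lerDr.
- by rewrite ler_wpM2r // lerB // ler_nat.
- by apply: le_trans hb; rewrite ler_wpM2r // lerBlDr.
Qed.

End Riemann.

(** * The integral of the limit curve against (s - u)^-3 *)

Section Primitive.
Variable R : realType.
Variable s : R.
Hypothesis s14 : 14 <= s.

Let v (u : R) : R := (s - u)^-1.
Let r : R := Num.sqrt (s ^+ 2 - 4).

Let r_sq : r ^+ 2 = s ^+ 2 - 4.
Proof. by rewrite sqr_sqrtr //; have := s14; nra. Qed.

Let r_gt0 : 0 < r.
Proof. by rewrite sqrtr_gt0; have := s14; nra. Qed.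

Let v_gt0 u : u <= 11 -> 0 < v u.
Proof. by move=> h; rewrite invr_gt0 subr_gt0; have := s14; lra. Qed.

Let vE u : u <= 11 -> (s - u) * v u = 1.
Proof. by move=> h; rewrite mulfV // subr_eq0 gt_eqF //; have := s14; lra. Qed.

Let v_le u : u <= 11 -> v u <= 3^-1.
Proof. by move=> h; rewrite lef_pV2 ?posrE; have := s14; lra. Qed.

Let is_derive_v (u : R) : u <= 11 -> is_derive u 1 v (v u ^+ 2).
Proof.
move=> h; have nz : s - u != 0 by rewrite subr_eq0 gt_eqF //; have := s14; lra.
have d1 : is_derive u 1 (fun u : R => s - u) (-1).
  by apply: is_derive_eq; rewrite /GRing.scale /=; ring.
have d2 := is_deriveV (f := fun u : R => s - u) nz d1.
by apply: (is_derive_eq d2); rewrite /v exprVn /GRing.scale /= mulrN1 opprK.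
Qed.

Let v_cont (a b : R) : b <= 11 -> {within `[a, b], continuous v}.
Proof.
move=> hb; apply: derivable_within_continuous => x; rewrite in_itv /= => /andP[_ xb].
by apply: ex_derive; apply: is_derive_v; apply: le_trans hb.
Qed.

(** The Moebius map with pole [s] that sends -2 to -1 and 2 to 1. *)
Let w (u : R) : R := (s * u - 4) * v u / 2.

Let w_itv u : -2 <= u <= 2 -> -1 <= w u <= 1.
Proof.
move=> hu; have u11 : u <= 11 by lra.
have v0 := v_gt0 u11; have e := vE u11; have h := s14.
have e1 : w u + 1 = (s - 2) * (u + 2) * v u / 2.
  by rewrite [X in _ + X = _](esym e) /w; field.
have e2 : 1 - w u = (s + 2) * (2 - u) * v u / 2.
  by rewrite [X in X - _ = _](esym e) /w; field.
have p1 : 0 <= w u + 1 by rewrite e1 !mulr_ge0 //; lra.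
have p2 : 0 <= 1 - w u by rewrite e2 !mulr_ge0 //; lra.
by lra.
Qed.

Definition hs (u : R) : R := (LSKV u - `|u|) * (s - u) ^- 3.

Let hsE u : hs u = (LSKV u - `|u|) * v u ^+ 3.
Proof. by rewrite /hs /v exprVn. Qed.

Let dLN_lip (x y : R) : `|(LSKV y - `|y|) - (LSKV x - `|x|)| <= 2 * `|y - x|.
Proof.
have h1 := LSKV_lip x y; have h2 := ler_dist_dist y x.
have -> : LSKV y - `|y| - (LSKV x - `|x|) = (LSKV y - LSKV x) - (`|y| - `|x|) by ring.
by apply: le_trans (ler_normB _ _) _; lra.
Qed.

Let dLN_le (x : R) : -11 <= x <= 11 -> `|LSKV x - `|x| | <= 26.
Proof.
move=> hx; have h := dLN_lip 2 x.
have e : LSKV (2 : R) - `|2| = 0 by rewrite LSKV_out normr_nat // subrr.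
rewrite e subr0 in h; apply: le_trans h _.
have : `|x - 2| <= 13 by rewrite ler_norml; lra.
lra.
Qed.

(** 28 = 2 + 26: on [-11, 11], LSKV - |u| is 2-Lipschitz and bounded by 26, while (s - u)^-3 is
    1-Lipschitz and at most 1. *)
Let hs_lip : lip_on hs (-11) 11 28.
Proof.
move=> x y hx xy hy; rewrite !hsE.
have x11 := le_trans xy hy.
have hvx := v_le x11; have hvy := v_le hy; have vx := v_gt0 x11; have vy := v_gt0 hy.
have dl := dLN_lip x y; rewrite [X in _ <= _ * X]ger0_norm ?subr_ge0 // in dl.
have lx : `|LSKV x - `|x| | <= 26 by apply: dLN_le; rewrite hx x11.
have vd : v y - v x = (y - x) * (v x * v y).
  by rewrite -[v y in LHS]mul1r -(vE x11) -[v x in X in _ - X]mul1r -(vE hy); ring.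
have v3 : `|v y ^+ 3 - v x ^+ 3| <= y - x.
  have -> : v y ^+ 3 - v x ^+ 3 = (y - x) * (v x * v y * (v y ^+ 2 + v y * v x + v x ^+ 2)).
    have -> : v y ^+ 3 - v x ^+ 3 = (v y - v x) * (v y ^+ 2 + v y * v x + v x ^+ 2) by ring.
    by rewrite vd; ring.
  rewrite normrM ger0_norm ?subr_ge0 // ler_piMr ?subr_ge0 //.
  rewrite ger0_norm; last by rewrite ?(mulr_ge0, addr_ge0, sqr_ge0) // ltW.
  have a : v x * v y <= 1 by apply: mulr_ile1; lra.
  have b : v y ^+ 2 + v y * v x + v x ^+ 2 <= 1.
    have : v y ^+ 2 <= 3^-1 * 3^-1 by rewrite expr2 ler_pM // ltW.
    have : v x ^+ 2 <= 3^-1 * 3^-1 by rewrite expr2 ler_pM // ltW.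
    have : v y * v x <= 3^-1 * 3^-1 by rewrite ler_pM // ltW.
    lra.
  by apply: mulr_ile1 => //; rewrite ?(mulr_ge0, addr_ge0, sqr_ge0) // ltW.
have vy3 : 0 <= v y ^+ 3 <= 1.
  by rewrite exprn_ge0 ?(ltW vy) //= exprn_ile1 // ?ltW //; lra.
have -> : (LSKV y - `|y|) * v y ^+ 3 - (LSKV x - `|x|) * v x ^+ 3 =
  ((LSKV y - `|y|) - (LSKV x - `|x|)) * v y ^+ 3 + (LSKV x - `|x|) * (v y ^+ 3 - v x ^+ 3).
  by ring.
apply: le_trans (ler_normD _ _) _.
rewrite (normrM (LSKV y - _ - _)) (normrM (LSKV x - _)).
have t1 : `|LSKV y - `|y| - (LSKV x - `|x|)| * `|v y ^+ 3| <= 2 * (y - x) * 1.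
  by apply: ler_pM => //; rewrite ger0_norm; lra.
have t2 : `|LSKV x - `|x| | * `|v y ^+ 3 - v x ^+ 3| <= 26 * (y - x) by exact: ler_pM.
by apply: le_trans (lerD t1 t2) _; lra.
Qed.

(* Integrating by parts twice brings in dOm' = 2 / (pi sqrt (4 - u^2)); the   *)
(* remaining integral is the arcsine of a Moebius transform of u.             *)
Let A (u : R) : R := Omt u * (v u * v u) / 2 - dOm u * v u / 2 + asin (w u) / (pi * r).
(** A primitive of e u (s - u)^-3, to subtract the part of |u|: [e] is the sign of [u], and the
    constants [c] used in [P1] and [P2] make these agree at 0. *)
Let B (e c u : R) : R := e * u * (v u * v u) / 2 - e * v u / 2 + c.

Let is_derive_asin_w (u : R) : -2 < u < 2 ->
  is_derive u 1 (fun u => asin (w u)) (r * v u / Num.sqrt (4 - u ^+ 2)).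
Proof.
move=> hu; have u11 : u <= 11 by lra.
have v0 := v_gt0 u11; have e := vE u11; have h := s14; have dv := is_derive_v u11.
have q : 0 < 4 - u ^+ 2 by nra.
have dw : is_derive u 1 w ((s * v u + (s * u - 4) * v u ^+ 2) / 2).
  by apply: is_derive_eq; rewrite /GRing.scale /=; ring.
have e1 : w u + 1 = (s - 2) * (u + 2) * v u / 2.
  by rewrite [X in _ + X = _](esym e) /w; field.
have e2 : 1 - w u = (s + 2) * (2 - u) * v u / 2.
  by rewrite [X in X - _ = _](esym e) /w; field.
have hw : -1 < w u < 1.
  have p1 : 0 < w u + 1 by rewrite e1 !mulr_gt0 //; lra.
  have p2 : 0 < 1 - w u by rewrite e2 !mulr_gt0 //; lra.
  by lra.
have d := is_derive1_comp (f := @asin R) (g := w) (is_derive1_asin hw) dw.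
apply: (is_derive_eq d).
have -> : 1 - w u ^+ 2 = (r * v u / 2) ^+ 2 * (4 - u ^+ 2).
  have -> : 1 - w u ^+ 2 = (w u + 1) * (1 - w u) by ring.
  by rewrite e1 e2 !exprMn r_sq; field.
rewrite sqrtrM ?sqr_ge0 // sqrtr_sqr ger0_norm; last by rewrite !mulr_ge0 // ltW.
have -> : (s * v u + (s * u - 4) * v u ^+ 2) / 2 = r ^+ 2 * v u ^+ 2 / 2.
  rewrite r_sq; congr (_ / _).
  by rewrite -[s * v u]mulr1 -[X in _ * X + _]e; ring.
have q0 : 0 < Num.sqrt (4 - u ^+ 2) by rewrite sqrtr_gt0.
by move: v0 q0 r_gt0; move: (v u) (Num.sqrt _) (r) => a b c a0 b0 c0; field; rewrite !gt_eqF.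
Qed.

Let is_derive_A (u : R) : -2 < u < 2 -> is_derive u 1 A (Omt u * v u ^+ 3).
Proof.
move=> hu; have u11 : u <= 11 by lra.
have dv := is_derive_v u11; have dO := is_derive_Omt hu; have dd := is_derive_dOm hu.
have da := is_derive_asin_w hu.
have q : 0 < 4 - u ^+ 2 by nra.
have d : is_derive u 1 A (dOm u * (v u * v u) / 2 + Omt u * (2 * v u ^+ 3) / 2
    - (2 / (pi * Num.sqrt (4 - u ^+ 2)) * v u / 2 + dOm u * v u ^+ 2 / 2)
    + r * v u / Num.sqrt (4 - u ^+ 2) / (pi * r)).
  by apply: is_derive_eq; rewrite /GRing.scale /=; ring.
apply: (is_derive_eq d).
have := pi_gt0 R; have : 0 < Num.sqrt (4 - u ^+ 2) by rewrite sqrtr_gt0.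
move: r_gt0; move: (@pi R) (Num.sqrt _) (r) (v u) (Omt u) (dOm u) => p a b c d1 d2 b0 a0 p0.
by field; rewrite !gt_eqF.
Qed.

Let is_derive_B (e c u : R) : u <= 11 -> is_derive u 1 (B e c) (e * u * v u ^+ 3).
Proof.
move=> u11; have dv := is_derive_v u11.
have d : is_derive u 1 (B e c) (e * (v u * v u) / 2 + e * u * (2 * v u ^+ 3) / 2 - e * v u ^+ 2 / 2).
  by apply: is_derive_eq; rewrite /GRing.scale /=; ring.
by apply: (is_derive_eq d); field.
Qed.

Let A_cont : {within `[-2, 2], continuous A}.
Proof.
have vc : {within `[-2, 2], continuous v} by apply: v_cont; lra.
have wc : {within `[-2, 2], continuous w}.
  move=> x; apply: cvgMl; apply: cvgM; last exact: vc.
  apply: cvgB; last exact: cvg_cst.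
  by apply: cvgMr; apply: continuous_subspaceT => y; exact: cvg_id.
have ac : {within `[-2, 2], continuous (@asin R \o w)}.
  apply: (@segment_continuous_comp _ _ `[-1, 1]%classic); [|exact: wc|exact: asin_continuous].
  by move=> x /=; rewrite !in_itv /=; exact: w_itv.
move=> x; apply: cvgD; last by apply: cvgMl; exact: ac.
apply: cvgB; apply: cvgMl; apply: cvgM.
- exact: Omt_continuous.
- by apply: cvgM; exact: vc.
- exact: dOm_continuous.
- exact: vc.
Qed.

Let B_cont (e c a b : R) : b <= 11 -> {within `[a, b], continuous (B e c)}.
Proof.
move=> hb; apply: derivable_within_continuous => x; rewrite in_itv /= => /andP[_ xb].
by apply: ex_derive; apply: is_derive_B; apply: le_trans hb.
Qed.

Let P1 u := A u - B (-1) 0 u.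
Let P2 u := A u - B 1 s^-1 u.

Let prim_P1 : prim_on P1 hs (-2) 0 28.
Proof.
apply: prim_MVT; first exact: ler0n.
- by move=> x y hx xy hy; apply: hs_lip; lra.
- move=> x hx; have hx2 : -2 < x < 2 by lra.
  have dA := is_derive_A hx2; have x11 : x <= 11 by lra.
  have dB := is_derive_B (-1) 0 x11.
  apply: is_derive_eq; rewrite hsE LSKV_in; last by lra.
  by rewrite ler0_norm; [ring|lra].
- have cA : {within `[-2, 0], continuous A}.
    by apply: continuous_subspaceW A_cont => z /=; rewrite !in_itv /=; lra.
  have cB e c : {within `[-2, 0], continuous (B e c)} by apply: B_cont; lra.
  by move=> x; apply: cvgB; [exact: cA|exact: cB].
Qed.

Let prim_P2 : prim_on P2 hs 0 2 28.
Proof.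
apply: prim_MVT; first exact: ler0n.
- by move=> x y hx xy hy; apply: hs_lip; lra.
- move=> x hx; have hx2 : -2 < x < 2 by lra.
  have dA := is_derive_A hx2; have x11 : x <= 11 by lra.
  have dB := is_derive_B 1 s^-1 x11.
  apply: is_derive_eq; rewrite hsE LSKV_in; last by lra.
  by rewrite ger0_norm; [ring|lra].
- have cA : {within `[0, 2], continuous A}.
    by apply: continuous_subspaceW A_cont => z /=; rewrite !in_itv /=; lra.
  have cB e c : {within `[0, 2], continuous (B e c)} by apply: B_cont; lra.
  by move=> x; apply: cvgB; [exact: cA|exact: cB].
Qed.

Let P := piecewise2 (-2) (fun=> P1 (-2)) (piecewise2 0 P1 (piecewise2 2 P2 (fun=> P2 2))).

Let hs_out (x : R) : 2 <= `|x| -> hs x = 0.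
Proof. by move=> h; rewrite /hs LSKV_out // subrr mul0r. Qed.

Let prim_P : prim_on P hs (-11) 11 28.
Proof.
have sub a b : -11 <= a -> b <= 11 -> lip_on hs a b 28.
  by move=> ha hb x y hx xy hy; apply: hs_lip; lra.
apply: prim_glue; [lra|lra|lra|by apply: sub; lra| | |].
- by rewrite /piecewise2 ifT //; lra.
- apply: prim_cst => // x hx; apply: hs_out; rewrite ler0_norm; lra.
apply: prim_glue; [lra|lra|lra|by apply: sub; lra| |exact: prim_P1|].
- rewrite /piecewise2 ifT; last lra.
  rewrite /P1 /P2 /B.
  have -> : v 0 = s^-1 by rewrite /v subr0.
  by field; rewrite gt_eqF //; have := s14; lra.
apply: prim_glue; [lra|lra|lra|by apply: sub; lra|by []|exact: prim_P2|].
apply: prim_cst => // x hx; apply: hs_out; rewrite ger0_norm; lra.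
Qed.

(** At -2 and 2 everything cancels except the arcsine, equal to -pi / 2 and pi / 2 there, and the
    constant of [B]. The value is the limit in [bavg3_cvg]. *)
Let P_diff : P2 2 - P1 (-2) = r^-1 - s^-1.
Proof.
have h := s14.
have h2 : (2 : R) <= 11 by lra. have hN2 : (-2 : R) <= 11 by lra.
have w2 : w 2 = 1.
  rewrite /w; have := vE h2 => e; have -> : (s * 2 - 4) * v 2 / 2 = (s - 2) * v 2 by field.
  by [].
have wN2 : w (-2) = -1.
  rewrite /w; have := vE hN2 => e.
  have -> : (s * -2 - 4) * v (-2) / 2 = - ((s - -2) * v (-2)) by field.
  by rewrite e.
rewrite /P1 /P2 /A /B w2 wN2 asin1 asinN1 Omt_2 Omt_N2 dOm_2 dOm_N2.
have := pi_gt0 R; move: r_gt0; move: (@pi R) (r) (v 2) (v (-2)) (s^-1) => p a b c d a0 p0.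
by field; rewrite !gt_eqF.
Qed.

Lemma riemann_hs (M : nat) (d : R) : 0 <= d -> 10 <= M%:R * d <= 11 ->
  `|d * \sum_(k < M + M) hs ((k%:R - M%:R) * d) - ((Num.sqrt (s ^+ 2 - 4))^-1 - s^-1)|
   <= (M + M)%:R * (28 * d ^+ 2).
Proof.
move=> d0 hM; have := riemann_sum (M := M) d0 prim_P.
have -> : P (M%:R * d) = P2 2.
  by rewrite /P /piecewise2 !ifF //; apply/negbTE; rewrite -ltNge; lra.
have -> : P (- (M%:R * d)) = P1 (-2) by rewrite /P /piecewise2 ifT //; lra.
by rewrite P_diff; apply; lra.
Qed.

End Primitive.

(** * Convergence against polynomials and uniform convergence *)

Section Dsum.
Variable R : realType.

(* The nodes cover [-10, 10], which contains the support of typical shapes:   *)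
(* both first_row_tail and nrows_tail are effective beyond 9 sqrt n.          *)
Definition mesh n : nat := (Num.truncn (10 * Num.sqrt n%:R : R)).+1.

Lemma mesh_bounds n : (0 < n)%N ->
  10 * Num.sqrt n%:R <= (mesh n)%:R :> R /\ (mesh n)%:R <= 11 * Num.sqrt n%:R :> R.
Proof.
move=> n0; have rn1 : 1 <= Num.sqrt n%:R :> R.
  by rewrite -[X in X <= _]sqrtr1 ler_wsqrtr // ler1n.
have h : 0 <= 10 * Num.sqrt n%:R :> R by rewrite mulr_ge0 // sqrtr_ge0.
rewrite /mesh; have /andP[h1 h2] := truncn_itv h; split; first exact: ltW.
by rewrite -natr1; lra.
Qed.

Definition node n (k : nat) : R := (k%:R - (mesh n)%:R) / Num.sqrt n%:R.

Lemma node_itv n k : (0 < n)%N -> (k < mesh n + mesh n)%N -> -11 <= node n k <= 11.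
Proof.
move=> n0 lt_k; have [_ h] := mesh_bounds n0.
have r0 : 0 < Num.sqrt n%:R :> R by rewrite sqrtr_gt0 ltr0n.
rewrite /node ler_pdivlMr // ler_pdivrMr //.
have : k%:R <= (mesh n)%:R + (mesh n)%:R :> R by rewrite -natrD ler_nat ltnW.
have : 0 <= k%:R :> R by []. lra.
Qed.

(** A Riemann sum of step 1 / sqrt n for the integral of the difference of the curves against [F].
    Its nodes are integers before rescaling, where [profile_diag] gives the profile exactly. *)
Definition Dsum n (la : intpart n) (F : R -> R) : R :=
  (Num.sqrt n%:R)^-1 * \sum_(k < mesh n + mesh n)
    (rescaled_profile la (node n k) - LSKV (node n k)) * F (node n k).

(** 19/2 lies between the rate 9 of the tails and the half-width 10 that the nodes cover. *)
Definition typical n (la : intpart n) : Prop :=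
  [/\ (0 < n)%N, (rowlen la 0)%:R <= 19 / 2 * Num.sqrt n%:R :> R
    & (nrows la)%:R <= 19 / 2 * Num.sqrt n%:R :> R].

Lemma near_typical : \forall x \near whp R, typical (projT2 x).
Proof.
have K9 : 9 < 19 / 2 :> R by lra.
have H0 := whp_eventually (R := R) (nbhs_infty_gt 0).
refine (filterS3 _ _ H0 (whp_first_row K9) (whp_nrows K9)) => x n0 h1 h2; by split.
Qed.

Lemma rescaled_out n (la : intpart n) (u : R) : typical la -> 19 / 2 <= `|u| ->
  rescaled_profile la u = `|u|.
Proof.
move=> [n0 h1 h2] hu; rewrite /rescaled_profile.
have r0 : 0 < Num.sqrt n%:R :> R by rewrite sqrtr_gt0 ltr0n.
rewrite (profile_out h1 h2); last first.
  by rewrite normrM (gtr0_norm r0) mulrC ler_pM2l.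
by rewrite normrM (gtr0_norm r0) mulrC mulKf // gt_eqF.
Qed.

Lemma rescaled_lip n (la : intpart n) (u v : R) : (0 < n)%N ->
  `|rescaled_profile la u - rescaled_profile la v| <= `|u - v|.
Proof.
move=> n0; have r0 : 0 < Num.sqrt n%:R :> R by rewrite sqrtr_gt0 ltr0n.
rewrite /rescaled_profile -mulrBl normrM normfV (gtr0_norm r0) ler_pdivrMr //.
apply: le_trans (profile_lip _ _ _) _.
by rewrite -mulrBr normrM (gtr0_norm r0) mulrC.
Qed.

(** Both curves are 1-Lipschitz and agree at 10, whose distance to [u] is at most 21. *)
Lemma rescaled_LSKV_bound n (la : intpart n) (u : R) : typical la -> -11 <= u <= 11 ->
  `|rescaled_profile la u - LSKV u| <= 42.
Proof.
move=> t hu; have [n0 _ _] := t.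
have h10 : 19 / 2 <= `|10 : R| by rewrite normr_nat; lra.
have e1 := rescaled_out t h10; have e2 : LSKV (10 : R) = `|10| by rewrite LSKV_out // normr_nat ler_nat.
have l1 := rescaled_lip la u 10 n0; have l2 := LSKV_lip 10 u.
rewrite e1 in l1; rewrite e2 in l2.
have : `|u - 10| <= 21 by rewrite ler_norml; lra.
have -> : rescaled_profile la u - LSKV u =
  (rescaled_profile la u - `|10|) - (LSKV u - `|10|) by ring.
move=> h; apply: le_trans (ler_normB _ _) _; lra.
Qed.

Lemma Dsum_diff n (la : intpart n) (F G : R -> R) e : typical la -> 0 <= e ->
  (forall u, -11 <= u <= 11 -> `|F u - G u| <= e) ->
  `|Dsum la F - Dsum la G| <= 22 * 42 * e.
Proof.
move=> t e0 h; have [n0 _ _] := t.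
have r0 : 0 < Num.sqrt n%:R :> R by rewrite sqrtr_gt0 ltr0n.
rewrite /Dsum -mulrBr -sumrB normrM normfV (gtr0_norm r0) mulrC ler_pdivrMr //.
apply: le_trans (ler_norm_sum _ _ _) _.
apply: (@le_trans _ _ (\sum_(k < mesh n + mesh n) 42 * e)).
  apply: ler_sum => k _; rewrite -mulrBr normrM.
  have hk := node_itv n0 (ltn_ord k).
  by rewrite ler_pM //; [exact: rescaled_LSKV_bound|exact: h].
have -> : \sum_(k < mesh n + mesh n) 42 * e = ((mesh n)%:R + (mesh n)%:R) * (42 * e).
  by rewrite sumr_const card_ord -natrD [RHS]mulr_natl.
have [_ hM] := mesh_bounds n0.
have := ler_wpM2r e0 hM; lra.
Qed.

Lemma DsumD n (la : intpart n) (F G : R -> R) a b :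
  Dsum la (fun u => a * F u + b * G u) = a * Dsum la F + b * Dsum la G.
Proof.
rewrite /Dsum !mulr_sumr -big_split; apply: eq_bigr => k _ /=; ring.
Qed.

(** The factor 2 is the height of a rotated box: at a node, the rescaled profile exceeds |u| by 2 /
    sqrt n times the number of boxes of that content. *)
Lemma Dsum_bavg n (la : intpart n) (F : R -> R) : typical la ->
  Dsum la F = 2 * bavg la F - (Num.sqrt n%:R)^-1 * \sum_(k < mesh n + mesh n)
     (LSKV (node n k) - `|node n k|) * F (node n k).
Proof.
move=> [n0 h1 h2]; have r0 : 0 < Num.sqrt n%:R :> R by rewrite sqrtr_gt0 ltr0n.
have rn : n%:R = Num.sqrt n%:R * Num.sqrt n%:R :> R by rewrite -expr2 sqr_sqrtr.
have [hM _] := mesh_bounds n0.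
have m1 : (rowlen la 0 <= mesh n)%N by rewrite -(ler_nat R) (le_trans h1) // (le_trans _ hM) // ler_pM2r //; lra.
have m2 : (nrows la <= mesh n)%N by rewrite -(ler_nat R) (le_trans h2) // (le_trans _ hM) // ler_pM2r //; lra.
rewrite /bavg (bsum_diag _ m1 m2) /Dsum mulr_suml !mulr_sumr -sumrB.
apply: eq_bigr => k _; rewrite -/(node n k).
have -> : rescaled_profile la (node n k) =
    `|node n k| + 2 * (diag la (k - mesh n) (mesh n - k))%:R / Num.sqrt n%:R.
  have nodeE : Num.sqrt n%:R * node n k = k%:R - (mesh n)%:R.
    by rewrite /node mulrC divfK ?gt_eqF.
  rewrite /rescaled_profile nodeE.
  have [le_k|lt_k] := leqP (mesh n) k.
    have e0 : (mesh n - k)%N = 0%N by apply/eqP.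
    have := @profile_diag R n la (k - mesh n)%N (mesh n - k)%N; rewrite e0 orbT subr0 addr0 => /(_ isT).
    rewrite natrB // => ->.
    have p : 0 <= node n k by rewrite divr_ge0 ?subr_ge0 ?ler_nat // ltW.
    by rewrite (ger0_norm p) /node; ring.
  have e0 : (k - mesh n)%N = 0%N by apply/eqP/ltnW.
  have := @profile_diag R n la (k - mesh n)%N (mesh n - k)%N; rewrite e0 sub0r add0r => /(_ isT).
  rewrite (natrB _ (ltnW lt_k)) opprB => ->.
  have p : node n k <= 0 by rewrite ler_pdivrMr // mul0r subr_le0 ler_nat ltnW.
  by rewrite (ler0_norm p) /node; ring.
rewrite [X in 2 * (_ / X)]rn; field; by rewrite gt_eqF.
Qed.

Lemma inv_sqrt_eventually (e : R) : 0 < e ->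
  \forall n \near \oo, (Num.sqrt n%:R)^-1 < e.
Proof.
move=> e0; near=> n; have h : e^-1 < Num.sqrt n%:R by near: n; exact: near_sqrt_gt.
have ei : 0 < e^-1 by rewrite invr_gt0.
by rewrite -[X in _ < X]invrK ltf_pV2 ?posrE // (lt_trans ei).
Unshelve. all: by end_near. Qed.

Lemma mul_half_div (C e : R) : C != 0 -> C * (e / (2 * C)) = e / 2.
Proof. by move=> C0; field. Qed.

(** In [Dsum_bavg] both terms have the same limit, the first by [bavg3_cvg] and the second by
    [riemann_hs]. *)
Lemma Dsum_inv3 s : 14 <= s -> Dsum (projT2 x) (fun u => (s - u) ^- 3) @[x --> whp R] --> 0.
Proof.
move=> s14; apply/cvgrPdist_lt => e e0.
have /cvgrPdist_lt /(_ (e / 2)) := bavg3_cvg s14; rewrite divr_gt0 // => /(_ isT) H1.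
have H2 := near_typical.
(* The error of [riemann_hs] is 2 mesh 28 / n, with mesh <= 11 sqrt n. *)
have C0 : 0 < 56 * 11 :> R by rewrite mulr_gt0 // ltr0n.
have e3 : 0 < e / (2 * (56 * 11)) by rewrite divr_gt0 // mulr_gt0.
have H3 := whp_eventually (R := R) (inv_sqrt_eventually e3).
refine (filterS3 _ _ H1 H2 H3) => -[n la] /= h1 t h3.
have [n0 _ _] := t; rewrite sub0r normrN (Dsum_bavg _ t) -bavgZ.
have r0 : 0 < Num.sqrt n%:R :> R by rewrite sqrtr_gt0 ltr0n.
have [hM1 hM2] := mesh_bounds n0.
have d0 : 0 <= (Num.sqrt n%:R)^-1 :> R by rewrite invr_ge0 ltW.
have hM : 10 <= (mesh n)%:R * (Num.sqrt n%:R : R)^-1 <= 11.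
  by rewrite ler_pdivlMr // ler_pdivrMr // hM1.
have rs := riemann_hs s14 d0 hM; rewrite -/(hs s) in rs.
rewrite (_ : \sum_(k < _) _ = \sum_(k < mesh n + mesh n) hs s ((k%:R - (mesh n)%:R) / Num.sqrt n%:R)); last by [].
have b : (mesh n + mesh n)%:R * (28 * (Num.sqrt n%:R)^-1 ^+ 2) < e / 2.
  apply: (@le_lt_trans _ _ ((56 * 11) * (Num.sqrt n%:R)^-1)).
    rewrite natrD; have := ler_wpM2r d0 hM2; rewrite mulfK ?gt_eqF // => h.
    rewrite expr2 [X in X <= _](_ : _ = (56 * (Num.sqrt n%:R)^-1) * ((mesh n)%:R * (Num.sqrt n%:R)^-1)); last by ring.
    have := ler_wpM2l (mulr_ge0 (ler0n R 56) d0) h; lra.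
  have -> : e / 2 = (56 * 11) * (e / (2 * (56 * 11))).
    by rewrite mul_half_div // gt_eqF.
  by rewrite ltr_pM2l.
move: h1 rs b; move: (bavg _ _) (_ * \sum_(k < _) _) (_%:R * _) (_ - s^-1) => x y z l.
rewrite !ltr_norml !ler_norml; lra.
Qed.

Definition negligible (F : R -> R) := Dsum (projT2 x) F @[x --> whp R] --> (0 : R).

Lemma negligibleD F G a b : negligible F -> negligible G ->
  negligible (fun u => a * F u + b * G u).
Proof.
move=> hF hG; rewrite /negligible.
have -> : (fun x : {n & intpart n} => Dsum (projT2 x) (fun u => a * F u + b * G u)) =
   (fun x => a * Dsum (projT2 x) F + b * Dsum (projT2 x) G).
  by apply/funext => x; rewrite DsumD.
by rewrite -[0]addr0 -{1}[0](mulr0 a) -[X in _ + X](mulr0 b); apply: cvgD; apply: cvgMr.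
Qed.

Lemma negligible0 : negligible (fun=> 0).
Proof.
rewrite /negligible (_ : (fun x : {n & intpart n} => _) = fun=> 0); first exact: cvg_cst.
by apply/funext => x; rewrite /Dsum big1 ?mulr0 // => k _; rewrite mulr0.
Qed.

Lemma negligible_sum (I : Type) (r : seq I) (c : I -> R) (F : I -> R -> R) :
  (forall i, negligible (F i)) -> negligible (fun u => \sum_(i <- r) c i * F i u).
Proof.
move=> h; elim: r => [|i r IH].
  by under eq_fun do rewrite big_nil; exact: negligible0.
under eq_fun => u do rewrite big_cons -[X in _ + X]mul1r.
exact: negligibleD.
Qed.

Lemma negligible_unif F :
  (forall e, 0 < e -> exists2 G, negligible G & forall u, -11 <= u <= 11 -> `|F u - G u| <= e) ->
  negligible F.
Proof.
move=> h; apply/cvgrPdist_lt => e e0.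
have C0 : 0 < 22 * 42 :> R by rewrite mulr_gt0 // ltr0n.
have e1 : 0 < e / (2 * (22 * 42)) by rewrite divr_gt0 // mulr_gt0.
have [G /cvgrPdist_lt /(_ (e / 2)) hG FG] := h _ e1.
have H1 := hG (divr_gt0 e0 (ltr0n R 2)); have H2 := near_typical.
refine (filterS2 _ _ H1 H2) => -[n la] /= h1 t.
have := Dsum_diff t (ltW e1) FG; move: h1; rewrite !sub0r !normrN.
have -> : 22 * 42 * (e / (2 * (22 * 42))) = e / 2.
  by rewrite mul_half_div // gt_eqF.
rewrite !ltr_norml !ler_norml; lra.
Qed.

(** The Taylor coefficients of (1 - x)^-3 at 0; [qq] is the polynomial in the exact remainder of
    [inv3_expand]. *)
Let cc (k : nat) : R := (k%:R + 1) * (k%:R + 2) / 2.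
Let qq (k : nat) (x : R) : R := cc k - k%:R * (k%:R + 2) * x + k%:R * (k%:R + 1) / 2 * x ^+ 2.

Let inv3_expand (k : nat) (x : R) : x != 1 ->
  (1 - x) ^- 3 - \sum_(j < k) cc j * x ^+ j = x ^+ k * qq k x * (1 - x) ^- 3.
Proof.
move=> x1; have : 1 - x != 0 by rewrite subr_eq0 eq_sym.
have : x = 1 - (1 - x) by ring.
move: (1 - x) => y -> nz.
elim: k => [|k IH].
  by rewrite big_ord0 expr0 /qq /cc !mulr0n !mul0r !add0r !subr0 !addr0 !mul1r divff ?mul1r.
have e1 : k.+1%:R = k%:R + 1 :> R by rewrite natr1.
rewrite big_ord_recr /= opprD addrA IH [(1 - y) ^+ k.+1]exprS /qq /cc e1.
by move: (k%:R : R) ((1 - y) ^+ k) => a b; field.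
Qed.

(* For s large, s^(k+3) (s - u)^-3 expands in powers of u / s; subtracting    *)
(* the terms of degree < k leaves cc k u^k + O(1 / s).                        *)
Lemma negligibleX k : negligible (fun u => u ^+ k).
Proof.
elim/ltn_ind: k => k IH.
have cc_gt0 : 0 < cc k by rewrite /cc !mulr_gt0 ?invr_gt0 ?ltr_wpDl.
suff h : negligible (fun u => cc k * u ^+ k).
  have := negligibleD (cc k)^-1 0 h negligible0.
  by under eq_fun do rewrite mulKf ?gt_eqF // mul0r addr0.
apply: negligible_unif => e e0.
pose q1 := cc k.+1 + k.+1%:R * (k.+1%:R + 2) + k.+1%:R * (k.+1%:R + 1).
have q1_gt0 : 0 < q1.
  by rewrite /q1 /cc ltr_wpDr ?mulr_ge0 ?addr_ge0 // ltr_wpDr ?mulr_ge0 ?addr_ge0 // !mulr_gt0 ?invr_gt0 ?ltr_wpDl.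
(* The term 22 gives |u / s| <= 1/2 on [-11, 11], whence the bound 8 for (1 - x)^-3; the other term
   makes the remainder at most [e]. *)
pose s := 22 + 11 ^+ k.+1 * q1 * 8 / e.
have b0 : 0 <= 11 ^+ k.+1 * q1 * 8 / e by rewrite ?(mulr_ge0, invr_ge0, exprn_ge0) // ltW.
have s22 : 22 <= s by rewrite lerDl.
have s0 : 0 < s by lra.
have s14 : 14 <= s by lra.
exists (fun u => s ^+ (k + 3) * (s - u) ^- 3 + (-1) * \sum_(j < k) (cc j * s ^+ (k - j)) * u ^+ j).
  apply: negligibleD; first exact: Dsum_inv3.
  have := @negligible_sum 'I_k (index_enum _) (fun j => cc j * s ^+ (k - j)) (fun j u => u ^+ j).
  by apply=> j; exact: IH.
move=> u hu; pose x := u / s.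
have xb : `|x| <= 2^-1.
  rewrite normrM normfV (gtr0_norm s0) ler_pdivrMr // ler_norml; lra.
have x1 : x != 1 by apply/eqP => e1; move: xb; rewrite e1 normr1; lra.
have uE : u = s * x by rewrite /x mulrC divfK // gt_eqF.
have -> : s ^+ (k + 3) * (s - u) ^- 3 + (-1) * (\sum_(j < k) (cc j * s ^+ (k - j)) * u ^+ j) =
   s ^+ k * ((1 - x) ^- 3 - \sum_(j < k) cc j * x ^+ j).
  rewrite mulrBr mulN1r; congr (_ - _).
    rewrite exprD -mulrA; congr (_ * _); rewrite uE.
    have -> : s - s * x = s * (1 - x) by ring.
    by rewrite exprMn invfM mulrA mulfV ?mul1r // expf_neq0 // gt_eqF.
  rewrite mulr_sumr; apply: eq_bigr => j _; rewrite uE exprMn.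
  have -> : s ^+ k = s ^+ (k - j) * s ^+ j by rewrite -exprD subnK // ltnW.
  by move: (s ^+ (k - j)) (s ^+ j) (x ^+ j) (cc j) => a b c d; ring.
have -> : cc k * u ^+ k - s ^+ k * ((1 - x) ^- 3 - \sum_(j < k) cc j * x ^+ j) =
   - (s ^+ k * (x ^+ k.+1 * qq k.+1 x * (1 - x) ^- 3)).
  by rewrite -inv3_expand // big_ord_recr /= uE exprMn; ring.
rewrite normrN !normrM !normrX (gtr0_norm s0).
have q_le : `|qq k.+1 x| <= q1.
  have x2 : `|x ^+ 2| <= 1 by rewrite normrX exprn_ile1 // ; lra.
  rewrite /qq /q1; apply: le_trans (ler_normD _ _) _; apply: lerD.
    apply: le_trans (ler_normB _ _) _; apply: lerD.
      by rewrite ger0_norm // /cc !mulr_ge0 ?addr_ge0.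
    by rewrite normrM ger0_norm ?mulr_ge0 ?addr_ge0 // ler_piMr ?mulr_ge0 ?addr_ge0 //; lra.
  rewrite normrM ger0_norm ?mulr_ge0 ?addr_ge0 //.
  have h : 0 <= k.+1%:R * (k.+1%:R + 1) :> R by rewrite mulr_ge0 ?addr_ge0.
  by apply: le_trans (ler_wpM2l _ x2) _; lra.
have i_le : `|(1 - x) ^- 3| <= 8.
  have h : 2^-1 <= 1 - x by move: xb; rewrite ler_norml; lra.
  rewrite ger0_norm ?invr_ge0 ?exprn_ge0 //; last lra.
  have -> : 8 = (2^-1 ^+ 3)^-1 :> R by field.
  rewrite lef_pV2 ?posrE ?exprn_gt0 //; [|lra].
  by rewrite lerXn2r ?nnegrE //; lra.
have u_le : `|u| ^+ k.+1 <= 11 ^+ k.+1.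
  by rewrite lerXn2r ?nnegrE // ler_norml.
have xs : s ^+ k * `|x| ^+ k.+1 = `|u| ^+ k.+1 / s.
  have uN : `|u| = s * `|x| by rewrite [in LHS]uE [LHS]normrM (gtr0_norm s0).
  rewrite uN exprMn [s ^+ k.+1]exprS; move: (s ^+ k) (`|x| ^+ k.+1) => a b.
  by field; rewrite gt_eqF.
have -> : s ^+ k * (`|x| ^+ k.+1 * `|qq k.+1 x| * `|(1 - x) ^- 3|) =
   `|u| ^+ k.+1 * `|qq k.+1 x| * `|(1 - x) ^- 3| / s.
  by rewrite mulrA mulrA xs; ring.
rewrite ler_pdivrMr //; apply: (@le_trans _ _ (11 ^+ k.+1 * q1 * 8)).
  by rewrite !ler_pM // ?mulr_ge0 ?exprn_ge0.
have : e * s = e * 22 + 11 ^+ k.+1 * q1 * 8 by rewrite /s mulrDr [e * (_ / e)]mulrC divfK ?gt_eqF.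
by move=> ->; rewrite lerDr mulr_ge0 // ltW.
Qed.

Lemma negligible_poly (p : {poly R}) : negligible (fun u => p.[u]).
Proof.
under eq_fun => u do rewrite horner_coef.
have := @negligible_sum _ (index_enum _) (fun i : 'I_(size p) => p`_i) (fun i u => u ^+ i).
apply=> i; exact: negligibleX.
Qed.

End Dsum.

(** * Detecting a deviation with polynomial kernels *)

Lemma sum_window (R : numDomainType) (j0 J N : nat) : (j0 + J <= N)%N ->
  \sum_(k < N) ((j0 <= k < j0 + J)%N)%:R = J%:R :> R.
Proof.
move=> le_N.
rewrite -(big_mkord xpredT (fun k => ((j0 <= k < j0 + J)%N)%:R)).
rewrite (@big_cat_nat _ _ _ j0) //=; last exact: leq_trans (leq_addr _ _) le_N.
rewrite [X in _ + X](@big_cat_nat _ _ _ (j0 + J)) ?leq_addr //=.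
rewrite big_nat big1 ?add0r => [|k /andP[_ lt_k]]; last by rewrite [(j0 <= k)%N]leqNgt lt_k.
rewrite [X in _ + X]big_nat [X in _ + X]big1 ?addr0 => [|k /andP[le_k _]]; last first.
  by rewrite [(k < _)%N]ltnNge le_k andbF.
rewrite big_nat (eq_bigr (fun=> 1)) => [|k ->] //.
by rewrite -big_nat sumr_const_nat addnC addnK.
Qed.

Section Final.
Variable R : realType.
Implicit Types (n : nat) (u v s eta : R).

Lemma exists_geometric_gap (a1 a2 b c : R) : 0 <= a2 -> a2 < a1 -> 0 <= b -> 0 < c ->
  exists m, b * a2 ^+ m < c * a1 ^+ m.
Proof.
move=> a20 lt_a b0 c0; have a10 : 0 < a1 by exact: le_lt_trans lt_a.
have q1 : `|a2 / a1| < 1 by rewrite ger0_norm ?divr_ge0 ?(ltW a10) // ltr_pdivrMr // mul1r.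
have e0 : 0 < c / (b + 1) by rewrite divr_gt0 // ltr_wpDl.
have /cvgrPdist_lt /(_ _ e0) [m _ /(_ m (leqnn m))] /= := cvg_expr q1.
rewrite sub0r normrN ger0_norm ?exprn_ge0 ?divr_ge0 ?(ltW a10) // => h.
exists m; move: h; rewrite expr_div_n ltr_pdivrMr ?exprn_gt0 // => h.
have b1 : 0 < b + 1 by rewrite ltr_wpDl.
apply: (@le_lt_trans _ _ ((b + 1) * a2 ^+ m)).
  by rewrite ler_wpM2r ?exprn_ge0 // lerDl.
have := h; rewrite -(ltr_pM2l b1).
by rewrite [X in _ < X](_ : _ = ((b + 1) * (c / (b + 1))) * a1 ^+ m) ?mulrA // [(b + 1) * c]mulrC mulfK // gt_eqF.
Qed.

(* A polynomial kernel peaked at s: 22 exceeds the width of [-11, 11].        *)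
Definition bump m s : {poly R} := (1 - ((22^-1)%:P * ('X - s%:P)) ^+ 2) ^+ m.

Lemma bumpE m s u : (bump m s).[u] = (1 - ((u - s) / 22) ^+ 2) ^+ m.
Proof. by rewrite /bump !hornerE mulrC. Qed.

Lemma bump_ge m s u d : `|u - s| <= d -> d <= 22 ->
  (1 - (d / 22) ^+ 2) ^+ m <= (bump m s).[u].
Proof.
move=> hu hd; rewrite bumpE.
have d0 : 0 <= d by apply: le_trans hu.
have h1 : ((u - s) / 22) ^+ 2 <= (d / 22) ^+ 2.
  rewrite -[X in X <= _]real_normK ?num_real // lerXn2r ?nnegrE ?divr_ge0 //.
  by rewrite normrM normfV normr_nat ler_pM2r.
have h2 : (d / 22) ^+ 2 <= 1 by rewrite exprn_ile1 ?divr_ge0 // ler_pdivrMr // mul1r.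
by rewrite lerXn2r ?nnegrE // ?subr_ge0 // ?(le_trans h1) // lerD2l lerN2.
Qed.

Lemma bump_le m s u d : 0 <= d -> d <= `|u - s| -> `|u - s| <= 22 ->
  (bump m s).[u] <= (1 - (d / 22) ^+ 2) ^+ m.
Proof.
move=> d0 hd hu; rewrite bumpE.
have e : ((u - s) / 22) ^+ 2 = (`|u - s| / 22) ^+ 2.
  by rewrite -[LHS]real_normK ?num_real // normrM normfV normr_nat.
have h1 : (d / 22) ^+ 2 <= ((u - s) / 22) ^+ 2.
  by rewrite e lerXn2r ?nnegrE ?divr_ge0 // ler_pM2r.
have h2 : ((u - s) / 22) ^+ 2 <= 1.
  by rewrite e exprn_ile1 ?divr_ge0 // ler_pdivrMr // mul1r.
by rewrite lerXn2r ?nnegrE // ?subr_ge0 // ?(le_trans h1) // lerD2l lerN2.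
Qed.

(** As [D] is 2-Lipschitz, it is at least eta / 2 within eta / 8 of [s] and nonnegative within eta /
    4. Farther away it is at least -42, but there the kernel is smaller. At least eta sqrt n / 16
    nodes lie in the inner window, which gives the factor eta^2 / 32. *)
Lemma bump_detects n (D : R -> R) eta s m : (0 < n)%N -> 0 < eta -> eta <= 1 ->
  16 <= eta * Num.sqrt n%:R -> `|s| <= 39 / 4 ->
  (forall u v, D u <= D v + 2 * `|u - v|) ->
  (forall u, -11 <= u <= 11 -> -42 <= D u) -> 3 / 4 * eta <= D s ->
  eta ^+ 2 / 32 * (1 - (eta / 8 / 22) ^+ 2) ^+ m -
    22 * 42 * (1 - (eta / 4 / 22) ^+ 2) ^+ m <=
  (Num.sqrt n%:R)^-1 * \sum_(k < mesh R n + mesh R n) D (node R n k) * (bump m s).[node R n k].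
Proof.
move=> n0 e0 e1 rn16 hs lipD lowD Ds.
have r0 : 0 < Num.sqrt n%:R :> R by rewrite sqrtr_gt0 ltr0n.
have [hM1 hM2] := mesh_bounds R n0.
set rn := Num.sqrt n%:R in rn16 r0 hM1 hM2 *.
set q1 := (1 - (eta / 8 / 22) ^+ 2) ^+ m; set q2 := (1 - (eta / 4 / 22) ^+ 2) ^+ m.
have sq_le1 (x : R) : 0 <= x -> x <= 1 -> x ^+ 2 <= 1 by move=> x0 x1; rewrite exprn_ile1.
have q10 : 0 <= q1 by rewrite exprn_ge0 // subr_ge0 sq_le1 //; lra.
have q20 : 0 <= q2 by rewrite exprn_ge0 // subr_ge0 sq_le1 //; lra.
(* In units of the step, [c] is the position of [s] among the nodes and [h] the radius eta / 8; the
   [J] nodes that follow [c] form the window. As h >= 2, rounding down keeps J >= h / 2. *)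
pose c := s * rn + (mesh R n)%:R; pose h := eta * rn / 8.
have [s1 s2] : - (39 / 4) <= s /\ s <= 39 / 4 by move: hs; rewrite ler_norml => /andP[].
have sr1 := ler_wpM2r (ltW r0) s1; have sr2 := ler_wpM2r (ltW r0) s2.
have er := ler_wpM2r (ltW r0) e1.
have c0 : 0 <= c by rewrite /c; lra.
have h2 : 2 <= h by rewrite /h; lra.
have h0 : 0 <= h by lra.
have /andP[tc1 tc2] := truncn_itv c0; have /andP[th1 th2] := truncn_itv h0.
set j0 := (Num.truncn c).+1; set J := Num.truncn h.
have le_N : (j0 + J <= mesh R n + mesh R n)%N.
  rewrite -(ler_nat R) !natrD /j0 -natr1; move: tc1 th1; rewrite -/J /c /h => *; lra.
apply: (@le_trans _ _ (rn^-1 * \sum_(k < mesh R n + mesh R n)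
   (eta / 2 * q1 * ((j0 <= k < j0 + J)%N)%:R - 42 * q2))).
  rewrite sumrB -mulr_sumr (sum_window _ le_N) sumr_const card_ord -[_ *+ (_ + _)]mulr_natl natrD.
  rewrite [rn^-1 * _]mulrC ler_pdivlMr //.
  have hJ : h / 2 <= J%:R by move: th2; rewrite -/J -natr1; lra.
  have k1 := ler_wpM2l (mulr_ge0 (mulr_ge0 (ltW e0) (ltW (@ltr0Sn R 7))) q10) hJ.
  have k2 := ler_wpM2r q20 hM2.
  rewrite mulrBl; apply: lerB; last lra.
  have -> : eta ^+ 2 / 32 * q1 * rn = eta / 2 * q1 * (h / 2) by rewrite /h; field.
  by rewrite ler_wpM2l // mulr_ge0 // ; lra.
clear er sr1 sr2 hM1 hM2 c0 h2 th2 rn16 le_N.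
rewrite ler_pM2l ?invr_gt0 //; apply: ler_sum => k _.
have hk := node_itv (R := R) n0 (ltn_ord k).
set v := node R n k in hk *.
have vs22 : `|v - s| <= 22 by rewrite ler_norml; lra.
clear hs s1 s2.
have P0 : 0 <= (bump m s).[v].
  apply: le_trans (bump_ge m vs22 (lexx _)); rewrite exprn_ge0 // subr_ge0 sq_le1 //; lra.
have lipv := lipD s v; rewrite distrC in lipv.
have [/andP[w1 w2]|_] := boolP (j0 <= k < j0 + J)%N.
  have vE : (v - s) * rn = k%:R - c by rewrite /v /node /c mulrBl divfK ?gt_eqF //; ring.
  have le1 : (Num.truncn c)%:R + 1 <= k%:R :> R by rewrite natr1 ler_nat.
  have le2 : k%:R <= (Num.truncn c)%:R + J%:R :> R by rewrite -natrD ler_nat.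
  have close : `|v - s| <= eta / 8.
    rewrite -(ler_pM2r r0) -[X in _ * X <= _](gtr0_norm r0) -normrM vE.
    have k_gt : c < k%:R by apply: lt_le_trans tc2 _; rewrite -natr1.
    have k_le : k%:R <= c + h by apply: le_trans le2 _; apply: lerD.
    move: k_gt k_le; rewrite /h ler_norml => k_gt k_le.
    by apply/andP; split; lra.
  have P1 : q1 <= (bump m s).[v] by apply: bump_ge => //; lra.
  have Dv : eta / 2 <= D v by lra.
  by rewrite mulr1; have := ler_wpM2r P0 Dv; have := ler_wpM2l (ltW e0) P1; lra.
rewrite mulr0 add0r.
have [far|near] := leP (eta / 4) `|v - s|.
  have e4 : 0 <= eta / 4 by lra.
  have := bump_le m e4 far vs22; rewrite -/q2 => P2.
  have D42 := lowD _ hk; have := ler_wpM2r P0 D42; lra.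
apply: (@le_trans _ _ 0); first by rewrite oppr_le0 mulr_ge0.
by rewrite mulr_ge0 //; lra.
Qed.

(** The centres form a grid of step eta / 8 that depends on neither [n] nor [la]. It suffices to
    cover [-19/2, 19/2], outside which the curves agree; moving from [u] to the grid costs at most
    eta / 4 of the deviation. *)
Lemma profile_detected n (la : intpart n) eta u : typical R la ->
  0 < eta -> eta <= 1 -> 16 <= eta * Num.sqrt n%:R ->
  eta < `|rescaled_profile la u - LSKV u| ->
  exists i : 'I_(Num.truncn (160 / eta)).+1, forall m,
  eta ^+ 2 / 32 * (1 - (eta / 8 / 22) ^+ 2) ^+ m -
    22 * 42 * (1 - (eta / 4 / 22) ^+ 2) ^+ m <=
  `|Dsum la (fun v => (bump m (i%:R * (eta / 8) - 39 / 4)).[v])|.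
Proof.
move=> t e0 e1 e16 big_u; have [n0 _ _] := t.
pose D v := rescaled_profile la v - LSKV v.
have lipD v w : `|D v - D w| <= 2 * `|v - w|.
  have -> : D v - D w = (rescaled_profile la v - rescaled_profile la w) - (LSKV v - LSKV w).
    by rewrite /D; ring.
  apply: le_trans (ler_normB _ _) _.
  by have := rescaled_lip la v w n0; have := LSKV_lip w v; lra.
have u_le : `|u| <= 19 / 2.
  rewrite leNgt; apply/negP => /ltW hu; move: big_u.
  by rewrite (rescaled_out t hu) LSKV_out ?subrr ?normr0; lra.
have [u1 u2] : - (19 / 2) <= u /\ u <= 19 / 2 by move: u_le; rewrite ler_norml => /andP[].
have w0 : 0 <= (u + 39 / 4) / (eta / 8) by rewrite divr_ge0 //; lra.
have e8 : 0 < eta / 8 by lra.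
have /andP[ti1 ti2] := truncn_itv w0.
have lt_i : (Num.truncn ((u + 39 / 4) / (eta / 8)) < (Num.truncn (160 / eta)).+1)%N.
  rewrite ltnS le_truncn // ?ler_pdivrMr //.
  have -> : 160 / eta * (eta / 8) = 20 by field; rewrite gt_eqF.
  lra.
exists (Ordinal lt_i) => m; rewrite /=.
set i := Num.truncn _ in ti1 ti2 *; set s := i%:R * _ - _.
have su : `|u - s| <= eta / 8.
  move: ti1 ti2; rewrite ler_pdivlMr // ltr_pdivrMr // -[i.+1%:R]natr1 /s ler_norml => *; lra.
have s_le : `|s| <= 39 / 4 by move: su; rewrite !ler_norml; lra.
have := lipD u s; rewrite -/(D u) in big_u => Dus.
have lowD v : -11 <= v <= 11 -> `|D v| <= 42 by exact: rescaled_LSKV_bound.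
have [Du|Du] := leP 0 (D u).
  apply: le_trans (ler_norm _); apply: (@bump_detects n D) => //.
  - by move=> v w; have := lipD v w; rewrite ler_norml; lra.
  - by move=> v /lowD; rewrite ler_norml => /andP[].
  - by move: big_u Dus; rewrite (ger0_norm Du) ler_norml; lra.
(* A negative deviation is a positive one of - D. *)
rewrite -normrN; apply: le_trans (ler_norm _).
rewrite /Dsum -[leRHS]mulrN -sumrN.
under eq_bigr do rewrite -mulNr.
apply: (@bump_detects n (fun v => - D v)) => //.
- by move=> v w; have := lipD v w; rewrite ler_norml; lra.
- by move=> v /lowD; rewrite ler_norml => /andP[]; rewrite lerN2.
- by move: big_u Dus; rewrite (ltr0_norm Du) ler_norml; lra.
Qed.

(** For [m] large the kernel's mass near its centre outweighs the far loss. With this [m] fixed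
    there are finitely many kernels, all negligible by [negligible_poly], so with high probability
    none detects a deviation. *)
Lemma profile_uniform eta : 0 < eta -> eta <= 1 ->
  \forall x \near whp R, forall u,
    `|rescaled_profile (projT2 x) u - LSKV u| <= eta.
Proof.
move=> e0 e1.
have [m hm] : exists m, 22 * 42 * (1 - (eta / 4 / 22) ^+ 2) ^+ m <
   eta ^+ 2 / 32 * (1 - (eta / 8 / 22) ^+ 2) ^+ m.
  apply: exists_geometric_gap.
  - by rewrite subr_ge0 exprn_ile1 //; lra.
  - by rewrite ltrD2l ltrN2 ltrXn2r // ?nnegrE; lra.
  - by rewrite mulr_ge0.
  - by rewrite divr_gt0 // exprn_gt0.
have H (i : 'I_(Num.truncn (160 / eta)).+1) : \forall x \near whp R,
   `|Dsum (projT2 x) (fun v => (bump m (i%:R * (eta / 8) - 39 / 4)).[v])| <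
   eta ^+ 2 / 32 * (1 - (eta / 8 / 22) ^+ 2) ^+ m - 22 * 42 * (1 - (eta / 4 / 22) ^+ 2) ^+ m.
  have /cvgrPdist_lt := negligible_poly (bump m (i%:R * (eta / 8) - 39 / 4)).
  move=> /(_ _ (etrans (subr_gt0 _ _) hm)) h.
  refine (filterS _ h) => -[n la] /=; by rewrite sub0r normrN.
have H1 := @near_typical R; have H2 := filter_forall _ H.
have H3 := whp_eventually (R := R) (near_sqrt_gt (16 / eta)).
refine (filterS3 _ _ H1 (H2 _) H3) => -[n la] /= t hi hn u.
rewrite leNgt; apply/negP => big_u.
have rn16 : 16 <= eta * Num.sqrt n%:R.
  by move: hn; rewrite ltr_pdivrMr // mulrC => /ltW.
have [i /(_ m)] := profile_detected t e0 e1 rn16 big_u.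
by rewrite leNgt hi.
Qed.

End Final.

Theorem theorem10 (R : realType) (eps : R) (heps : 0 < eps) :
  (fun n : nat => gelfand R
     [set la : intpart n |
        (eps%:E <= sup_norm (fun s : R => rescaled_profile la s - LSKV s)%R)%E])
  @ \oo --> (0 : R).
Proof.
(* Strictly below [eps], because pointwise bounds by [eta] give only a supremum at most [eta]; at
   most 1 for [profile_uniform]. *)
pose eta := Num.min (eps / 2) 1.
have e0 : 0 < eta by rewrite lt_min ltr01 divr_gt0.
have e1 : eta <= 1 by rewrite ge_min lexx orbT.
have e2 : eta < eps.
  by apply: (@le_lt_trans _ _ (eps / 2)); [rewrite ge_min lexx|lra].
have h := profile_uniform e0 e1.
have : \forall x \near whp R,
    (sup_norm (fun s : R => rescaled_profile (projT2 x) s - LSKV s)%R < eps%:E)%E.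
  refine (filterS _ h) => -[n la] /= hu.
  apply: (@le_lt_trans _ _ eta%:E); last by rewrite lte_fin.
  by apply: ge_ereal_sup => _ [s _ <-]; rewrite lee_fin.
rewrite /prop_near1 /nbhs /= /whp /=; apply: cvg_trans.
rewrite /prop_near1 /nbhs /= /whp /= => cvg_h.
suff -> : (fun n => gelfand R [set la : intpart n |
      (eps%:E <= sup_norm (fun s : R => rescaled_profile la s - LSKV s)%R)%E]) =
    (fun n => gelfand R [set la : intpart n |
      ~ (sup_norm (fun s : R => rescaled_profile la s - LSKV s)%R < eps%:E)%E]) by [].
apply/funext => n; congr (gelfand R _); apply/seteqP.
by split=> la /=; rewrite leNgt => /negP.
Qed.
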